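(* Assume $1<\alpha<2$ and $0<\beta<\beta_\alpha$. For every $0<p<\alpha$, $$\lim_{N\to\infty}\mathbb E\Bigl|\frac1N\ln Z_N-\Bigl(\ln 2+\frac{\alpha}{2}\int_0^\infty\frac{\ln\cosh(\beta x)}{x^{\alpha+1}}\,dx\Bigr)\Bigr|^p=0 .$$
   Context: Lévy spin glass model. Let $0<\alpha<2$ and let $X$ be a symmetric real random variable with $\mathbb P(|X|>x)=L(x)/x^\alpha$ for all $x>0$, where $L:(0,\infty)\to(0,\infty)$ is slowly varying at $\infty$, i.e. $\lim_{x\to\infty}L(tx)/L(x)=1$ for every $t>0$. For $N\ge1$ set $a_N=\inf\{x>0: N\,\mathbb P(|X|>x)\le 1\}$ and $J=a_N^{-1}X$ ($a_N>0$ for all large $N$, and only large $N$ matter). Let $(J_{ij})_{1\le i<j\le N}$ be i.i.d. copies of $J$. For (inverse) temperature $\beta>0$ and $\sigma\in\{-1,1\}^N$ let $-H_N(\sigma)=\beta\sum_{1\le i<j\le N}J_{ij}\sigma_i\sigma_j$, and let $Z_N=\sum_{\sigma\in\{-1,1\}^N}e^{-H_N(\sigma)}$. The critical temperature is $\beta_\alpha=\Bigl(\alpha\int_0^\infty \frac{\tanh^2(x)}{x^{\alpha+1}}dx\Bigr)^{-1/\alpha}$. *)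

(* Defs.v *)
From HB Require Import structures.
From mathcomp Require Import all_boot all_order all_algebra.
From mathcomp Require Import all_classical all_reals all_analysis.

Set Implicit Arguments.
Unset Strict Implicit.
Unset Printing Implicit Defensive.

Import Order.TTheory GRing.Theory Num.Theory.
Import numFieldNormedType.Exports.

Local Open Scope classical_set_scope.
Local Open Scope ring_scope.

Definition cosh {R : realType} (x : R) : R := (expR x + expR (- x)) / 2.

Definition sinh {R : realType} (x : R) : R := (expR x - expR (- x)) / 2.

Definition tanh {R : realType} (x : R) : R := sinh x / cosh x.

(* The equality is only required on measurable sets: off the sigma-algebra the
   value of a measure is an arbitrary extended real. *)
Definition same_law {R : realType} {d1 d2 : measure_display}
    {T1 : measurableType d1} {T2 : measurableType d2}
    (P1 : probability T1 R) (P2 : probability T2 R)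
    (X1 : T1 -> R) (X2 : T2 -> R) : Prop :=
  forall A : set R, measurable A -> P1 (X1 @^-1` A) = P2 (X2 @^-1` A).

Definition symmetric_rv {R : realType} {d : measure_display}
    {T : measurableType d} (P : probability T R) (X : T -> R) : Prop :=
  same_law P P X (fun w => - X w).

(* Mutual independence of the subfamily (X i)_(i | D i). *)
Definition independent_rvs {R : realType} {d : measure_display}
    {T : measurableType d} (P : probability T R) (I : finType) (D : pred I)
    (X : I -> T -> R) : Prop :=
  forall (S : {set I}) (A : I -> set R),
    (forall i, i \in S -> D i) ->
    (forall i, i \in S -> measurable (A i)) ->
    P [set w | forall i, i \in S -> A i (X i w)] =
    (\prod_(i in S) P (X i @^-1` A i))%E.

Definition slowly_varying {R : realType} (L : R -> R) : Prop :=
  forall t : R, 0 < t -> L (t * x) / L x @[x --> +oo] --> (1 : R).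

(* The normalisation a_N.  It may vanish for small N, and then its inverse is 0 by
   the convention 0^-1 = 0. *)
Definition scale {R : realType} {d : measure_display} {T : measurableType d}
    (P : probability T R) (X : T -> R) (N : nat) : R :=
  inf [set x : R | 0 < x /\ (N%:R%:E * P [set w | (x < `|X w|)%R] <= 1)%E].

Section spin_glass.
Context {R : realType} (N : nat).

(* A configuration in {-1,1}^N is coded by booleans, with [true] for -1. *)
Definition spin (s : {ffun 'I_N -> bool}) (i : 'I_N) : R := (-1) ^+ s i.

Definition hamiltonian (beta : R) (J : 'I_N -> 'I_N -> R)
    (s : {ffun 'I_N -> bool}) : R :=
  - (beta * \sum_(i < N) \sum_(j < N | (i < j)%N) J i j * spin s i * spin s j).

Definition partition_function (beta : R) (J : 'I_N -> 'I_N -> R) : R :=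
  \sum_(s : {ffun 'I_N -> bool}) expR (- hamiltonian beta J s).

End spin_glass.

Definition beta_crit {R : realType} (alpha : R) : R :=
  (alpha * \int[lebesgue_measure]_(x in `]0, +oo[)
     (tanh x ^+ 2 / x `^ (alpha + 1))) `^ (- (1 / alpha)).

Definition limit_free_energy {R : realType} (alpha beta : R) : R :=
  ln 2 + alpha / 2 * \int[lebesgue_measure]_(x in `]0, +oo[)
     (ln (cosh (beta * x)) / x `^ (alpha + 1)).

(* Main.v *)
Require Import Defs.
From mathcomp Require Import all_boot all_order all_algebra.
From mathcomp Require Import all_classical all_reals all_analysis.
From mathcomp Require Import measurable_realfun ring lra.

Set Implicit Arguments.
Unset Strict Implicit.
Unset Printing Implicit Defensive.

Import Order.TTheory GRing.Theory Num.Theory.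
Import numFieldNormedType.Exports.

Local Open Scope classical_set_scope.
Local Open Scope ring_scope.

(** Expanding [expR x = cosh x * (1 + tanh x)] and its mirror image on every edge splits
[ln Z] into [N * ln 2], the sum of [lncosh (beta * J_ij)] over the edges, and the logarithm
of a normalised sum of products of [tanh] ([ln_gibbs_sum]). The limit comes from the second
term, a sum of about [N ^ 2 / 2] independent variables of mean about [Lambda / N], where
[Lambda] is the integral of [lncosh (beta * x)] against the Levy measure
[alpha * x ^ (- alpha - 1) dx]. The third term must be shown to be [o(N)].

The third term has mean 1 before the logarithm because the bonds are symmetric. Its second
moment is the mean, over two independent configurations, of a product over the edges, and is
bounded as soon as [N * E (tanh (beta * J) ^ 2)] stays below some [c < 1]
([overlap_bound]). That quantity tends to [(beta / beta_crit) ^ alpha]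
([tanh_moment_lt1]), so such a [c] exists for large [N] when [beta < beta_crit]. Two moments
bound the mean of the logarithm from below once its variance is known ([average_sqr_ln]),
and the variance follows from the Efron-Stein inequality ([efron_stein]), [ln Z] being
Lipschitz in each bond.

The variance estimates need bonds with a second moment, which heavy tails do not have. The
bonds are therefore cut at a large constant level [K]. The part above the level changes
[ln Z] by at most [beta] times a sum of independent nonnegative variables with a moment of
order [q] between [max 1 p] and [alpha], whose total is at most a small multiple of [N] in
the [L^q] sense ([average_far]). Convergence in [L^p] follows because the near part is
controlled in [L^2], the far part in [L^q], and [p] is smaller than both exponents
([powR_le_threshold], [finite_volume_bound]).

The probabilistic input is the behaviour of [N] times the law of the rescaled bond:
[tail_cvg] gives its limit, and [tail_domination], in the manner of Potter's bounds, an
integrable majorant. Expectations are integrals of tails by the layer-cake formula, so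
dominated convergence yields the limits of the moments ([jump_moment_cvg]) and a bound for
the far moment of order [q] ([jump_far_moment]).

Before the probabilistic estimates each bond is rounded to a finite grid, so fine that the
rounding errors of all bonds together are negligible ([grid_round_moment_cvg]). The law of
the rounded bonds is then a finite product ([edge_code_law]), and the variance and moment
estimates become statements about finite sums. *)

(** * Averages over finite product spaces *)

Section product_average.
Context {R : realType} {V E : finType} (mu : V -> R).

Definition average (G : {ffun E -> V} -> R) : R :=
  \sum_(f : {ffun E -> V}) (\prod_e mu (f e)) * G f.

Definition update (f : {ffun E -> V}) (e : E) (v : V) : {ffun E -> V} :=
  [ffun i => if i == e then v else f i].

Definition average_at (e : E) (G : {ffun E -> V} -> R) (f : {ffun E -> V}) : R :=
  \sum_v mu v * G (update f e v).

Lemma averageD G H : average (fun f => G f + H f) = average G + average H.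
Proof. by rewrite -big_split /=; apply: eq_bigr => f _; rewrite mulrDr. Qed.

Lemma averageZ c G : average (fun f => c * G f) = c * average G.
Proof. by rewrite mulr_sumr; apply: eq_bigr => f _; rewrite mulrCA. Qed.

Lemma averageZr c G : average (fun f => G f * c) = average G * c.
Proof. by rewrite mulr_suml; apply: eq_bigr => f _; rewrite mulrA. Qed.

Lemma average_sum (I : Type) (r : seq I) (P : pred I) (G : I -> {ffun E -> V} -> R) :
  average (fun f => \sum_(i <- r | P i) G i f) = \sum_(i <- r | P i) average (G i).
Proof.
by rewrite /average exchange_big /=; apply: eq_bigr => f _; rewrite mulr_sumr.
Qed.

Lemma average_prod (g : E -> V -> R) :
  average (fun f => \prod_e g e (f e)) = \prod_e \sum_v mu v * g e v.
Proof. by rewrite bigA_distr_bigA /=; apply: eq_bigr => f _; rewrite big_split. Qed.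

Lemma updateE f e v : update f e v e = v.
Proof. by rewrite ffunE eqxx. Qed.

Lemma update_neq f e v i : i != e -> update f e v i = f i.
Proof. by rewrite ffunE => /negbTE ->. Qed.

Lemma update_update f e u v : update (update f e u) e v = update f e v.
Proof. by apply/ffunP => i; rewrite !ffunE; case: (i == e). Qed.

Lemma update_id f e : update f e (f e) = f.
Proof. by apply/ffunP => i; rewrite !ffunE; case: eqP => // ->. Qed.

Lemma updateC f e e' u v : e != e' ->
  update (update f e u) e' v = update (update f e' v) e u.
Proof.
move=> ee'; apply/ffunP => i; rewrite !ffunE.
by case: (i =P e) => [->|_]; rewrite ?(negbTE ee')//; case: eqP.
Qed.

Hypothesis mu_ge0 : forall v, 0 <= mu v.
Hypothesis mu_sum1 : \sum_v mu v = 1.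

Lemma weight_ge0 (f : {ffun E -> V}) : 0 <= \prod_e mu (f e).
Proof. exact: prodr_ge0. Qed.

Lemma average_cst c : average (fun=> c) = c.
Proof.
have := average_prod (fun _ _ => 1).
under [X in _ = X -> _]eq_bigr do under eq_bigr do rewrite mulr1.
rewrite mu_sum1 big1_eq => h.
rewrite -[RHS]mulr1 -h -averageZ; apply: eq_bigr => f _.
by rewrite mulr1.
Qed.

Lemma le_average G H : (forall f, G f <= H f) -> average G <= average H.
Proof. by move=> GH; apply: ler_sum => f _; rewrite ler_wpM2l// weight_ge0. Qed.

Lemma average_ge0 G : (forall f, 0 <= G f) -> 0 <= average G.
Proof. by move=> G0; apply: sumr_ge0 => f _; rewrite mulr_ge0// weight_ge0. Qed.

Lemma averageB G H : average (fun f => G f - H f) = average G - average H.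
Proof.
rewrite -[- average H]mulN1r -averageZ -averageD.
by apply: eq_bigr => f _; rewrite mulN1r.
Qed.

(** Exchanging the coordinate [f e] with an independent copy [v] is an involution of the
pairs [(f, v)] which preserves their joint weight. *)
Lemma average_average_at e G : average (average_at e G) = average G.
Proof.
transitivity (\sum_(fv : {ffun E -> V} * V)
    ((\prod_i mu (fv.1 i)) * mu fv.2) * G (update fv.1 e fv.2)).
  rewrite -(pair_bigA _ (fun (f : {ffun E -> V}) v =>
    ((\prod_i mu (f i)) * mu v) * G (update f e v))) /=.
  by apply: eq_bigr => f _; rewrite mulr_sumr; apply: eq_bigr => v _; rewrite mulrA.
pose h (fv : {ffun E -> V} * V) := (update fv.1 e fv.2, fv.1 e).
have hK : involutive h.
  by case=> f v; rewrite /h /= update_update updateE update_id.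
rewrite (reindex_inj (inv_inj hK)) /=.
transitivity (\sum_(fv : {ffun E -> V} * V) ((\prod_i mu (fv.1 i)) * mu fv.2) * G fv.1).
  apply: eq_bigr => -[f v] _ /=; rewrite update_update update_id; congr (_ * _).
  rewrite (bigD1 e) //= [in RHS](bigD1 e) //= updateE.
  rewrite [RHS]mulrAC [mu (f e) * _]mulrC mulrAC; congr (_ * _).
  by apply: eq_bigr => i ie; rewrite update_neq.
rewrite -(pair_bigA _ (fun (f : {ffun E -> V}) v => ((\prod_i mu (f i)) * mu v) * G f)) /=.
by apply: eq_bigr => f _; rewrite -mulr_suml -mulr_sumr mu_sum1 mulr1.
Qed.

Lemma average_indep e (h : V -> R) G : (forall f v, G (update f e v) = G f) ->
  average (fun f => h (f e) * G f) = (\sum_v mu v * h v) * average G.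
Proof.
move=> hG; rewrite -(average_average_at e) -averageZ; apply: eq_bigr => f _.
congr (_ * _); rewrite /average_at mulr_suml.
by apply: eq_bigr => v _; rewrite updateE hG mulrA.
Qed.

Lemma average_coord e (h : V -> R) :
  average (fun f => h (f e)) = \sum_v mu v * h v.
Proof.
have := @average_indep e h (fun=> 1) (fun _ _ => erefl).
by rewrite average_cst mulr1 => <-; apply: eq_bigr => f _; rewrite mulr1.
Qed.

Lemma variance_average G :
  average (fun f => (G f - average G) ^+ 2) = average (fun f => G f ^+ 2) - average G ^+ 2.
Proof.
transitivity (average (fun f => G f ^+ 2 - 2 * average G * G f + average G ^+ 2)).
  by apply: eq_bigr => f _; congr (_ * _); ring.
by rewrite averageD averageB averageZ average_cst//; ring.
Qed.

Lemma sqr_average_le G : average G ^+ 2 <= average (fun f => G f ^+ 2).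
Proof.
by rewrite -subr_ge0 -variance_average average_ge0// => f; exact: sqr_ge0.
Qed.

End product_average.

Section efron_stein.
Context {R : realType} {V E : finType} (mu : V -> R) (x : V -> R) (c : R).
Hypothesis mu_ge0 : forall v, 0 <= mu v.
Hypothesis mu_sum1 : \sum_v mu v = 1.

Definition coord_lipschitz (G : {ffun E -> V} -> R) := forall f e u v,
  `|G (update f e u) - G (update f e v)| <= c * `|x u - x v|.

Let m2 := \sum_v mu v * x v ^+ 2.

Lemma coord_lipschitz_average_at e G :
  coord_lipschitz G -> coord_lipschitz (average_at mu e G).
Proof.
move=> LG f e' u v; rewrite /average_at -sumrB.
have [->|ee'] := eqVneq e e'.
  under eq_bigr do rewrite !update_update subrr.
  rewrite sumr_const mul0rn normr0; apply: le_trans (normr_ge0 _) (LG f e' u v).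
apply: le_trans (ler_norm_sum _ _ _) _.
rewrite -[leRHS]mul1r -mu_sum1 mulr_suml; apply: ler_sum => w _.
rewrite -mulrBr normrM ger0_norm// ler_wpM2l//.
by rewrite !(@updateC _ _ f e' e) ?LG// eq_sym.
Qed.

(** The variance in one coordinate is half the mean square of a difference of two
independent copies, and that mean square is monotone in the Lipschitz comparison with
[x]. *)
Lemma variance_at_le e G f : coord_lipschitz G ->
  average_at mu e (fun f => G f ^+ 2) f <= average_at mu e G f ^+ 2 + c ^+ 2 * m2.
Proof.
move=> LG; rewrite /average_at.
pose g v := G (update f e v).
have cross (h : V -> R) : \sum_u \sum_v mu u * mu v * (h u - h v) ^+ 2 =
    2 * (\sum_v mu v * h v ^+ 2 - (\sum_v mu v * h v) ^+ 2).
  transitivity (\sum_u (mu u * h u ^+ 2 - 2 * (mu u * h u) * (\sum_v mu v * h v)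
      + mu u * \sum_v mu v * h v ^+ 2)).
    apply: eq_bigr => u _; rewrite !mulr_sumr.
    have -> : mu u * h u ^+ 2 = \sum_v mu u * h u ^+ 2 * mu v.
      by rewrite -mulr_sumr mu_sum1 mulr1.
    rewrite -sumrB -big_split /=; apply: eq_bigr => v _; ring.
  rewrite big_split sumrB /= -!mulr_suml -mulr_sumr mu_sum1; ring.
have : \sum_u \sum_v mu u * mu v * (g u - g v) ^+ 2 <=
       c ^+ 2 * \sum_u \sum_v mu u * mu v * (x u - x v) ^+ 2.
  rewrite mulr_sumr; apply: ler_sum => u _; rewrite mulr_sumr; apply: ler_sum => v _.
  rewrite [leRHS]mulrCA ler_wpM2l ?mulr_ge0// -exprMn -[leLHS]real_normK ?num_real//.
  rewrite -[leRHS]real_normK ?num_real// lerXn2r ?nnegrE// normrM.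
  apply: le_trans (LG f e u v) _.
  by rewrite ler_wpM2r// ler_norm.
rewrite !cross// mulrCA ler_pM2l// -/m2 mulrBr.
have : 0 <= c ^+ 2 * (\sum_v mu v * x v) ^+ 2 by rewrite mulr_ge0 ?sqr_ge0.
rewrite -/(g _); lra.
Qed.

Let avgs (s : seq E) G := foldr (average_at mu) G s.

Let avgs_free (s : seq E) G e f v : e \in s -> avgs s G (update f e v) = avgs s G f.
Proof.
elim: s f => //= e' s IH f; rewrite inE => es.
rewrite /average_at; apply: eq_bigr => w _; congr (_ * _).
have [->|ee'] := eqVneq e e'; first by rewrite update_update.
rewrite updateC// IH//; first by move: es; rewrite (negbTE ee').
Qed.

(** The Efron-Stein inequality: averaging out one coordinate at a time lowers the
second moment of [G] by at most the variance in that coordinate. *)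
Lemma efron_stein G : coord_lipschitz G ->
  average mu (fun f => G f ^+ 2) - average mu G ^+ 2 <= c ^+ 2 * (#|E|%:R * m2).
Proof.
move=> LG.
have LGs s : coord_lipschitz (avgs s G).
  by elim: s => //= e s IH; exact: coord_lipschitz_average_at.
have step s : average mu (fun f => G f ^+ 2) <=
    average mu (fun f => avgs s G f ^+ 2) + (size s)%:R * (c ^+ 2 * m2).
  elim: s => [|e s IH] /=; first by rewrite mul0r addr0.
  apply: le_trans IH _; rewrite -(average_average_at mu_sum1 e) -natr1 mulrDl mul1r.
  rewrite [leRHS]addrCA [leRHS]addrC lerD2r -[X in _ <= _ + X](@average_cst _ _ E _ mu_sum1).
  rewrite -averageD; apply: le_average => // f; exact: variance_at_le.
have mean s : average mu (avgs s G) = average mu G.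
  by elim: s => //= e s <-; rewrite average_average_at.
have [f0 _|V0] := pickP (@predT {ffun E -> V}); last first.
  rewrite /average !big_pred0 // expr0n subr0 mulr_ge0 ?sqr_ge0// mulr_ge0//.
  by apply: sumr_ge0 => v _; rewrite mulr_ge0 ?sqr_ge0.
have cst f : avgs (enum E) G f = avgs (enum E) G f0.
  suff h (s : seq E) : avgs (enum E) G f =
      avgs (enum E) G [ffun e => if e \in s then f0 e else f e].
    rewrite (h (enum E)); congr avgs; apply/ffunP => e; by rewrite ffunE mem_enum.
  elim: s => [|e s ->]; first by congr avgs; apply/ffunP => e; rewrite ffunE.
  rewrite -(@avgs_free _ _ e _ (f0 e)) ?mem_enum//; congr avgs.
  apply/ffunP => i; rewrite !ffunE inE; by case: eqP => // ->.
have := step (enum E); have := mean (enum E).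
have -> : avgs (enum E) G = fun=> avgs (enum E) G f0 by apply/funext.
by rewrite -cardE !average_cst// => <-; rewrite lerBlDl mulrCA.
Qed.

End efron_stein.
(** * Hyperbolic functions and powers *)

Section hyperbolic.
Context {R : realType}.
Implicit Types x y : R.

Definition lncosh x : R := ln (cosh x).

Lemma cosh_gt0 x : 0 < cosh x.
Proof. by rewrite /cosh divr_gt0// addr_gt0 ?expR_gt0. Qed.

Lemma coshN x : cosh (- x) = cosh x.
Proof. by rewrite /cosh opprK addrC. Qed.

Lemma tanhN x : tanh (- x) = - tanh x.
Proof. by rewrite /tanh coshN /sinh opprK -[in LHS]opprB !mulNr. Qed.

Lemma cosh0 : cosh 0 = 1 :> R.
Proof. by rewrite /cosh oppr0 expR0; field. Qed.

Lemma tanh0 : tanh 0 = 0 :> R.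
Proof. by rewrite /tanh /sinh oppr0 subrr !mul0r. Qed.

Lemma lncosh0 : lncosh 0 = 0 :> R.
Proof. by rewrite /lncosh cosh0 ln1. Qed.

Lemma expR_pm_le_cosh (b : bool) x :
  expR ((-1) ^+ b * x) = cosh x * (1 + (-1) ^+ b * tanh x).
Proof.
rewrite mulrDr mulr1 mulrCA /tanh [cosh x * _]mulrC divfK ?gt_eqF ?cosh_gt0//.
by rewrite /cosh /sinh; case: b; rewrite ?expr1 ?expr0 ?mul1r ?mulN1r; field.
Qed.

Lemma tanh_bound x : `|tanh x| < 1.
Proof.
have h (b : bool) : 0 < 1 + (-1) ^+ b * tanh x.
  by rewrite -(pmulr_rgt0 _ (cosh_gt0 x)) -expR_pm_le_cosh expR_gt0.
by have := h false; have := h true; rewrite expr0 expr1 ltr_norml; lra.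
Qed.

Lemma sqr_tanh_le1 x : tanh x ^+ 2 <= 1.
Proof.
rewrite -[leLHS]real_normK ?num_real// exprn_ile1//.
exact: ltW (tanh_bound x).
Qed.

Lemma lncosh_lipschitz x y : `|lncosh x - lncosh y| <= `|x - y|.
Proof.
suff h u v : lncosh u - lncosh v <= `|u - v|.
  by rewrite ler_norml h lerNl opprB distrC h.
rewrite lerBlDr -[`|_|]expRK /lncosh -lnM ?posrE ?expR_gt0 ?cosh_gt0//.
rewrite ler_ln ?posrE ?cosh_gt0// ?(mulr_gt0 (expR_gt0 _) (cosh_gt0 _))// /cosh mulrA.
rewrite ler_pM2r ?invr_gt0// mulrDr -!expRD lerD// ler_expR.
- by rewrite -lerBlDr ler_norm.
- by rewrite -lerBlDr opprK addrC distrC ler_norm.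
Qed.

Lemma is_derive_cosh x : is_derive x 1 cosh (sinh x).
Proof.
have hN : is_derive x 1 (expR \o -%R) (expR (- x) * -1) by exact: is_derive1_comp.
rewrite [@cosh R](_ : _ = (fun z : R => 2^-1 *: (expR z + (expR \o -%R) z))).
  2: by apply/funext => z /=; rewrite /GRing.scale/= mulrC.
apply: is_derive_eq.
by rewrite /GRing.scale/= mulrN1 mulrC.
Qed.

Lemma is_derive_sinh x : is_derive x 1 sinh (cosh x).
Proof.
have hN : is_derive x 1 (expR \o -%R) (expR (- x) * -1) by exact: is_derive1_comp.
rewrite [@sinh R](_ : _ = (fun z : R => 2^-1 *: (expR z - (expR \o -%R) z))).
  2: by apply/funext => z /=; rewrite /GRing.scale/= mulrC.
apply: is_derive_eq.
by rewrite /GRing.scale/= mulrN1 opprK mulrC.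
Qed.

Lemma is_derive_tanh x : is_derive x 1 tanh (1 - tanh x ^+ 2).
Proof.
have c0 : cosh x != 0 by rewrite gt_eqF ?cosh_gt0.
have h1 := is_derive_cosh x; have h2 := is_derive_sinh x.
have h3 := is_deriveV c0 h1.
rewrite [tanh](_ : _ = fun y => sinh y * (cosh y)^-1)//.
apply: is_derive_eq.
rewrite /GRing.scale/= /tanh.
by move: (cosh x) (sinh x) c0 {h1 h2 h3} => c s c0; field.
Qed.

Lemma is_derive_lncosh x : is_derive x 1 lncosh (tanh x).
Proof.
have h1 := is_derive_cosh x; have h2 := is_derive1_ln (cosh_gt0 x).
have h : is_derive x 1 (@ln R \o @cosh R) ((cosh x)^-1 * sinh x) by exact: is_derive1_comp.
by rewrite /tanh mulrC.
Qed.

Lemma ge0_of_derive (f df : R -> R) x : f 0 = 0 ->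
  (forall y, is_derive y 1 f (df y)) -> (forall y, 0 <= y -> 0 <= df y) ->
  0 <= x -> 0 <= f x.
Proof.
move=> f0 fd df0 x0.
have fc : {within `[0, x], continuous f}.
  by apply: derivable_within_continuous => y _; exact: (@ex_derive _ _ _ _ _ _ _ (fd y)).
have [c] := MVT_segment x0 (fun y _ => fd y) fc.
by rewrite in_itv/= => /andP[c0 _]; rewrite f0 !subr0 => ->; rewrite mulr_ge0 ?df0.
Qed.

Lemma tanh_ge0 x : 0 <= x -> 0 <= tanh x.
Proof.
apply: (ge0_of_derive tanh0 is_derive_tanh) => y _.
by rewrite subr_ge0 sqr_tanh_le1.
Qed.

Lemma tanh_le_id x : 0 <= x -> tanh x <= x.
Proof.
move=> x0; rewrite -subr_ge0.
refine (@ge0_of_derive (fun y => y - tanh y) (fun y => tanh y ^+ 2) x _ _ _ x0).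
- by rewrite tanh0 subr0.
- by move=> y; have h := is_derive_tanh y; apply: is_derive_eq; rewrite opprB addrC subrK.
- by move=> y _; exact: sqr_ge0.
Qed.

Lemma tanh_le_minr1 x : 0 <= x -> tanh x <= Num.min x 1.
Proof.
move=> x0; rewrite le_min tanh_le_id//=.
exact: le_trans (ler_norm _) (ltW (tanh_bound x)).
Qed.

Lemma lncosh_ge0 x : 0 <= lncosh x.
Proof.
wlog x0 : x / 0 <= x => [h|].
  have [/h//|/ltW x0] := leP 0 x; rewrite /lncosh -coshN; apply: h.
  by rewrite oppr_ge0.
by apply: (ge0_of_derive lncosh0 is_derive_lncosh) => // y; exact: tanh_ge0.
Qed.

Lemma cosh_le_expR_sqr x : cosh x <= expR (x ^+ 2 / 2).
Proof.
wlog x0 : x / 0 <= x => [h|].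
  have [/h//|/ltW x0] := leP 0 x; rewrite -coshN -sqrrN; apply: h.
  by rewrite oppr_ge0.
rewrite -[leLHS]lnK ?posrE ?cosh_gt0// ler_expR -subr_ge0.
refine (@ge0_of_derive (fun y => y ^+ 2 / 2 - lncosh y) (fun y => y - tanh y) x _ _ _ x0).
- by rewrite lncosh0 expr0n mul0r subr0.
- move=> y; have h := is_derive_lncosh y.
  rewrite (_ : (fun _ => _) = (fun y => 2^-1 *: (y ^+ 2) - lncosh y)).
    by apply: is_derive_eq; rewrite /GRing.scale/=; field.
  by apply/funext => z; rewrite mulrC.
- by move=> y y0; rewrite subr_ge0 tanh_le_id.
Qed.

Lemma cosh_le x y : 0 <= x -> x <= y -> cosh x <= cosh y.
Proof.
move=> x0 xy; rewrite -ler_ln ?posrE ?cosh_gt0// -!/(lncosh _).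
have fc : {within `[x, y], continuous lncosh}.
  by apply: derivable_within_continuous => z _; exact: (@ex_derive _ _ _ _ _ _ _ (is_derive_lncosh z)).
have [c + /eqP] := MVT_segment xy (fun z _ => is_derive_lncosh z) fc.
rewrite in_itv/= => /andP[xc _]; rewrite subr_eq => /eqP ->.
by rewrite lerDr mulr_ge0 ?subr_ge0// tanh_ge0// (le_trans x0).
Qed.

(** [x <= sinh x], written with [tanh]. *)
Lemma le_cosh_tanh x : 0 <= x -> x <= cosh x * tanh x.
Proof.
have tE y : cosh y * tanh y = sinh y by rewrite /tanh mulrC divfK ?gt_eqF ?cosh_gt0.
move=> x0; rewrite tE -subr_ge0.
refine (@ge0_of_derive (fun y => sinh y - y) (fun y => cosh y - 1) x _ _ _ x0).
- by rewrite -tE tanh0 mulr0 subr0.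
- by move=> y; have h := is_derive_sinh y; apply: is_derive_eq.
- by move=> y y0; rewrite subr_ge0 -cosh0 cosh_le.
Qed.

Lemma sqr_le_tanh (K : R) x : `|x| <= K -> x ^+ 2 <= cosh K ^+ 2 * tanh x ^+ 2.
Proof.
wlog x0 : x / 0 <= x => [h|].
  have [/h//|/ltW x0] := leP 0 x; rewrite -normrN -sqrrN => /h.
  by rewrite tanhN (sqrrN (tanh x)); apply; rewrite oppr_ge0.
rewrite ger0_norm// => xK.
have h : x <= cosh K * tanh x.
  by apply: le_trans (le_cosh_tanh x0) _; rewrite ler_wpM2r ?tanh_ge0// cosh_le.
by rewrite -exprMn lerXn2r// nnegrE// (le_trans x0).
Qed.

Lemma tanh_mono x y : 0 <= x -> x <= y -> tanh x <= tanh y.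
Proof.
move=> x0 xy; have fc : {within `[x, y], continuous tanh}.
  by apply: derivable_within_continuous => z _; exact: (@ex_derive _ _ _ _ _ _ _ (is_derive_tanh z)).
have [c + /eqP] := MVT_segment xy (fun z _ => is_derive_tanh z) fc.
rewrite in_itv/= => /andP[xc _]; rewrite subr_eq => /eqP ->.
by rewrite lerDr mulr_ge0 ?subr_ge0// sqr_tanh_le1.
Qed.

Lemma sqr_tanh_mono x y : `|x| <= `|y| -> tanh x ^+ 2 <= tanh y ^+ 2.
Proof.
have h (z : R) : tanh z ^+ 2 = tanh `|z| ^+ 2.
  by have [z0|z0] := lerP 0 z; rewrite ?(ger0_norm z0)// ltr0_norm// tanhN sqrrN.
move=> xy; rewrite h [leRHS]h lerXn2r ?nnegrE ?tanh_ge0//.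
exact: tanh_mono.
Qed.

End hyperbolic.

Section powers.
Context {R : realType}.
Implicit Types x y a r : R.

Lemma le_powR2r r x y : 0 <= r -> 0 <= x -> x <= y -> x `^ r <= y `^ r.
Proof.
by move=> r0 x0 xy; rewrite ge0_ler_powR// nnegrE// (le_trans x0).
Qed.

Lemma powR2_lt (r s : R) : r < s -> 2 `^ r < 2 `^ s.
Proof.
move=> rs; rewrite lt_neqAle ler_powR ?ler1n ?(ltW rs)// andbT.
apply/negP => /eqP h; have : 1 < 2 `^ (s - r) :> R.
  rewrite -[ltLHS](_ : 1 `^ (s - r) = 1); last by rewrite powR1.
  by rewrite gt0_ltr_powR ?nnegrE ?subr_gt0// ltr1n.
by rewrite powRB ?pnatr_eq0 ?implybT// h divff ?ltxx// gt_eqF// powR_gt0.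
Qed.

Lemma powRN_le r x y : 0 <= r -> 0 < x -> x <= y -> y `^ (- r) <= x `^ (- r).
Proof.
move=> r0 x0 xy; rewrite !powRN lef_pV2 ?posrE ?powR_gt0//; last exact: lt_le_trans xy.
by rewrite le_powR2r// ltW.
Qed.

Lemma powRN_div (x s r : R) : 0 < x -> 0 < s -> (x / s) `^ (- r) = s `^ r * x `^ (- r).
Proof.
move=> x0 s0; rewrite powRM ?ltW ?invr_gt0// mulrC; congr (_ * _).
by rewrite -powR_inv1 ?ltW// -powRrM mulN1r opprK.
Qed.

Lemma powRD_le r x y : 0 <= r <= 1 -> 0 <= x -> 0 <= y ->
  (x + y) `^ r <= x `^ r + y `^ r.
Proof.
move=> /andP[r0 r1] x0 y0.
have [->|s0] := eqVneq (x + y) 0.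
  have [->|rn0] := eqVneq r 0; first by rewrite !powRr0; lra.
  by rewrite powR0// addr_ge0 ?powR_ge0.
have s_gt0 : 0 < x + y by rewrite lt_def s0 addr_ge0.
have h (z : R) : 0 <= z -> z <= x + y -> z / (x + y) * (x + y) `^ r <= z `^ r.
  move=> z0 zs; have [->|zn0] := eqVneq z 0; first by rewrite !mul0r powR_ge0.
  have z_gt0 : 0 < z by rewrite lt_def zn0.
  have -> : z `^ r = (z / (x + y)) `^ r * (x + y) `^ r.
    by rewrite -powRM ?divfK// ?divr_ge0// ltW.
  rewrite ler_wpM2r ?powR_ge0// -[leLHS]powRr1 ?divr_ge0 ?(ltW s_gt0)//.
  by rewrite ger_powR// divr_gt0//= ler_pdivrMr// mul1r.
have -> : (x + y) `^ r = x / (x + y) * (x + y) `^ r + y / (x + y) * (x + y) `^ r.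
  by rewrite -mulrDl -mulrDl divff// mul1r.
by rewrite lerD// h ?lerDl ?lerDr.
Qed.

Lemma powR_le_linear r x a : 0 <= r <= 1 -> 0 <= x -> 0 < a ->
  x `^ r <= a `^ r * (1 + x / a).
Proof.
move=> /andP[r0 r1] x0 a0.
have [xa|ax] := leP x a.
  rewrite -[leLHS]mulr1 ler_pM ?powR_ge0//; first exact: le_powR2r.
  by rewrite lerDl divr_ge0// ltW.
have -> : x = a * (x / a) by rewrite mulrC divfK// gt_eqF.
rewrite powRM ?divr_ge0 ?(ltW a0)// ler_wpM2l ?powR_ge0//.
apply: (@le_trans _ _ (x / a)); last by rewrite [a * _]mulrC divfK ?gt_eqF// lerDr.
by rewrite ler1_powR// ler_pdivlMr// mul1r ltW.
Qed.

(** The first term alone suffices up to [eps], the second beyond. *)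
Lemma powR_le_threshold (p q eps : R) x : 0 < p <= q -> 0 < eps -> 0 <= x ->
  x `^ p <= eps `^ p + eps `^ (p - q) * x `^ q.
Proof.
move=> /andP[p0 pq] e0 x0; have [xe|ex] := leP x eps.
  by rewrite (le_trans (le_powR2r (ltW p0) x0 xe))// lerDl mulr_ge0 ?powR_ge0.
apply: (@le_trans _ _ (eps `^ (p - q) * x `^ q)); last by rewrite lerDr powR_ge0.
have x_gt0 := lt_trans e0 ex.
have -> : x `^ p = x `^ (p - q) * x `^ q.
  by rewrite -powRD ?subrK// gt_eqF ?implybT.
rewrite ler_wpM2r ?powR_ge0// -opprB !powRN lef_pV2 ?posrE ?powR_gt0//.
by rewrite le_powR2r ?subr_ge0 ?(ltW e0) ?(ltW ex).
Qed.

(** Through the maximum of the four numbers, which works for [p < 1] and [1 <= p] alike. *)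
Lemma powR_sum4_le (p x y z t : R) : 0 <= p -> 0 <= x -> 0 <= y -> 0 <= z -> 0 <= t ->
  (x + y + z + t) `^ p <= 4 `^ p * (x `^ p + y `^ p + z `^ p + t `^ p).
Proof.
move=> p0 x0 y0 z0 t0.
pose m := Num.max (Num.max x y) (Num.max z t).
have mp : m `^ p <= x `^ p + y `^ p + z `^ p + t `^ p.
  have := (powR_ge0 x p, powR_ge0 y p, powR_ge0 z p, powR_ge0 t p) => -[[[]]].
  by rewrite /m [Num.max (Num.max _ _) _]maxEle; case: ifP => _; rewrite maxEle;
    case: ifP => _; lra.
have [mx my mz mt] : [/\ x <= m, y <= m, z <= m & t <= m] by rewrite /m !le_max !lexx !orbT.
apply: (@le_trans _ _ ((4 * m) `^ p)).
  by apply: le_powR2r; rewrite ?addr_ge0//; lra.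
rewrite powRM//; last by rewrite /m !le_max x0.
by rewrite ler_wpM2l ?powR_ge0.
Qed.

End powers.
(** * Moments in a finite product space *)

Section product_moments.
Context {R : realType} {V E : finType} (mu : V -> R).
Hypothesis mu_ge0 : forall v, 0 <= mu v.
Hypothesis mu_sum1 : \sum_v mu v = 1.
Local Notation avg := (@average R V E mu).

(** Writing [S ^ q] as the sum over [e] of [w (f e) * S ^ (q - 1)] and splitting
[S = w (f e) + T] by subadditivity of the power [q - 1 <= 1] leaves the independent
product [w (f e) * T ^ (q - 1)], whose second factor is concave in [T] and so is at most
an affine function of [T] fixed by the level [a]. *)
Lemma average_powR_sum (w : V -> R) (q a : R) :
  (forall v, 0 <= w v) -> 1 <= q <= 2 -> 0 < a ->
  #|E|%:R * (\sum_v mu v * w v) <= a ->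
  avg (fun f => (\sum_e w (f e)) `^ q) <=
  #|E|%:R * (\sum_v mu v * w v `^ q) +
  2 * (#|E|%:R * (\sum_v mu v * w v)) * a `^ (q - 1).
Proof.
move=> w0 /andP[q1 q2] a0 ma.
have q0 : 0 < q by lra.
have r01 : 0 <= q - 1 <= 1 by lra.
pose T (e : E) (f : {ffun E -> V}) := \sum_(i | i != e) w (f i).
have T0 e f : 0 <= T e f by apply: sumr_ge0.
have pointwise (f : {ffun E -> V}) : (\sum_e w (f e)) `^ q <=
    \sum_e (w (f e) `^ q + w (f e) * T e f `^ (q - 1)).
  rewrite -mulr_powRB1 ?sumr_ge0// mulr_suml; apply: ler_sum => e _.
  rewrite (bigD1 e)//= -/(T e f).
  apply: le_trans (ler_wpM2l (w0 _) (powRD_le r01 (w0 _) (T0 e f))) _.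
  by rewrite mulrDr mulr_powRB1.
apply: le_trans (le_average mu_ge0 pointwise) _.
have hq e : avg (fun f => w (f e) `^ q) = \sum_v mu v * w v `^ q.
  exact: (average_coord mu_sum1 e (fun v => w v `^ q)).
rewrite average_sum; under eq_bigr do rewrite averageD hq.
rewrite big_split /= sumr_const -[X in X + _]mulr_natl lerD2l.
have ha e : avg (fun f => w (f e) * T e f `^ (q - 1)) <=
    (\sum_v mu v * w v) * (a `^ (q - 1) * 2).
  rewrite (@average_indep _ _ _ _ mu_sum1 e w (fun f => T e f `^ (q - 1))); last first.
    by move=> f v; congr (_ `^ _); apply: eq_bigr => i ie; rewrite update_neq.
  rewrite ler_wpM2l//; first by apply: sumr_ge0 => v _; rewrite mulr_ge0.
  apply: (@le_trans _ _ (avg (fun f => a `^ (q - 1) * (1 + T e f / a)))).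
    by apply: le_average => // f; exact: powR_le_linear.
  rewrite averageZ averageD average_cst// ler_wpM2l ?powR_ge0//.
  rewrite (_ : 2 = 1 + 1 :> R); last by ring.
  rewrite lerD2l averageZr ler_pdivrMr// mul1r average_sum.
  apply: le_trans _ ma; under eq_bigr do rewrite (average_coord mu_sum1 _ w).
  rewrite mulr_natl -[leRHS]sumr_const [leRHS](bigD1 e)//= lerDr.
  by apply: sumr_ge0 => v _; rewrite mulr_ge0.
apply: le_trans (ler_sum _ (fun e _ => ha e)) _.
by rewrite sumr_const -[leLHS]mulr_natl le_eqVlt; apply/orP; left; apply/eqP; ring.
Qed.

(** A lower bound on the mean of [ln Z] from two moments of [Z] and the variance of
[ln Z]: were the mean [a] below [- ln 2 - b], every [f] with [1 / 2 <= Z f] would lie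
at distance [b] from the mean of [ln Z], and such [f] have probability of order [1 / C]. *)
Lemma average_sqr_ln (Z : {ffun E -> V} -> R) (C v : R) : (forall f, 0 < Z f) -> avg Z = 1 ->
  avg (fun f => Z f ^+ 2) <= C ->
  avg (fun f => ln (Z f) ^+ 2) - avg (fun f => ln (Z f)) ^+ 2 <= v ->
  avg (fun f => ln (Z f) ^+ 2) <= v + 8 * C * v + 2.
Proof.
move=> Z0 Z1 Z2 vZ; pose a := avg (fun f => ln (Z f)).
have C1 : 1 <= C.
  by apply: le_trans Z2; rewrite -(expr1n _ 2) -Z1; exact: sqr_average_le.
have v0 : 0 <= v by apply: le_trans vZ; rewrite subr_ge0; exact: sqr_average_le.
have a0 : a <= 0.
  have -> : 0 = avg (fun f => Z f - 1) by rewrite averageB average_cst// Z1 subrr.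
  apply: le_average => // f.
  have := @le_ln1Dx R (Z f - 1); rewrite (addrC 1) subrK; apply.
  by rewrite ltrBrDr addNr.
have [ln2_ge0 ln2_le1] : 0 <= ln 2 :> R /\ ln 2 <= 1 :> R.
  split; first by rewrite ln_ge0// ler1n.
  by have := @le_ln1Dx R 1; apply; lra.
suff : a ^+ 2 <= 8 * C * v + 2 by move: vZ; rewrite -/a; lra.
have [ha|ha] := leP (- ln 2) a.
  have : a ^+ 2 <= ln 2 ^+ 2 by rewrite -sqrrN lerXn2r ?nnegrE; lra.
  have : ln 2 ^+ 2 <= 1 :> R by rewrite exprn_ile1; lra.
  have : 0 <= C * v by rewrite mulr_ge0//; lra.
  lra.
pose b := - ln 2 - a; have b0 : 0 < b by rewrite /b; lra.
(* The polynomial replaces the indicator of [1 / 2 <= Z]: it is nonpositive below [1 / 2],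
at most [C] everywhere, and has mean at least [1 / 4] by the two moments of [Z]. *)
have pointwise f : b ^+ 2 * (Z f - 2^-1 - Z f ^+ 2 / (4 * C)) <= C * (ln (Z f) - a) ^+ 2.
  have [hZ|hZ] := ltP (Z f) 2^-1.
    apply: (@le_trans _ _ 0); last by rewrite mulr_ge0 ?sqr_ge0//; lra.
    rewrite mulr_ge0_le0 ?sqr_ge0//.
    have : 0 <= Z f ^+ 2 / (4 * C) by rewrite divr_ge0 ?sqr_ge0//; lra.
    lra.
  have hb : b ^+ 2 <= (ln (Z f) - a) ^+ 2.
    have : - ln 2 <= ln (Z f) by rewrite -lnV ?posrE// ler_ln ?posrE ?invr_gt0.
    by move=> h; rewrite lerXn2r ?nnegrE /b//; lra.
  have hC : Z f - 2^-1 - Z f ^+ 2 / (4 * C) <= C.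
    suff : 0 <= (Z f - 2 * C) ^+ 2 / (4 * C).
      have -> : (Z f - 2 * C) ^+ 2 / (4 * C) = Z f ^+ 2 / (4 * C) - Z f + C.
        by field; lra.
      lra.
    by rewrite divr_ge0 ?sqr_ge0//; lra.
  rewrite mulrC; apply: (@le_trans _ _ (C * b ^+ 2)); first by rewrite ler_wpM2r ?sqr_ge0.
  by rewrite ler_wpM2l//; lra.
have := le_average mu_ge0 pointwise.
rewrite !averageZ (variance_average mu_sum1) averageB averageZr averageB average_cst// Z1.
have : avg (fun f => Z f ^+ 2) / (4 * C) <= 4^-1.
  by rewrite ler_pdivrMr ?mulrA ?mulVf ?mul1r//; lra.
set t := _ / (4 * C); rewrite -/a; set u := _ - a ^+ 2 => ht hu.
have {hu} : b ^+ 2 * 4^-1 <= C * v.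
  apply: le_trans (_ : C * u <= _); last by rewrite ler_wpM2l//; lra.
  by apply: le_trans hu; rewrite ler_wpM2l ?sqr_ge0//; lra.
have -> : a = - (b + ln 2) by rewrite /b; ring.
have : ln 2 ^+ 2 <= 1 :> R by rewrite exprn_ile1; lra.
have := sqr_ge0 (b - ln 2); nra.
Qed.

End product_moments.
(** * Partition functions with signed bonds *)

Section gibbs.
Context {R : realType} {S E : finType} (bond : S -> E -> bool).
Hypothesis S_gt0 : (0 < #|S|)%N.
Implicit Types y z : E -> R.

Definition gibbs_sum y : R := \sum_s expR (\sum_e (-1) ^+ bond s e * y e).

(** The factor left over when [expR (+- y e) = cosh (y e) * (1 +- tanh (y e))] is expanded
on every bond. *)
Definition tanh_sum y : R :=
  #|S|%:R^-1 * \sum_s \prod_e (1 + (-1) ^+ bond s e * tanh (y e)).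

Lemma card_gt0r : 0 < #|S|%:R :> R.
Proof. by rewrite ltr0n. Qed.

Lemma bond_factor_gt0 y s e : 0 < 1 + (-1) ^+ bond s e * tanh (y e).
Proof.
by rewrite -(pmulr_rgt0 _ (cosh_gt0 (y e))) -expR_pm_le_cosh expR_gt0.
Qed.

Lemma sum_pos_gt0 (F : S -> R) : (forall s, 0 < F s) -> 0 < \sum_s F s.
Proof.
move=> F0; have /card_gt0P[s0 _] := S_gt0.
by rewrite (bigD1 s0)//= ltr_pwDl// sumr_ge0// => s _; exact: ltW.
Qed.

Lemma tanh_sum_gt0 y : 0 < tanh_sum y.
Proof.
rewrite mulr_gt0 ?invr_gt0 ?card_gt0r// sum_pos_gt0// => s.
by rewrite prodr_gt0// => e _; exact: bond_factor_gt0.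
Qed.

Lemma gibbs_sum_gt0 y : 0 < gibbs_sum y.
Proof. by apply: sum_pos_gt0 => s; exact: expR_gt0. Qed.

Lemma ln_gibbs_sum y :
  ln (gibbs_sum y) = ln #|S|%:R + \sum_e lncosh (y e) + ln (tanh_sum y).
Proof.
have hc : 0 < \prod_e cosh (y e) by rewrite prodr_gt0// => e _; exact: cosh_gt0.
have lnprod : ln (\prod_e cosh (y e)) = \sum_e lncosh (y e).
  apply: (@expR_inj R); rewrite lnK ?posrE// expR_sum.
  by apply: eq_bigr => e _; rewrite lnK ?posrE ?cosh_gt0.
have hS := card_gt0r.
rewrite -lnprod -lnM ?posrE// -lnM ?posrE ?tanh_sum_gt0 ?(mulr_gt0 hS hc)//.
congr (ln _); rewrite /tanh_sum mulrCA mulrA mulrA mulVf ?gt_eqF// mul1r mulr_sumr.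
apply: eq_bigr => s _; rewrite expR_sum -big_split /=.
by apply: eq_bigr => e _; rewrite expR_pm_le_cosh.
Qed.

Lemma ln_gibbs_sum_lipschitz y z :
  `|ln (gibbs_sum y) - ln (gibbs_sum z)| <= \sum_e `|y e - z e|.
Proof.
suff h u v : ln (gibbs_sum u) - ln (gibbs_sum v) <= \sum_e `|u e - v e|.
  rewrite ler_norml h andbT lerNl opprB.
  by under eq_bigr do rewrite distrC; exact: h.
rewrite lerBlDr -[X in X + _]expRK -lnM ?posrE ?expR_gt0 ?gibbs_sum_gt0//.
rewrite ler_ln ?posrE ?gibbs_sum_gt0// ?(mulr_gt0 (expR_gt0 _) (gibbs_sum_gt0 _))//.
rewrite mulr_sumr; apply: ler_sum => s _; rewrite -expRD ler_expR.
rewrite -big_split /=; apply: ler_sum => e _; rewrite -lerBlDr -mulrBr.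
by apply: le_trans (ler_norm _) _; rewrite normrM normrX normrN1 expr1n mul1r.
Qed.

Section random_bonds.
Context {V : finType} (mu x : V -> R).
Hypothesis mu_ge0 : forall v, 0 <= mu v.
Hypothesis mu_sum1 : \sum_v mu v = 1.
Hypothesis tanh_centred : \sum_v mu v * tanh (x v) = 0.
Local Notation avg := (@average R V E mu).
Local Notation tau := (\sum_v mu v * tanh (x v) ^+ 2).

Lemma average_tanh_sum : avg (fun f => tanh_sum (x \o f)) = 1.
Proof.
rewrite averageZ average_sum.
under eq_bigr do rewrite (average_prod mu (fun e v => 1 + (-1) ^+ bond _ e * tanh (x v))).
rewrite (eq_bigr (fun=> 1)) => [|s _].
  by rewrite sumr_const mulVf// gt_eqF// card_gt0r.
rewrite big1// => e _; under eq_bigr do rewrite mulrDr mulr1 mulrCA.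
by rewrite big_split /= -mulr_sumr tanh_centred mulr0 addr0.
Qed.

(** Two configurations [s] and [t] see the same bonds, whence the product of the two signs. *)
Lemma average_sqr_tanh_sum : avg (fun f => tanh_sum (x \o f) ^+ 2) =
  #|S|%:R^-1 ^+ 2 * \sum_s \sum_t \prod_e (1 + (-1) ^+ (bond s e (+) bond t e) * tau).
Proof.
have sqE y : tanh_sum y ^+ 2 = #|S|%:R^-1 ^+ 2 * \sum_s \sum_t \prod_e
    ((1 + (-1) ^+ bond s e * tanh (y e)) * (1 + (-1) ^+ bond t e * tanh (y e))).
  rewrite /tanh_sum exprMn; congr (_ * _); rewrite expr2 mulr_suml.
  by apply: eq_bigr => s _; rewrite mulr_sumr; apply: eq_bigr => t _; rewrite big_split.
under [X in average _ X]eq_fun do rewrite sqE.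
rewrite averageZ average_sum; congr (_ * _); apply: eq_bigr => s _.
rewrite average_sum; apply: eq_bigr => t _.
rewrite (average_prod mu (fun e v =>
  (1 + (-1) ^+ bond s e * tanh (x v)) * (1 + (-1) ^+ bond t e * tanh (x v)))).
apply: eq_bigr => e _; rewrite signr_addb.
set a := (-1) ^+ bond s e; set b := (-1) ^+ bond t e.
transitivity (\sum_v (mu v + (a + b) * (mu v * tanh (x v)) + a * b * (mu v * tanh (x v) ^+ 2))).
  by apply: eq_bigr => v _; ring.
by rewrite !big_split /= -!mulr_sumr tanh_centred mu_sum1 mulr0 addr0.
Qed.

(** Both [\sum_e lncosh (x (f e))] and [ln (tanh_sum (x \o f))] are Lipschitz in each bond, so
the Efron-Stein inequality bounds their variances by multiples of [A]. The mean of the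
first is explicit, and that of the second is controlled by [average_sqr_ln], where [C]
bounds the second moment of [tanh_sum]. *)
Lemma average_sqr_ln_gibbs_sum (C A : R) :
  A = #|E|%:R * (\sum_v mu v * x v ^+ 2) ->
  \sum_s \sum_t \prod_e (1 + (-1) ^+ (bond s e (+) bond t e) * tau) <= C * #|S|%:R ^+ 2 ->
  avg (fun f => (ln (gibbs_sum (x \o f))
      - (ln #|S|%:R + #|E|%:R * (\sum_v mu v * lncosh (x v)))) ^+ 2)
  <= 10 * A + 64 * C * A + 4.
Proof.
move=> AE overlap.
pose G (f : {ffun E -> V}) := \sum_e lncosh (x (f e)).
pose F (f : {ffun E -> V}) := ln (tanh_sum (x \o f)).
have upd_dist (f : {ffun E -> V}) e u v :
    \sum_i `|x (update f e u i) - x (update f e v i)| = `|x u - x v|.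
  rewrite (bigD1 e)//= !updateE big1 ?addr0// => i ie.
  by rewrite !update_neq// subrr normr0.
have lipG : coord_lipschitz x 1 G.
  move=> f e u v; rewrite mul1r -(upd_dist f e) -sumrB.
  apply: le_trans (ler_norm_sum _ _ _) _.
  by apply: ler_sum => i _; exact: lncosh_lipschitz.
have lipF : coord_lipschitz x 2 F.
  have FE f : F f = ln (gibbs_sum (x \o f)) - ln #|S|%:R - G f.
    by rewrite ln_gibbs_sum /G /F; ring.
  move=> f e u v; rewrite !FE [X in `|X|](_ : _ =
    (ln (gibbs_sum (x \o update f e u)) - ln (gibbs_sum (x \o update f e v))) -
    (G (update f e u) - G (update f e v))); last by ring.
  apply: le_trans (ler_normB _ _) _; rewrite mulr_natl mulr2n lerD//.
    by rewrite -(upd_dist f e); exact: ln_gibbs_sum_lipschitz.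
  by have := lipG f e u v; rewrite mul1r.
have meanG : avg G = #|E|%:R * \sum_v mu v * lncosh (x v).
  rewrite average_sum.
  under eq_bigr do rewrite (average_coord mu_sum1 _ (fun v => lncosh (x v))).
  by rewrite sumr_const [RHS]mulr_natl.
have varG := efron_stein mu_ge0 mu_sum1 lipG.
have varF := efron_stein mu_ge0 mu_sum1 lipF.
have := average_sqr_ln mu_ge0 mu_sum1 (fun f => tanh_sum_gt0 (x \o f))
  average_tanh_sum _ varF.
have hC : avg (fun f => tanh_sum (x \o f) ^+ 2) <= C.
  rewrite average_sqr_tanh_sum exprVn mulrC ler_pdivrMr ?exprn_gt0 ?card_gt0r//.
move=> /(_ _ hC); rewrite -AE => hF.
have pointwise (f : {ffun E -> V}) : (ln (gibbs_sum (x \o f))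
      - (ln #|S|%:R + #|E|%:R * (\sum_v mu v * lncosh (x v)))) ^+ 2 <=
    2 * (F f ^+ 2) + 2 * ((G f - avg G) ^+ 2).
  rewrite meanG ln_gibbs_sum -/(F f) -/(G f).
  set m := _ * (\sum_v mu v * lncosh _); have := sqr_ge0 (F f - (G f - m)).
  nra.
apply: le_trans (le_average mu_ge0 pointwise) _.
rewrite averageD !averageZ (variance_average mu_sum1).
by move: varG hF; rewrite -AE expr1n mul1r; lra.
Qed.

End random_bonds.
End gibbs.
(** * The overlap of two independent configurations *)

Section overlap.
Context {R : realType} (n : nat).
Local Notation config := {ffun 'I_n -> bool}.

Definition edge := {e : 'I_n * 'I_n | (e.1 < e.2)%N}.

Definition edge_sign (s : config) (e : edge) : bool :=
  s (val e).1 (+) s (val e).2.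

Lemma sum_edge (F : 'I_n -> 'I_n -> R) :
  \sum_(e : edge) F (val e).1 (val e).2 = \sum_(i < n) \sum_(j < n | (i < j)%N) F i j.
Proof.
rewrite pair_big_dep /=.
by rewrite -(big_sub (fun e : 'I_n * 'I_n => (e.1 < e.2)%N) (fun e => F e.1 e.2)).
Qed.

Lemma card_edge_le : (#|{: edge}| <= n ^ 2)%N.
Proof.
rewrite card_sig; apply: leq_trans (max_card _) _.
by rewrite card_prod card_ord expnS expn1.
Qed.

Definition magnetization (s : config) : R := \sum_i (-1) ^+ s i.

Lemma sqr_magnetization s :
  magnetization s ^+ 2 = n%:R + 2 * \sum_(e : edge) (-1) ^+ edge_sign s e.
Proof.
pose a i : R := (-1) ^+ s i.
have -> : \sum_(e : edge) (-1) ^+ edge_sign s e =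
    \sum_(i < n) \sum_(j < n | (i < j)%N) a i * a j.
  rewrite -(sum_edge (fun i j => a i * a j)); apply: eq_bigr => e _.
  by rewrite /edge_sign signr_addb.
have swap : \sum_(i < n) \sum_(j < n | (j < i)%N) a i * a j =
    \sum_(i < n) \sum_(j < n | (i < j)%N) a i * a j.
  rewrite (exchange_big_dep xpredT)//=; apply: eq_bigr => i _.
  by apply: eq_bigr => j _; rewrite mulrC.
rewrite mulr_natl mulr2n -[X in _ + (X + _)]swap expr2 {1}/magnetization mulr_suml.
have -> : n%:R = \sum_(i < n) a i * a i.
  under eq_bigr do rewrite -expr2 sqrr_sign.
  by rewrite sumr_const card_ord.
rewrite -!big_split /=; apply: eq_bigr => i _.
rewrite mulr_sumr (bigD1 i)//=; congr (_ + _).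
rewrite (bigID (fun j : 'I_n => (j < i)%N))/=; congr (_ + _).
  by apply: eq_bigl => j; rewrite -val_eqE; case: ltngtP.
by apply: eq_bigl => j; rewrite -val_eqE; case: ltngtP.
Qed.

Lemma sum_expR_magnetization (lam : R) :
  \sum_s expR (lam * magnetization s) <= 2 ^+ n * expR (n%:R * lam ^+ 2 / 2).
Proof.
have -> : \sum_s expR (lam * magnetization s) = (2 * cosh lam) ^+ n.
  transitivity (\sum_(s : config) \prod_i expR (lam * (-1) ^+ s i)).
    by apply: eq_bigr => s _; rewrite -expR_sum /magnetization mulr_sumr.
  rewrite -(bigA_distr_bigA (fun (i : 'I_n) (b : bool) => expR (lam * (-1) ^+ b))).
  rewrite (eq_bigr (fun=> 2 * cosh lam)) => [|i _]; first by rewrite prodr_const card_ord.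
  by rewrite big_bool /= expr1 mulrN1 mulr1 /cosh; field.
rewrite exprMn ler_wpM2l ?exprn_ge0//.
rewrite -mulrA mulrC expRM_natr.
by rewrite lerXn2r ?nnegrE ?expR_ge0 ?cosh_le_expR_sqr// ltW ?cosh_gt0.
Qed.

Lemma magnetization_bound s : magnetization s ^+ 2 <= n%:R ^+ 2.
Proof.
rewrite -[leLHS]real_normK ?num_real// lerXn2r ?nnegrE//.
apply: le_trans (ler_norm_sum _ _ _) _.
by under eq_bigr do rewrite normrX normrN1 expr1n; rewrite sumr_const card_ord.
Qed.

(** Slice the configurations according to the integer part [k] of
[magnetization s ^+ 2 / n]; the exponential Chernoff bound at [lam = sqrt (k / n)] beats
[expR (c * (k + 1) / 2)] on the [k]-th slice because [c < 1]. *)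
Lemma sum_expR_sqr_magnetization (c : R) : (0 < n)%N -> 0 <= c < 1 ->
  \sum_s expR (c * magnetization s ^+ 2 / (2 * n%:R)) <=
  2 * expR (c / 2) / (1 - expR (- ((1 - c) / 2))) * 2 ^+ n.
Proof.
move=> n0 /andP[c0 c1]; have nr0 : 0 < n%:R :> R by rewrite ltr0n.
pose lam (k : nat) : R := Num.sqrt (k%:R / n%:R).
pose g (k : nat) (s : config) : R := expR (c * k.+1%:R / 2 - k%:R) *
  (expR (lam k * magnetization s) + expR (- lam k * magnetization s)).
have g0 k s : 0 <= g k s by rewrite mulr_ge0 ?addr_ge0 ?expR_ge0.
have slice s : expR (c * magnetization s ^+ 2 / (2 * n%:R)) <= \sum_(k < n.+1) g k s.
  set M := magnetization s.
  have M0 : 0 <= M ^+ 2 / n%:R by rewrite divr_ge0 ?sqr_ge0.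
  pose k := Num.truncn (M ^+ 2 / n%:R).
  have /andP[kM Mk] : k%:R <= M ^+ 2 / n%:R < k.+1%:R by exact: truncn_itv.
  have kn : (k < n.+1)%N.
    rewrite ltnS -(ler_nat R); apply: le_trans kM _.
    by rewrite ler_pdivrMr// -expr2 magnetization_bound.
  rewrite (bigD1 (Ordinal kn))//=; apply: (@le_trans _ _ (g k s)); last first.
    by rewrite lerDl sumr_ge0.
  have hu : expR (c * M ^+ 2 / (2 * n%:R)) <= expR (c * k.+1%:R / 2).
    rewrite ler_expR.
    have -> : c * M ^+ 2 / (2 * n%:R) = c / 2 * (M ^+ 2 / n%:R).
      by field; rewrite gt_eqF.
    by rewrite [leRHS]mulrAC ler_wpM2l ?divr_ge0// ltW.
  apply: le_trans hu _; rewrite /g expRD -[leRHS]mulrA ler_peMr ?expR_ge0//.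
  rewrite expRN -ler_pdivrMl ?invr_gt0 ?expR_gt0// invrK mulr1.
  have hk : k%:R <= lam k * `|M|.
    rewrite -[leLHS]ger0_norm// -[leLHS]sqrtr_sqr -[in leRHS](sqrtr_sqr M).
    have kn0 : 0 <= k%:R / n%:R :> R by rewrite divr_ge0.
    rewrite -sqrtrM// ler_sqrt ?(mulr_ge0 kn0 (sqr_ge0 _))//.
    by rewrite expr2 -mulrA ler_wpM2l// mulrC.
  apply: (@le_trans _ _ (expR (lam k * `|M|))); first by rewrite ler_expR.
  case: (ger0P M) => _; first by rewrite lerDl expR_ge0.
  by rewrite mulrN -mulNr lerDr expR_ge0.
apply: le_trans (ler_sum _ (fun s _ => slice s)) _.
rewrite exchange_big /=.
pose x := expR (- ((1 - c) / 2)).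
have x1 : x < 1 by rewrite -expR0 ltr_expR; lra.
have x0 : 0 < x by exact: expR_gt0.
have sliceE k : \sum_s g k s <= 2 * expR (c / 2) * 2 ^+ n * x ^+ k.
  rewrite -mulr_sumr big_split /=.
  have hl : n%:R * lam k ^+ 2 / 2 = k%:R / 2.
    by rewrite sqr_sqrtr ?divr_ge0//; field; rewrite gt_eqF.
  have h1 := sum_expR_magnetization (lam k).
  have h2 := sum_expR_magnetization (- lam k).
  rewrite sqrrN hl in h2; rewrite hl in h1.
  apply: le_trans (ler_wpM2l (expR_ge0 _) (lerD h1 h2)) _.
  rewrite le_eqVlt; apply/orP; left; apply/eqP.
  have -> : x ^+ k = expR (c * k%:R / 2 - k%:R / 2).
    by rewrite -expRM_natr; congr expR; field.
  have -> : expR (c * k.+1%:R / 2 - k%:R) =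
      expR (c / 2) * expR (c * k%:R / 2 - k%:R / 2) * expR (- (k%:R / 2)).
    by rewrite -!expRD; congr expR; rewrite -natr1; field.
  have : expR (- (k%:R / 2)) * expR (k%:R / 2) = 1 :> R by rewrite -expRD addNr expR0.
  by move=> h; ring : h.
apply: le_trans (ler_sum _ (fun (k : 'I_n.+1) _ => sliceE k)) _.
rewrite -mulr_sumr mulrAC ler_wpM2r ?exprn_ge0// ler_wpM2l ?mulr_ge0 ?expR_ge0//.
have := @geometric_le_lim R n.+1 1 x ler01 x0.
rewrite (ger0_norm (ltW x0)) => /(_ x1); rewrite div1r; apply: le_trans.
rewrite /series/= big_mkord; apply: ler_sum => k _; by rewrite mul1r.
Qed.

(** The sum over pairs depends only on the product configuration, so it reduces to one
configuration; the exponential bound of [1 + x] turns the product over the edges into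
[expR] of a multiple of the squared magnetization. *)
Lemma overlap_bound (c tau : R) : (0 < n)%N -> 0 <= c < 1 -> 0 <= tau -> tau * n%:R <= c ->
  \sum_(s : config) \sum_(t : config) \prod_(e : edge)
    (1 + (-1) ^+ (edge_sign s e (+) edge_sign t e) * tau) <=
  2 * expR (c / 2) / (1 - expR (- ((1 - c) / 2))) * #|{: config}|%:R ^+ 2.
Proof.
move=> n0 c01 tau0 taun; have /andP[c0 c1] := c01.
have nr0 : 0 < n%:R :> R by rewrite ltr0n.
have cardE : #|{: config}|%:R = 2 ^+ n :> R.
  by rewrite card_ffun card_bool card_ord natrX.
set K := 2 * _ / _.
pose xor (s t : config) : config := [ffun i => s i (+) t i].
have xorK s : involutive (xor s).
  by move=> t; apply/ffunP => i; rewrite !ffunE addKb.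
have tau1 : tau <= 1.
  have : tau <= tau * n%:R by rewrite ler_peMr// ler1n.
  lra.
have signE s t e : edge_sign s e (+) edge_sign (xor s t) e = edge_sign t e.
  by rewrite /edge_sign !ffunE; move: (val e).1 (val e).2 => i j;
    case: (s i); case: (s j); case: (t i); case: (t j).
have row s : \sum_(t : config) \prod_(e : edge)
    (1 + (-1) ^+ (edge_sign s e (+) edge_sign t e) * tau) <= K * 2 ^+ n.
  rewrite (reindex_inj (inv_inj (xorK s))) /=.
  apply: le_trans (sum_expR_sqr_magnetization n0 c01); apply: ler_sum => t _.
  under eq_bigr do rewrite signE.
  apply: (@le_trans _ _ (expR (\sum_(e : edge) (-1) ^+ edge_sign t e * tau))).
    rewrite expR_sum; apply: ler_prod => e _; rewrite expR_ge1Dx andbT.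
    by case: (edge_sign t e); rewrite ?expr1 ?expr0; lra.
  rewrite ler_expR -mulr_suml.
  have h := sqr_magnetization t; set q := \sum_e _ in h *.
  have -> : q = (magnetization t ^+ 2 - n%:R) / 2 by rewrite h; field.
  have -> : c * magnetization t ^+ 2 / (2 * n%:R) = magnetization t ^+ 2 / 2 * (c / n%:R).
    by field; rewrite gt_eqF.
  apply: (@le_trans _ _ (magnetization t ^+ 2 / 2 * tau)).
    by rewrite ler_wpM2r// ler_wpM2r// lerBlDr lerDl.
  by rewrite ler_wpM2l ?divr_ge0 ?sqr_ge0// ler_pdivlMr.
apply: le_trans (ler_sum _ (fun s _ => row s)) _.
by rewrite sumr_const -[leLHS]mulr_natl cardE expr2 mulrCA.
Qed.

End overlap.
(** * Layer-cake formula and power integrals *)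

Section layer_cake.
Context {R : realType}.
Local Notation leb := (@lebesgue_measure R).

(** Tonelli applied to [rho w * g x] on the region [0 < x < Y w]. *)
Lemma layer_cake d (Om : measurableType d)
    (m : {sigma_finite_measure set Om -> \bar R}) (rho Y : Om -> R) (g F : R -> R) :
  measurable_fun setT rho -> (forall w, 0 <= rho w) ->
  measurable_fun setT Y ->
  measurable_fun setT g -> (forall x, 0 <= g x) ->
  (forall w, \int[leb]_(x in `]0%R, Y w[) (g x)%:E = (F (Y w))%:E)%E ->
  (\int[m]_w (rho w * F (Y w))%:E =
   \int[leb]_(x in `]0%R, +oo[) ((g x)%:E * \int[m]_(w in [set w | (x < Y w)%R]) (rho w)%:E))%E.
Proof.
move=> mrho rho0 mY mg g0 gF.
pose GR : measurableType _ := measurableTypeR R.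
pose h (z : Om * GR) : \bar R :=
  (if (0 < z.2) && (z.2 < Y z.1) then rho z.1 * g z.2 else 0)%:E.
have mh : measurable_fun setT h.
  apply/measurable_EFinP; apply: measurable_fun_ifT => //.
  - apply: measurable_and; apply: measurable_fun_ltr => //.
    exact: measurableT_comp.
  - by apply: measurable_funM; apply: measurableT_comp.
have h0 z : (0 <= h z)%E by rewrite lee_fin; case: ifP => // _; rewrite mulr_ge0.
transitivity (\int[m]_w \int[leb]_x h (w, x))%E.
  apply: eq_integral => w _.
  rewrite EFinM -gF -ge0_integralZl_EFin//; last 2 first.
  - by move=> x _; rewrite lee_fin.
  - by apply/measurable_EFinP; apply: measurable_funTS.
  rewrite integral_mkcond; apply: eq_integral => x _.
  rewrite patchE /h/=; case: ifPn => [/set_mem|/negP nx].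
    by rewrite /= in_itv/= => ->.
  case: ifPn => // xY; exfalso; apply: nx; apply: mem_set.
  by rewrite /= in_itv.
rewrite fubini_tonelli// [in RHS]integral_mkcond; apply: eq_integral => x _.
rewrite patchE; case: ifPn => [/set_mem|/negP nx].
  rewrite /= in_itv/= andbT => x0.
  have mYx : measurable [set w | x < Y w].
    have : measurable_fun setT (fun w => x < Y w) by exact: measurable_fun_ltr.
    by move=> /(_ measurableT [set true]); rewrite setTI; exact.
  rewrite -ge0_integralZl_EFin//; last 2 first.
  - by move=> w _; rewrite lee_fin.
  - by apply/measurable_EFinP; apply: measurable_funTS.
  rewrite [in RHS]integral_mkcond; apply: eq_integral => w _.
  rewrite patchE /h/= x0/=; case: ifPn => [xY|nxY].
    by rewrite mem_set// mulrC.
  by rewrite memNset//= => /(negP nxY).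
apply: integral0_eq => w _; rewrite /h/=; case: ifPn => // /andP[x0 _].
by exfalso; apply: nx; apply: mem_set; rewrite /= in_itv/= x0.
Qed.

Lemma is_derive_powR_div (r x : R) : 0 < x -> r != 0 ->
  is_derive x 1 (fun y : R => r^-1 * y `^ r) (x `^ (r - 1)).
Proof.
move=> x0 r0; have h := is_derive1_powR r x0.
have -> : x `^ (r - 1) = r^-1 *: (r * x `^ (r - 1)) by rewrite /GRing.scale/= mulKf.
exact: is_deriveZ.
Qed.

Lemma continuous_powR (r x : R) : 0 < x -> {for x, continuous (fun y : R => y `^ r)}.
Proof.
move=> x0; apply: differentiable_continuous; apply/derivable1_diffP.
exact: (@ex_derive _ _ _ _ _ _ _ (is_derive1_powR r x0)).
Qed.

Lemma cvg_powRN (r : R) : 0 < r -> y `^ (- r) @[y --> +oo] --> (0 : R).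
Proof.
move=> r0; apply/cvgrPdist_lt => e e0.
near=> y; rewrite sub0r normrN ger0_norm ?powR_ge0// powRN.
have y0 : 0 < y by near: y; exact: nbhs_pinfty_gt.
rewrite invf_plt ?posrE ?powR_gt0//.
have -> : e^-1 = (e^-1 `^ r^-1) `^ r by rewrite -powRrM mulVf ?gt_eqF// powRr1// invr_ge0 ltW.
rewrite gt0_ltr_powR ?nnegrE ?powR_ge0 ?(ltW y0)//.
Unshelve. all: by end_near. Qed.

Lemma integral_powR_cy (r a : R) : 0 < a -> 0 < r ->
  (\int[leb]_(x in `[a, +oo[) (x `^ (- r - 1))%:E = (r^-1 * a `^ (- r))%:E)%E.
Proof.
move=> a0 r0.
have rn0 : - r != 0 by rewrite oppr_eq0 gt_eqF.
rewrite (@ge0_continuous_FTC2y _ _ (fun y => (- r)^-1 * y `^ (- r)) _ 0).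
- by rewrite -EFinB invrN mulNr sub0r opprK.
- by move=> x _; exact: powR_ge0.
- apply: continuous_in_subspaceT => x; rewrite inE/= in_itv/= andbT => ax.
  exact/continuous_powR/(lt_le_trans a0).
- by rewrite -[X in _ --> X](mulr0 (- r)^-1); apply: cvgMl_tmp; exact: cvg_powRN.
- move=> x ax; exact: (@ex_derive _ _ _ _ _ _ _ (is_derive_powR_div (lt_trans a0 ax) rn0)).
- apply: cvg_at_right_filter; apply: cvgMl_tmp; exact: continuous_powR.
- move=> x; rewrite in_itv/= andbT => ax; rewrite derive1E.
  exact: (@derive_val _ _ _ _ _ _ _ (is_derive_powR_div (lt_trans a0 ax) rn0)).
Qed.

(** The primitive is continuous up to 0 while the integrand is not, so the formula is
applied on [[1 / (k + 1), 1]] and the limit taken by monotone convergence. *)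
Lemma integral_powR_oc (r : R) : 0 < r ->
  (\int[leb]_(x in `]0%R, 1%R]) (x `^ (r - 1))%:E <= (r^-1)%:E)%E.
Proof.
move=> r0.
pose F (k : nat) : set R := `[k.+2%:R^-1, 1]%classic.
have F0 k : 0 < k.+2%:R^-1 :> R by rewrite invr_gt0.
have F1 k : k.+2%:R^-1 < 1 :> R by rewrite invf_lt1// ltr1n.
have -> : `]0, 1]%classic = \bigcup_k F k.
  apply/seteqP; split => [x|x [k _]]; rewrite /F/= !in_itv/= => /andP[x0 x1]; last first.
    by rewrite x1 (lt_le_trans (F0 k)).
  exists (Num.truncn x^-1) => //=; rewrite in_itv/= x1 andbT.
  rewrite -[leRHS]invrK lef_pV2 ?posrE ?invr_gt0//.
  apply: (@le_trans _ _ (Num.truncn x^-1).+1%:R); last by rewrite ler_nat.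
  exact/ltW/truncnS_gt.
have mf : measurable_fun setT (fun x : R => (x `^ (r - 1))%:E).
  by apply/measurable_EFinP; exact: measurable_powR.
have h : (\int[leb]_(x in F k) (x `^ (r - 1))%:E @[k --> \oo] -->
          \int[leb]_(x in \bigcup_k F k) (x `^ (r - 1))%:E)%E.
  apply: ge0_nondecreasing_set_cvg_integral => //.
  - apply/nondecreasing_seqP => k; apply/subsetPset => x.
    rewrite /F/= !in_itv/= => /andP[x0 ->].
    by rewrite andbT (le_trans _ x0)// lef_pV2 ?posrE// ler_nat.
  - by move=> i; exact: measurable_itv.
  - by move=> i; exact: measurable_funTS.
  - by move=> i x _; rewrite lee_fin powR_ge0.
rewrite -(cvg_lim _ h)//; apply: lime_le; first by apply/cvg_ex; eexists; exact: h.
apply: nearW => k.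
have cP (x : R) : 0 < x -> {for x, continuous (fun y : R => r^-1 * y `^ r)}.
  by move=> x0; apply: cvgMl_tmp; exact: continuous_powR.
rewrite (@continuous_FTC2 _ _ (fun y => r^-1 * y `^ r)) ?F1//.
- rewrite -EFinB lee_fin powR1 mulr1 gerBl mulr_ge0 ?powR_ge0// invr_ge0 ltW//.
- apply: continuous_in_subspaceT => x; rewrite inE/= in_itv/= => /andP[kx _].
  exact/continuous_powR/(lt_le_trans (F0 k)).
- split.
  + move=> x; rewrite in_itv/= => /andP[kx _].
    exact: (@ex_derive _ _ _ _ _ _ _ (is_derive_powR_div (lt_trans (F0 k) kx) (lt0r_neq0 r0))).
  + by apply: cvg_at_right_filter; apply: cP.
  + by apply: cvg_at_left_filter; apply: cP.
- move=> x; rewrite in_itv/= => /andP[kx _]; rewrite derive1E.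
  exact: (@derive_val _ _ _ _ _ _ _ (is_derive_powR_div (lt_trans (F0 k) kx) (lt0r_neq0 r0))).
Qed.

Lemma integral_min1_powR_lty (a : R) : 1 < a < 2 ->
  (\int[leb]_(x in `]0%R, +oo[) (Num.min x 1 * x `^ (- a))%:E < +oo)%E.
Proof.
move=> /andP[a1 a2].
have mf : measurable_fun setT (fun x : R => (Num.min x 1 * x `^ (- a))%:E).
  apply/measurable_EFinP; apply: measurable_funM; last exact: measurable_powR.
  exact: measurable_minr.
have f0 (x : R) : 0 < x -> (0 <= (Num.min x 1 * x `^ (- a))%:E)%E.
  by move=> x0; rewrite lee_fin mulr_ge0 ?powR_ge0// le_min ler01 (ltW x0).
have -> : `]0%R, +oo[%classic = `]0, 1] `|` `]1, +oo[ :> set R.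
  by rewrite -itv_bndbnd_setU// bnd_simp.
rewrite ge0_integral_setU//=; last 3 first.
- exact: measurable_funTS.
- by move=> x [|]; rewrite /= in_itv/= => /andP[x0 _]; apply: f0 => //; apply: lt_trans x0.
- by apply/disj_setPRL => x/=; rewrite !in_itv/= andbT => x1; rewrite leNgt x1 andbF.
apply: lte_add_pinfty.
- apply: (@le_lt_trans _ _ ((2 - a)^-1)%:E); last by rewrite ltry.
  apply: le_trans (integral_powR_oc _); last by lra.
  apply: ge0_le_integral => //.
  + by move=> x; rewrite /= in_itv/= => /andP[x0 _]; exact: f0.
  + exact: measurable_funTS.
  + by apply: measurable_funTS; apply/measurable_EFinP; exact: measurable_powR.
  + move=> x; rewrite /= in_itv/= => /andP[x0 _].
    have -> : 2 - a - 1 = 1 + - a by ring.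
    rewrite powRD ?(gt_eqF x0) ?implybT// powRr1 ?(ltW x0)// lee_fin.
    by rewrite ler_wpM2r ?powR_ge0// ge_min lexx.
- apply: (@le_lt_trans _ _ ((a - 1)^-1 * 1 `^ (- (a - 1)))%:E); last by rewrite ltry.
  rewrite -integral_powR_cy//; last by lra.
  apply: (@le_trans _ _ (\int[leb]_(x in `]1%R, +oo[) (x `^ (- (a - 1) - 1))%:E)%E).
    apply: ge0_le_integral => //.
    + move=> x; rewrite /= in_itv/= => /andP[x1 _]; apply: f0; exact: lt_trans x1.
    + exact: measurable_funTS.
    + by apply: measurable_funTS; apply/measurable_EFinP; exact: measurable_powR.
    + move=> x; rewrite /= in_itv/= => /andP[x1 _].
      have -> : - (a - 1) - 1 = - a by ring.
      by rewrite lee_fin ler_piMl ?powR_ge0// ge_min lexx orbT.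
  apply: ge0_subset_integral => //.
  + by apply: measurable_funTS; apply/measurable_EFinP; exact: measurable_powR.
  + by move=> x _; rewrite lee_fin powR_ge0.
  + by move=> x; rewrite /= !in_itv/= !andbT; exact: ltW.
Qed.

(** Integration by parts against the Pareto density, as an instance of the layer-cake
formula. *)
Lemma integral_pareto (alpha : R) (g F : R -> R) : 0 < alpha ->
  measurable_fun setT g -> (forall x, 0 <= g x) ->
  (forall y : R, (0 <= y)%R -> \int[leb]_(x in `]0%R, y[) (g x)%:E = (F y)%:E)%E ->
  measurable_fun setT F ->
  (alpha%:E * \int[leb]_(x in `]0%R, +oo[) (F x / x `^ (alpha + 1))%:E =
   \int[leb]_(x in `]0%R, +oo[) (g x * x `^ (- alpha))%:E)%E.
Proof.
move=> alpha0 mg g0 gF mF.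
pose Y (w : measurableTypeR R) : R := Num.max w 0.
pose rho (w : measurableTypeR R) : R := if 0 < w then alpha * w `^ (- alpha - 1) else 0.
have rho0 w : 0 <= rho w by rewrite /rho; case: ifP => // _; rewrite mulr_ge0 ?powR_ge0// ltW.
have F0 y : 0 <= y -> 0 <= F y.
  by move=> y0; rewrite -lee_fin -gF//; apply: integral_ge0 => x _; rewrite lee_fin.
have mrho : measurable_fun setT rho.
  apply: measurable_fun_ifT => //; first exact: measurable_fun_ltr.
  by apply: measurable_funM => //; exact: measurable_powR.
have mY : measurable_fun setT Y by exact: measurable_maxr.
have Y0 w : 0 <= Y w by rewrite le_max lexx orbT.
have := layer_cake leb mrho rho0 mY mg g0 (fun w => gF _ (Y0 w)).
rewrite -ge0_integralZl_EFin ?(ltW alpha0)//; last 2 first.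
- move=> x; rewrite /= in_itv/= andbT => x0.
  by rewrite lee_fin divr_ge0 ?powR_ge0// F0// ltW.
- apply: measurable_funTS; apply/measurable_EFinP; apply: measurable_funM => //.
  under eq_fun do rewrite -powRN.
  exact: measurable_powR.
move=> h; transitivity (\int[leb]_w (rho w * F (Y w))%:E)%E.
  rewrite integral_mkcond; apply: eq_integral => w _.
  rewrite patchE /rho /Y; case: ifPn => [/set_mem|/negP nw].
    rewrite /= in_itv/= andbT => w0; rewrite w0 -EFinM; congr _%:E.
    by rewrite (max_idPl (ltW w0)) -opprD powRN; ring.
  case: ifPn => w0; last by rewrite mul0r.
  by exfalso; apply: nw; apply: mem_set; rewrite /= in_itv/= w0.
rewrite h; apply: eq_integral => x /set_mem; rewrite /= in_itv/= andbT => x0.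
rewrite EFinM; congr (_ * _)%E.
have -> : [set w | (x < Y w)%R] = `]x, +oo[%classic.
  apply/seteqP; split => w /=; rewrite in_itv/= andbT /Y lt_max.
    by move=> /orP[//|]; rewrite ltNge (ltW x0).
  by move=> ->.
rewrite integral_itv_obnd_cbnd; last by apply: measurable_funTS; apply/measurable_EFinP.
transitivity (\int[leb]_(w in `[x, +oo[) (alpha%:E * (w `^ (- alpha - 1))%:E))%E.
  apply: eq_integral => w /set_mem; rewrite /= in_itv/= andbT => xw.
  by rewrite /rho (lt_le_trans x0 xw) EFinM.
rewrite ge0_integralZl_EFin ?(ltW alpha0)//; last 2 first.
- by move=> w _; rewrite lee_fin powR_ge0.
- by apply: measurable_funTS; apply/measurable_EFinP; exact: measurable_powR.
by rewrite integral_powR_cy// -EFinM mulrA divff ?gt_eqF// mul1r.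
Qed.

Lemma integral_derivative (F f : R -> R) :
  (forall x : R, is_derive x 1 F (f x)) -> continuous f -> F 0 = 0 ->
  forall y : R, 0 <= y -> (\int[leb]_(x in `]0%R, y[) (f x)%:E = (F y)%:E)%E.
Proof.
move=> dF cf F0 y; rewrite le_eqVlt => /predU1P[<-|y0].
  by rewrite set_itvoo0 integral_set0 F0.
have cF : continuous F.
  move=> x; apply: differentiable_continuous; apply/derivable1_diffP.
  exact: (@ex_derive _ _ _ _ _ _ _ (dF x)).
have mf : measurable_fun setT (fun x => (f x)%:E).
  by apply/measurable_EFinP; exact: continuous_measurable_fun.
rewrite integral_itv_bndo_bndc ?integral_itv_obnd_cbnd; [|exact: measurable_funTS..].
rewrite (@continuous_FTC2 _ _ F) ?F0 ?sube0//.
- by apply: continuous_subspaceT => x; exact: cf.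
- split.
  + by move=> x _; exact: (@ex_derive _ _ _ _ _ _ _ (dF x)).
  + by apply: cvg_at_right_filter; exact: cF.
  + by apply: cvg_at_left_filter; exact: cF.
- by move=> x _; rewrite derive1E; exact: (@derive_val _ _ _ _ _ _ _ (dF x)).
Qed.

End layer_cake.
(** * Regularly varying tails at the scale of their quantiles *)

Section regular_variation.
Context {R : realType} (alpha : R) (T : R -> R) (a : nat -> R).
Hypothesis T_gt0 : forall x : R, 0 < x -> 0 < T x.
Hypothesis T_le1 : forall x, T x <= 1.
Hypothesis T_rv : forall t : R, 0 < t -> T (t * x) / T x @[x --> +oo] --> t `^ (- alpha).
Hypothesis a_lt : forall N (y : R), 0 < y -> y < a N -> 1 < N%:R * T y.
Hypothesis a_gt : forall N (y : R), 0 < y -> a N < y -> N%:R * T y <= 1.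
Hypothesis a_cvg : forall M, \forall N \near \oo, M <= a N.

(** For exponents on either side of [alpha] the limit [2 ^ (- alpha)] leaves room for a two
sided bound from some point on, which can be iterated. *)
Lemma dyadic_tail_ratio (q r : R) : q < alpha -> alpha < r ->
  exists2 x0 : R, 0 < x0 & forall x : R, x0 <= x ->
    2 `^ (- r) * T x <= T (2 * x) <= 2 `^ (- q) * T x.
Proof.
move=> qa ar; have h := @T_rv 2 ltac:(by []).
have h1 : \forall x \near +oo, 2 `^ (- r) <= T (2 * x) / T x <= 2 `^ (- q).
  near=> x; apply/andP; split; near: x.
  - by apply: (cvgr_ge _ h); apply: powR2_lt; rewrite ltrN2.
  - by apply: (cvgr_le _ h); apply: powR2_lt; rewrite ltrN2.
case: h1 => M [_ hM]; exists (Num.max M 0 + 1); first by rewrite ltr_wpDl// le_max lexx orbT.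
move=> x xM; have x0 : 0 < x by apply: lt_le_trans xM; rewrite ltr_wpDl// le_max lexx orbT.
have := hM x; rewrite ler_pdivlMr ?ler_pdivrMr ?T_gt0//; apply.
by apply: lt_le_trans xM; rewrite ltr_pwDr// le_max lexx.
Unshelve. all: by end_near. Qed.

(** Iterating the dyadic comparison from the scale [a N], where the tail is of order
[1 / N], upwards with the exponent [q] and downwards with the exponent [r]. *)
Lemma tail_domination (q r : R) : 0 < q -> q < alpha -> alpha < r ->
  exists C : R, exists2 x0 : R, 0 < x0 & forall N (x : R), x0 <= a N -> 0 < x ->
    N%:R * T (a N * x) <= C * (x `^ (- r) + x `^ (- q)).
Proof.
move=> q0 qa ar; have r0 : 0 < r by lra.
have [x0 x0_gt0 hx0] := dyadic_tail_ratio qa ar.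
pose C0 := 1 + (T x0)^-1.
have C01 : 1 <= C0 by rewrite lerDl invr_ge0 ltW// T_gt0.
exists (C0 * (4 `^ r + 4 `^ q)), x0 => // N x x0a x_gt0.
have a0 : 0 < a N := lt_le_trans x0_gt0 x0a.
pose nu y := N%:R * T (a N * y).
have nu1 (y : R) : 1 < y -> nu y <= 1.
  by move=> y1; apply: a_gt; rewrite ?mulr_gt0 ?ltr_pMr// (lt_trans _ y1).
have powge1 (s y : R) : 0 <= s -> 0 < y -> y <= 4 -> 1 <= (y / 4) `^ (- s).
  move=> s0 y0 y4; rewrite -[leLHS](_ : 1 `^ (- s) = 1); last by rewrite powR1.
  apply: powRN_le => //.
    by rewrite divr_gt0.
  by rewrite ler_pdivrMr// mul1r.
have up n (y : R) : 2 <= y -> y <= n%:R + 4 -> nu y <= (y / 4) `^ (- q).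
  elim: n y => [|n IH] y y2 yn.
    by apply: le_trans (powge1 q y _ _ _); rewrite ?nu1//; lra.
  have [y4|y4] := leP y 4.
    by apply: le_trans (powge1 q y _ _ _); rewrite ?nu1//; lra.
  have /IH h : 2 <= y / 2 by lra.
  have /h {}h : y / 2 <= n%:R + 4 by move: yn; rewrite -natr1; lra.
  have /hx0/andP[_] : x0 <= a N * (y / 2).
    by apply: le_trans x0a _; rewrite ler_pMr//; lra.
  have -> : 2 * (a N * (y / 2)) = a N * y by field.
  move=> hT; apply: (@le_trans _ _ (2 `^ (- q) * nu (y / 2))).
    by rewrite mulrCA ler_wpM2l.
  apply: le_trans (ler_wpM2l (powR_ge0 _ _) h) _.
  rewrite -powRM; [|lra|lra].
  by rewrite (_ : 2 * (y / 2 / 4) = y / 4)//; field.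
have down n (y : R) : 0 < y -> y <= 4 -> x0 <= a N * y -> 4 <= y * n.+1%:R ->
    nu y <= (y / 4) `^ (- r).
  elim: n y => [|n IH] y y0 y4 ya yn.
    apply: le_trans (powge1 r y _ _ _); rewrite ?nu1//; lra.
  have [y2|y2] := leP 2 y.
    by apply: le_trans (powge1 r y _ _ _); rewrite ?nu1//; lra.
  have h : nu (2 * y) <= (2 * y / 4) `^ (- r).
    apply: IH; [lra|lra| |].
    - by apply: le_trans ya _; rewrite ler_pM2l//; lra.
    - have n1 : 1 <= n.+1%:R :> R by rewrite ler1n.
      move: yn; rewrite -[n.+2%:R]natr1; nra.
  have /hx0/andP[+ _] := ya.
  have -> : 2 * (a N * y) = a N * (2 * y) by ring.
  move=> hT; have {hT} : 2 `^ (- r) * nu y <= nu (2 * y).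
    by rewrite mulrCA ler_wpM2l.
  move=> /le_trans/(_ h); rewrite -mulrA powRM//; last by rewrite divr_ge0// ltW.
  by rewrite ler_pM2l ?powR_gt0.
have down' (y : R) : 0 < y -> y <= 4 -> x0 <= a N * y -> nu y <= (y / 4) `^ (- r).
  move=> y0 y4 ya; apply: (down (Num.truncn (4 / y))) => //.
  by rewrite mulrC -ler_pdivrMr// ltW// truncnS_gt.
have x4 (s : R) : 0 <= (x / 4) `^ (- s) by exact: powR_ge0.
apply: (@le_trans _ _ (C0 * ((x / 4) `^ (- r) + (x / 4) `^ (- q)))); last first.
  rewrite -mulrA ler_wpM2l ?(le_trans ler01)// !powRN_div//.
  have := (powR_ge0 4 r, powR_ge0 4 q, powR_ge0 x (- r), powR_ge0 x (- q)).
  by move=> -[[[]]]; nra.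
have [x2|x2] := leP 2 x.
  have := up (Num.truncn x).+1 x x2; rewrite -/(nu x) => h.
  apply: le_trans (h _) _; first by have := truncnS_gt x; lra.
  by rewrite -[leLHS]mul1r ler_pM// lerDr.
have [ax|ax] := leP x0 (a N * x).
  apply: le_trans (down' x _ _ ax) _ => //; first by lra.
  by rewrite -[leLHS]mul1r ler_pM// lerDl.
have hy : N%:R * T x0 <= (x0 / a N / 4) `^ (- r).
  have := down' (x0 / a N); rewrite /nu mulrCA divff ?gt_eqF// mulr1; apply => //.
  - by rewrite divr_gt0.
  - have : x0 / a N <= 1 by rewrite ler_pdivrMr// mul1r.
    lra.
have hN : N%:R <= (T x0)^-1 * (x / 4) `^ (- r).
  rewrite mulrC ler_pdivlMr ?T_gt0//; apply: le_trans hy _.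
  apply: powRN_le; [lra|lra|].
  by rewrite ler_pM2r// ler_pdivlMr// mulrC ltW.
apply: (@le_trans _ _ N%:R); first by rewrite -[leRHS]mulr1 ler_wpM2l.
apply: le_trans hN _; rewrite ler_pM ?invr_ge0 ?(ltW (T_gt0 _))//.
  by rewrite lerDr.
by rewrite lerDl.
Qed.

(** The tail at [a N] need not be exactly [1 / N], but it exceeds [1 / N] just below [a N]
and not above: comparing with the nearby points [a N * x / y], [y] close to [x] on either
side, squeezes the limit between the powers of these [y]. *)
Lemma tail_cvg (x : R) : 0 < x -> N%:R * T (a N * x) @[N --> \oo] --> x `^ (- alpha).
Proof.
move=> x0; apply/cvgrPdist_lt => e e0.
have cx := @continuous_powR R (- alpha) x x0.
have [d /= d0 hd] : exists2 d : R, 0 < d & forall y : R, `|x - y| < d ->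
    `|x `^ (- alpha) - y `^ (- alpha)| < e.
  have /cvgrPdist_lt/(_ e e0) := cx.
  by move=> [d /= d0 hd]; exists d => // y xy; exact: hd.
pose m := Num.min d x; have m0 : 0 < m by rewrite lt_min d0.
have [md mx] : m <= d /\ m <= x by rewrite !ge_min !lexx orbT.
pose y1 := x - m / 2; pose y2 := x + m / 2.
have y10 : 0 < y1 by rewrite /y1; lra.
have y20 : 0 < y2 by rewrite /y2; lra.
have h1 : y1 `^ (- alpha) < x `^ (- alpha) + e.
  have := hd y1; rewrite /y1 opprB addrCA subrr addr0 gtr0_norm; last by lra.
  move=> /(_ ltac:(lra)); rewrite ltr_norml => /andP[]; lra.
have h2 : x `^ (- alpha) - e < y2 `^ (- alpha).
  have := hd y2; rewrite /y2 opprD addNKr normrN gtr0_norm; last by lra.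
  move=> /(_ ltac:(lra)); rewrite ltr_norml => /andP[]; lra.
have H1 : \forall z \near +oo, T (y1 * z) / T z < x `^ (- alpha) + e.
  exact: (cvgr_lt _ (T_rv y10)).
have H2 : \forall z \near +oo, x `^ (- alpha) - e < T (y2 * z) / T z.
  exact: (cvgr_gt _ (T_rv y20)).
case: H1 => M1 [_ H1]; case: H2 => M2 [_ H2].
near=> N.
have aN : Num.max (Num.max (M1 * y1 / x) (M2 * y2 / x)) 0 + 1 <= a N.
  by near: N; exact: a_cvg.
have a0 : 0 < a N by apply: lt_le_trans aN; rewrite ltr_wpDl// le_max lexx orbT.
have side (M y : R) : 0 < y -> M * y / x + 1 <= a N -> M < a N * (x / y).
  move=> y0 h; rewrite mulrA ltr_pdivlMr// -ltr_pdivrMr//.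
  by apply: lt_le_trans h; rewrite ltrDl.
have {}H1 : T (a N * x) / T (a N * (x / y1)) < x `^ (- alpha) + e.
  have -> : a N * x = y1 * (a N * (x / y1)) by field; rewrite gt_eqF.
  apply: H1; apply: side => //; apply: le_trans aN.
  by rewrite lerD2r !le_max lexx.
have {}H2 : x `^ (- alpha) - e < T (a N * x) / T (a N * (x / y2)).
  have -> : a N * x = y2 * (a N * (x / y2)) by field; rewrite gt_eqF.
  apply: H2; apply: side => //; apply: le_trans aN.
  by rewrite lerD2r !le_max lexx orbT.
have T1 : N%:R * T (a N * (x / y1)) <= 1.
  apply: a_gt; first by rewrite mulr_gt0// divr_gt0.
  by rewrite ltr_pMr// ltr_pdivlMr// mul1r /y1; lra.
have T2 : 1 < N%:R * T (a N * (x / y2)).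
  apply: a_lt; first by rewrite mulr_gt0// divr_gt0.
  by rewrite gtr_pMr// ltr_pdivrMr// mul1r /y2; lra.
have Tp1 : 0 < T (a N * (x / y1)) by rewrite T_gt0// mulr_gt0// divr_gt0.
have Tp2 : 0 < T (a N * (x / y2)) by rewrite T_gt0// mulr_gt0// divr_gt0.
have Tx : 0 < T (a N * x) by rewrite T_gt0// mulr_gt0.
have l0 : 0 <= x `^ (- alpha) by exact: powR_ge0.
rewrite ltr_pdivrMr// in H1; rewrite ltr_pdivlMr// in H2.
rewrite ltr_norml; apply/andP; split.
- have N0 : 0 < N%:R :> R by move: T2; nra.
  have : N%:R * T (a N * x) < (x `^ (- alpha) + e) * 1.
    apply: (@lt_le_trans _ _ (N%:R * ((x `^ (- alpha) + e) * T (a N * (x / y1))))).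
      by rewrite ltr_pM2l.
    by rewrite mulrCA ler_wpM2l//; lra.
  lra.
- have [neg|pos] := leP (x `^ (- alpha) - e) 0.
    have : 0 < N%:R * T (a N * x) by rewrite mulr_gt0//; move: T2; nra.
    lra.
  have : (x `^ (- alpha) - e) * 1 < N%:R * T (a N * x).
    apply: (@lt_le_trans _ _ (N%:R * ((x `^ (- alpha) - e) * T (a N * (x / y2))))).
      by rewrite mulrCA ltr_pM2l.
    by rewrite ler_wpM2l// ltW.
  lra.
Unshelve. all: by end_near. Qed.

End regular_variation.
(** * Moments of the rescaled bond *)

Section rescaled_bond.
Context {R : realType} (alpha : R) (L : R -> R).
Context {d0 : measure_display} {T0 : measurableType d0} (P0 : probability T0 R).
Context (X : {RV P0 >-> R}).
Hypothesis alpha12 : 1 < alpha < 2.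
Hypothesis L_gt0 : forall x : R, 0 < x -> 0 < L x.
Hypothesis L_sv : slowly_varying L.
Hypothesis X_tail : forall x : R, 0 < x ->
  P0 [set w | x < `|X w|] = (L x / x `^ alpha)%:E.
Local Notation leb := (@lebesgue_measure R).
Local Notation a := (scale P0 X).

Definition abs_tail (x : R) : R := fine (P0 [set w | x < `|X w|]).

Lemma measurable_abs_gt (x : R) : measurable [set w | x < `|X w|].
Proof.
have : measurable_fun setT (fun w => x < `|X w|).
  by apply: measurable_fun_ltr => //; exact: measurableT_comp.
by move=> /(_ measurableT [set true]); rewrite setTI; exact.
Qed.

Lemma abs_tailE x : P0 [set w | x < `|X w|] = (abs_tail x)%:E.
Proof. by rewrite /abs_tail fineK// fin_num_measure//; exact: measurable_abs_gt. Qed.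

Lemma abs_tail_sv (x : R) : 0 < x -> abs_tail x = L x / x `^ alpha.
Proof. by move=> x0; rewrite /abs_tail X_tail. Qed.

Lemma abs_tail_gt0 (x : R) : 0 < x -> 0 < abs_tail x.
Proof. by move=> x0; rewrite abs_tail_sv// divr_gt0 ?L_gt0// powR_gt0. Qed.

Lemma abs_tail_mono (x y : R) : x <= y -> abs_tail y <= abs_tail x.
Proof.
move=> xy; rewrite -lee_fin -!abs_tailE; apply: le_measure.
- by rewrite inE; exact: measurable_abs_gt.
- by rewrite inE; exact: measurable_abs_gt.
- by move=> w /=; exact: le_lt_trans.
Qed.

Lemma abs_tail_le1 x : abs_tail x <= 1.
Proof. by rewrite -lee_fin -abs_tailE probability_le1//; exact: measurable_abs_gt. Qed.

Lemma abs_tail_rv (t : R) : 0 < t ->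
  abs_tail (t * x) / abs_tail x @[x --> +oo] --> t `^ (- alpha).
Proof.
move=> t0; have h : L (t * x) / L x * t `^ (- alpha) @[x --> +oo] --> 1 * t `^ (- alpha).
  by apply: cvgMr_tmp; exact: L_sv.
rewrite mul1r in h; apply: cvg_trans h; apply: near_eq_cvg.
near=> x; have x0 : 0 < x by near: x; exact: nbhs_pinfty_gt.
rewrite !abs_tail_sv ?mulr_gt0// powRM ?ltW// powRN.
have Lx := L_gt0 x0; have px : 0 < x `^ alpha by exact: powR_gt0.
have pt : 0 < t `^ alpha by exact: powR_gt0.
by field; rewrite !gt_eqF.
Unshelve. all: by end_near. Qed.

(** The set defining the scale is nonempty: the dyadic comparison with exponent 1 at least
halves the tail from [2 ^ N * x0] to [2 ^ N.+1 * x0], faster than [N] grows. *)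
Let small_tail (N : nat) : exists2 x : R, 0 < x & N%:R * abs_tail x <= 1.
Proof.
have /andP[a1 a2] := alpha12.
have [x0 x0_gt0 hx] := @dyadic_tail_ratio R alpha abs_tail abs_tail_gt0 abs_tail_rv 1 2 a1 a2.
exists (2 ^+ N * x0); first by rewrite mulr_gt0// exprn_gt0.
suff : N.+1%:R * abs_tail (2 ^+ N * x0) <= 1.
  by apply: le_trans; rewrite ler_wpM2r ?ler_nat// ltW// abs_tail_gt0// mulr_gt0// exprn_gt0.
elim: N => [|N IH]; first by rewrite expr0 !mul1r abs_tail_le1.
have x0N : x0 <= 2 ^+ N * x0 by rewrite ler_peMl ?(ltW x0_gt0)// exprn_ege1// ler1n.
have /andP[_] := hx _ x0N.
rewrite mulrA -exprS powRN powRr1// => h.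
have t0 : 0 < abs_tail (2 ^+ N * x0) by rewrite abs_tail_gt0// (lt_le_trans x0_gt0).
apply: le_trans (ler_wpM2l _ h) _ => //; apply: le_trans IH.
rewrite mulrA ler_pM2r// ler_pdivrMr// -!natr1.
have : 0 <= N%:R :> R by [].
lra.
Qed.

Let S N := [set x : R | 0 < x /\ (N%:R%:E * P0 [set w | (x < `|X w|)%R] <= 1)%E].

Let S_iff N x : S N x <-> 0 < x /\ N%:R * abs_tail x <= 1.
Proof. by rewrite /S/= abs_tailE -EFinM lee_fin. Qed.

Let S_has_inf N : has_inf (S N).
Proof.
split; last by exists 0 => x /S_iff[/ltW].
by have [x x0 hx] := small_tail N; exists x; apply/S_iff.
Qed.

Lemma scale_lt N (y : R) : 0 < y -> y < a N -> 1 < N%:R * abs_tail y.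
Proof.
move=> y0 ya; rewrite ltNge; apply/negP => h.
have : a N <= y by apply: ge_inf; [exact: (S_has_inf N).2|apply/S_iff].
by rewrite leNgt ya.
Qed.

Lemma scale_gt N (y : R) : 0 < y -> a N < y -> N%:R * abs_tail y <= 1.
Proof.
move=> y0 ay; have [x /S_iff[x0 hx] xy] := inf_lt (S_has_inf N).1 ay.
by apply: le_trans hx; rewrite ler_wpM2l// abs_tail_mono// ltW.
Qed.

Lemma scale_cvg (M : R) : \forall N \near \oo, M <= a N.
Proof.
pose M' := Num.max M 1; have M'0 : 0 < M' by rewrite lt_max ltr01 orbT.
near=> N; apply: (@le_trans _ _ M'); first by rewrite le_max lexx.
apply: lb_le_inf; first exact: (S_has_inf N).1.
move=> x /S_iff[x0 hx]; rewrite leNgt; apply/negP => xM.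
have : (abs_tail M')^-1 < N%:R by near: N; exact: nbhs_infty_gtr.
rewrite invf_plt ?posrE ?abs_tail_gt0//; last first.
  by near: N; exact: nbhs_infty_gtr.
rewrite ltNge => /negP; apply.
rewrite -div1r ler_pdivlMr; last by near: N; exact: nbhs_infty_gtr.
by rewrite mulrC; apply: le_trans hx; rewrite ler_wpM2l// abs_tail_mono// ltW.
Unshelve. all: by end_near. Qed.

Local Notation jump N w := ((a N)^-1 * X w).

Lemma abs_jump_gt N (s x : R) : 0 < a N -> 0 < s ->
  [set w | x < s * `|jump N w| ] = [set w | a N * (x / s) < `|X w| ].
Proof.
move=> a0 s0; apply: eq_set => w; rewrite normrM (gtr0_norm (_ : 0 < (a N)^-1)) ?invr_gt0//.
have -> : a N * (x / s) = x / (s / a N) by field; rewrite !gt_eqF.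
have -> : s * ((a N)^-1 * `|X w|) = `|X w| * (s / a N) by ring.
by rewrite ltr_pdivrMr// divr_gt0.
Qed.

Lemma measurable_jump N : measurable_fun setT (fun w => jump N w).
Proof. exact: measurable_funM. Qed.

Lemma measurable_abs_tail (c s : R) : 0 < c -> 0 < s ->
  measurable_fun setT (fun x : R => abs_tail (c * (x / s))).
Proof.
move=> c0 s0; apply: nonincreasing_measurable => // x y xy.
by apply: abs_tail_mono; rewrite ler_pM2l// ler_pM2r ?invr_gt0.
Qed.

Lemma integral_jump N (s : R) (g F : R -> R) : 0 < a N -> 0 < s ->
  measurable_fun setT g -> (forall x, 0 <= g x) ->
  (forall y : R, (0 <= y)%R -> \int[leb]_(x in `]0%R, y[) (g x)%:E = (F y)%:E)%E ->
  (N%:R%:E * \int[P0]_w (F (s * `|jump N w|))%:E =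
   \int[leb]_(x in `]0%R, +oo[) (g x * (N%:R * abs_tail (a N * (x / s))))%:E)%E.
Proof.
move=> a0 s0 mg g0 gF.
have mY : measurable_fun setT (fun w => s * `|jump N w|).
  by apply: measurable_funM => //; apply: measurableT_comp => //; exact: measurable_jump.
have Y0 w : 0 <= s * `|jump N w| by rewrite mulr_ge0// ltW.
have := layer_cake P0 (measurable_cst (1 : R)) (fun=> ler01) mY mg g0 (fun w => gF _ (Y0 w)).
under eq_integral do rewrite mul1r.
have intE (x : R) : (\int[P0]_(w in [set w | (x < s * `|jump N w|)%R]) (cst (1 : R) w)%:E =
    (abs_tail (a N * (x / s)))%:E)%E.
  rewrite abs_jump_gt// -abs_tailE -[RHS]mul1e.
  exact: (integral_cst P0 (measurable_abs_gt _) 1%E).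
move=> ->; rewrite -ge0_integralZl_EFin//; last 2 first.
- by move=> x _; apply: mule_ge0; [rewrite lee_fin|apply: integral_ge0 => w _; rewrite lee_fin].
- apply: (eq_measurable_fun (fun x : R => (g x * abs_tail (a N * (x / s)))%:E)).
    by move=> x _; rewrite EFinM; congr (_ * _)%E; exact/esym/intE.
  apply: measurable_funTS; apply/measurable_EFinP; apply: measurable_funM => //.
  exact: measurable_abs_tail.
apply: eq_integral => x _.
transitivity (N%:R%:E * ((g x)%:E * (abs_tail (a N * (x / s)))%:E))%E.
  by congr (_ * (_ * _))%E; exact: intE.
by rewrite muleCA -!EFinM.
Qed.

(** Vague convergence of [N] times the law of the rescaled bond towards the Levy measure,
tested against a primitive [F] of [g]: after the layer-cake formula only the tail of the
bond remains, which converges pointwise and is dominated by the two powers of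
[tail_domination]. *)
Lemma jump_integral_cvg (s C : R) (g F : R -> R) : 0 < s ->
  measurable_fun setT g -> (forall x, 0 <= g x) ->
  (forall x, 0 < x -> g x <= C * Num.min x 1) ->
  (forall y : R, (0 <= y)%R -> \int[leb]_(x in `]0%R, y[) (g x)%:E = (F y)%:E)%E ->
  (\int[leb]_(x in `]0%R, +oo[) (g x * x `^ (- alpha))%:E < +oo)%E /\
  (N%:R%:E * \int[P0]_w (F (s * `|jump N w|))%:E @[N --> \oo] -->
   (s `^ alpha)%:E * \int[leb]_(x in `]0%R, +oo[) (g x * x `^ (- alpha))%:E)%E.
Proof.
move=> s0 mg g0 gC gF; have /andP[a1 a2] := alpha12.
pose q := (1 + alpha) / 2; pose r := (alpha + 2) / 2.
have q0 : 0 < q by rewrite /q; lra.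
have qa : q < alpha by rewrite /q; lra.
have ar : alpha < r by rewrite /r; lra.
have [C1 [x0 x0_gt0 dom]] := tail_domination abs_tail_gt0 abs_tail_le1
  abs_tail_rv scale_gt q0 qa ar.
pose f N (x : R) := (g x * (N%:R * abs_tail (a N * (x / s))))%:E.
pose f_lim (x : R) := (g x * (x / s) `^ (- alpha))%:E.
pose G (x : R) := ((C * C1 * s `^ r) * (Num.min x 1 * x `^ (- r)) +
                   (C * C1 * s `^ q) * (Num.min x 1 * x `^ (- q)))%:E.
have [N0 _ hN0] : \forall N \near \oo, x0 <= a N by exact: scale_cvg.
have aN n : x0 <= a (n + N0) by apply: hN0 => /=; exact: leq_addl.
have aN_gt0 n : 0 < a (n + N0) by apply: lt_le_trans x0_gt0 (aN n).
have C0 : 0 <= C.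
  by have := le_trans (g0 1) (gC 1 ltr01); rewrite minxx mulr1.
have C10 : 0 <= C1.
  have := dom _ 1 (aN 0) ltr01; rewrite !powR1 => h.
  have : 0 <= (0 + N0)%:R * abs_tail (a (0 + N0) * 1).
    by rewrite mulr_ge0// ltW// abs_tail_gt0// mulr1.
  lra.
have mG (e : R) : measurable_fun setT (fun x : R => (Num.min x 1 * x `^ e)).
  by apply: measurable_funM; [exact: measurable_minr|exact: measurable_powR].
have min0 (x e : R) : 0 < x -> 0 <= Num.min x 1 * x `^ e.
  by move=> x0'; rewrite mulr_ge0 ?powR_ge0// le_min ler01 ltW.
have iG : leb.-integrable `]0%R, +oo[ G.
  apply/integrableP; split.
    apply: measurable_funTS; apply/measurable_EFinP.
    by apply: measurable_funD; apply: measurable_funM => //; exact: mG.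
  have k0 e : 0 <= C * C1 * s `^ e by rewrite !mulr_ge0 ?powR_ge0.
  have -> : (\int[leb]_(x in `]0%R, +oo[) `|G x| = \int[leb]_(x in `]0%R, +oo[)
      ((C * C1 * s `^ r)%:E * (Num.min x 1 * x `^ (- r))%:E +
       (C * C1 * s `^ q)%:E * (Num.min x 1 * x `^ (- q))%:E))%E.
    apply: eq_integral => x /set_mem; rewrite /= in_itv/= andbT => x0'.
    by rewrite -!EFinM -EFinD ger0_norm// addr_ge0// mulr_ge0// min0.
  rewrite ge0_integralD//=; last 4 first.
  - move=> x; rewrite /= in_itv/= andbT => x0'.
    by rewrite -EFinM lee_fin mulr_ge0// min0.
  - apply: measurable_funTS; apply/measurable_EFinP; apply: measurable_funM => //.
    exact: mG.
  - move=> x; rewrite /= in_itv/= andbT => x0'.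
    by rewrite -EFinM lee_fin mulr_ge0// min0.
  - apply: measurable_funTS; apply/measurable_EFinP; apply: measurable_funM => //.
    exact: mG.
  rewrite !ge0_integralZl_EFin//=; last 4 first.
  - by move=> x; rewrite /= in_itv/= andbT => x0'; rewrite lee_fin min0.
  - by apply: measurable_funTS; apply/measurable_EFinP; exact: mG.
  - by move=> x; rewrite /= in_itv/= andbT => x0'; rewrite lee_fin min0.
  - by apply: measurable_funTS; apply/measurable_EFinP; exact: mG.
  apply: lte_add_pinfty; apply: lte_mul_pinfty; rewrite ?lee_fin//.
  - by apply: integral_min1_powR_lty; rewrite /r; lra.
  - by apply: integral_min1_powR_lty; rewrite /q; lra.
have mpow : measurable_fun setT (fun x : R => (x / s) `^ (- alpha)).
  apply: (measurableT_comp (measurable_powR (- alpha))).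
  exact: measurable_funM.
have [] := @dominated_convergence _ _ _ leb `]0%R, +oo[%classic (measurable_itv _)
   (fun n => f (n + N0)%N) f_lim G.
- move=> n; apply: measurable_funTS; apply/measurable_EFinP.
  apply: measurable_funM => //; apply: measurable_funM => //.
  exact: measurable_abs_tail.
- by apply: measurable_funTS; apply/measurable_EFinP; apply: measurable_funM.
- apply/aeW => x; rewrite /= in_itv/= andbT => x0'.
  rewrite /f /f_lim; apply: cvg_EFin; first exact: nearW.
  apply: cvgMl_tmp.
  have xs : 0 < x / s by rewrite divr_gt0.
  have h := tail_cvg abs_tail_gt0 abs_tail_rv scale_lt scale_gt scale_cvg xs.
  by rewrite (cvg_shiftn N0 (fun n : nat => n%:R * abs_tail (a n * (x / s)))).
- exact: iG.
- apply/aeW => x n; rewrite /= in_itv/= andbT => x0'.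
  have t0 : 0 <= (n + N0)%:R * abs_tail (a (n + N0) * (x / s)).
    by rewrite mulr_ge0// ltW// abs_tail_gt0// mulr_gt0// divr_gt0.
  rewrite lee_fin (ger0_norm (mulr_ge0 (g0 x) t0)).
  have xs : 0 < x / s by rewrite divr_gt0.
  have m0 : 0 <= Num.min x 1 by rewrite le_min ler01 ltW.
  apply: le_trans (ler_pM (g0 x) t0 (gC x x0') (dom _ _ (aN n) xs)) _.
  rewrite !powRN_div// le_eqVlt; apply/orP; left; apply/eqP; ring.
move=> i_lim _ lim.
have flimE : (\int[leb]_(x in `]0%R, +oo[) f_lim x =
    (s `^ alpha)%:E * \int[leb]_(x in `]0%R, +oo[) (g x * x `^ (- alpha))%:E)%E.
  rewrite -ge0_integralZl_EFin ?powR_ge0//; last 2 first.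
  - by move=> x _; rewrite lee_fin mulr_ge0 ?powR_ge0.
  - by apply: measurable_funTS; apply/measurable_EFinP; apply: measurable_funM.
  apply: eq_integral => x /set_mem; rewrite /= in_itv/= andbT => x0'.
  by rewrite /f_lim powRN_div// mulrCA EFinM.
split.
  have sp : (0 < (s `^ alpha)%:E)%E by rewrite lte_fin powR_gt0.
  have : (\int[leb]_(x in `]0%R, +oo[) f_lim x \is a fin_num)%E by exact: integrable_fin_num.
  rewrite flimE.
  case: (\int[leb]_(x in _) _)%E => [u||] //; first by rewrite ltry.
  by rewrite gt0_muley.
rewrite -flimE -(cvg_shiftn N0); move: lim; apply: cvg_trans.
apply: near_eq_cvg; apply: nearW => n /=.
by rewrite (integral_jump (aN_gt0 n) s0 mg g0 gF).
Qed.

(** The limit of the previous lemma, integrated by parts back into an integral of [F] against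
the Levy measure. *)
Lemma jump_moment_cvg (s C : R) (F f : R -> R) : 0 < s ->
  (forall x : R, is_derive x 1 F (f x)) -> continuous f -> F 0 = 0 ->
  (forall x, 0 < x -> 0 <= f x <= C * Num.min x 1) ->
  let I := (\int[leb]_(x in `]0%R, +oo[) (F x / x `^ (alpha + 1))%:E)%E in
  (I < +oo)%E /\
  (N%:R%:E * \int[P0]_w (F (s * `|jump N w|))%:E @[N --> \oo] -->
   (s `^ alpha * alpha)%:E * I)%E.
Proof.
move=> s0 dF cf F0 fC I; have /andP[a1 a2] := alpha12.
pose g (x : R) : R := `|f x|.
have cg : continuous g by move=> x; apply: continuous_comp; [exact: cf|exact: norm_continuous].
have mg : measurable_fun setT g by exact: continuous_measurable_fun.
have cF : continuous F.
  move=> x; apply: differentiable_continuous; apply/derivable1_diffP.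
  exact: (@ex_derive _ _ _ _ _ _ _ (dF x)).
have mF : measurable_fun setT F by exact: continuous_measurable_fun.
have gF (y : R) : 0 <= y -> (\int[leb]_(x in `]0%R, y[) (g x)%:E = (F y)%:E)%E.
  move=> y0; rewrite -(integral_derivative dF cf F0 y0).
  apply: eq_integral => x /set_mem; rewrite /= in_itv/= => /andP[x0 _].
  by rewrite /g ger0_norm//; have /andP[] := fC _ x0.
have gC (x : R) : 0 < x -> g x <= C * Num.min x 1.
  by move=> x0; have /andP[f0 fx] := fC _ x0; rewrite /g ger0_norm.
have [fin lim] := jump_integral_cvg s0 mg (fun x => normr_ge0 _) gC gF.
have a0 : 0 < alpha by lra.
have := integral_pareto a0 mg (fun x => normr_ge0 _) gF mF; rewrite -/I => IE.
rewrite -IE in fin lim; split; last by rewrite EFinM -muleA.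
move: fin; have I0 : (0 <= I)%E.
  apply: integral_ge0 => x; rewrite /= in_itv/= andbT => x0.
  rewrite lee_fin divr_ge0 ?powR_ge0// -lee_fin -gF ?(ltW x0)//.
  by apply: integral_ge0 => z _; rewrite lee_fin; exact: normr_ge0.
by case: I I0 {IE lim} => [u _|_|//]; rewrite ?ltry// gt0_muley// lte_fin.
Qed.

(** Above 1 only the upper half of [tail_domination] matters, with an exponent strictly
between [q] and [alpha] so that the layer-cake integral of [x ^ q] converges. *)
Lemma jump_far_moment (q : R) : 1 <= q -> q < alpha ->
  exists2 C : R, 0 <= C & \forall N \near \oo,
    (N%:R%:E * \int[P0]_w (if (1 < `|jump N w|)%R then `|jump N w| `^ q else 0)%:E <= C%:E)%E.
Proof.
move=> q1 qa; have /andP[a1 a2] := alpha12.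
pose t := (q + alpha) / 2; pose r := (alpha + 2) / 2.
have t0 : 0 < t by rewrite /t; lra.
have ta : t < alpha by rewrite /t; lra.
have qt : q < t by rewrite /t; lra.
have ar : alpha < r by rewrite /r; lra.
have [C1 [x0 x0_gt0 dom]] := tail_domination abs_tail_gt0 abs_tail_le1
  abs_tail_rv scale_gt t0 ta ar.
pose g (x : R) : R := if 1 < x then q * x `^ (q - 1) else 0.
pose F (y : R) : R := if 1 < y then y `^ q - 1 else 0.
have g0 x : 0 <= g x by rewrite /g; case: ifP => // _; rewrite mulr_ge0 ?powR_ge0//; lra.
have mg : measurable_fun setT g.
  apply: measurable_fun_ifT => //; first exact: measurable_fun_ltr.
  by apply: measurable_funM => //; exact: measurable_powR.
have mF : measurable_fun setT F.
  apply: measurable_fun_ifT => //; first exact: measurable_fun_ltr.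
  by apply: measurable_funB => //; exact: measurable_powR.
have F_ge0 y : 0 <= F y.
  rewrite /F; case: ifP => // y1; rewrite subr_ge0 -[leLHS](_ : 1 `^ q = 1); last by rewrite powR1.
  by apply: le_powR2r; [lra|lra|exact: ltW].
have gE (D : set R) : measurable D ->
    (\int[leb]_(x in D) (g x)%:E = \int[leb]_(x in D `&` `]1%R, +oo[) (q * x `^ (q - 1))%:E)%E.
  move=> mD; rewrite integral_mkcondr; apply: eq_integral => x _.
  rewrite patchE /g; case: ifPn => [x1|x1].
    by rewrite mem_set//= in_itv/= x1.
  by rewrite memNset//= in_itv/= andbT; exact/negP.
have gF (y : R) : 0 <= y -> (\int[leb]_(x in `]0%R, y[) (g x)%:E = (F y)%:E)%E.
  move=> y0; rewrite gE// /F; case: ifPn => [y1|]; last first.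
    rewrite -leNgt => y1; rewrite (_ : _ `&` _ = set0) ?integral_set0//.
    apply/seteqP; split => x //=; rewrite !in_itv/= andbT => -[/andP[_ xy] x1].
    by have := lt_trans x1 (lt_le_trans xy y1); rewrite ltxx.
  have -> : `]0, y[%classic `&` `]1, +oo[ = `]1, y[%classic :> set R.
    apply/seteqP; split => x /=; rewrite !in_itv/= andbT.
      by move=> [/andP[_ ->] ->].
    by move=> /andP[x1 ->]; rewrite x1 (lt_trans ltr01 x1).
  have mf : measurable_fun setT (fun x : R => (q * x `^ (q - 1))%:E).
    by apply/measurable_EFinP; apply: measurable_funM => //; exact: measurable_powR.
  rewrite integral_itv_bndo_bndc ?integral_itv_obnd_cbnd; [|exact: measurable_funTS..].
  rewrite (@continuous_FTC2 _ _ (fun x => x `^ q))//.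
  - by rewrite -EFinB powR1.
  - apply: continuous_in_subspaceT => x; rewrite inE/= in_itv/= => /andP[x1 _].
    by apply: cvgMl_tmp; apply: continuous_powR; lra.
  - split.
    + move=> x; rewrite in_itv/= => /andP[x1 _].
      by apply: (@ex_derive _ _ _ _ _ _ _ (is_derive1_powR q _)); lra.
    + by apply: cvg_at_right_filter; apply: continuous_powR.
    + by apply: cvg_at_left_filter; apply: continuous_powR; lra.
  - move=> x; rewrite in_itv/= => /andP[x1 _]; rewrite derive1E.
    by apply: (@derive_val _ _ _ _ _ _ _ (is_derive1_powR q _)); lra.
have C10 : 0 <= C1.
  have [N0 _ hN0] : \forall N \near \oo, x0 <= a N by exact: scale_cvg.
  have := dom N0 1 (hN0 N0 (leqnn _)) ltr01; rewrite !powR1 mulr1 => h.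
  have : 0 <= N0%:R * abs_tail (a N0).
    by rewrite mulr_ge0// ltW// abs_tail_gt0// (lt_le_trans x0_gt0)//; exact: (hN0 N0 (leqnn _)).
  lra.
exists (2 * C1 + q * (2 * C1) * (t - q)^-1).
  by rewrite addr_ge0 ?mulr_ge0 ?invr_ge0//; lra.
near=> N.
have xa : x0 <= a N by near: N; exact: scale_cvg.
have a0 : 0 < a N by apply: lt_le_trans xa.
have -> : (\int[P0]_w (if (1 < `|jump N w|)%R then `|jump N w| `^ q else 0)%:E =
   \int[P0]_w ((\1_[set w | 1 < 1 * `|jump N w|] w)%:E + (F (1 * `|jump N w|))%:E))%E.
  apply: eq_integral => w _; rewrite -EFinD mul1r; congr _%:E; rewrite /F indicE.
  have -> : (w \in [set w | 1 < 1 * `|jump N w|]) = (1 < `|jump N w|).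
    by apply/idP/idP => [/set_mem/=|h]; rewrite ?mul1r//; apply: mem_set; rewrite /= mul1r.
  by case: ifP => _; rewrite /= ?addr0//; ring.
have mA : measurable [set w | 1 < 1 * `|jump N w|].
  by rewrite (abs_jump_gt _ a0 ltr01); exact: measurable_abs_gt.
rewrite ge0_integralD//=; last 3 first.
- by apply/measurable_EFinP; exact: measurable_indic.
- by move=> w _; rewrite lee_fin.
- apply/measurable_EFinP; apply: (measurableT_comp mF); apply: measurable_funM => //.
  by apply: measurableT_comp => //; exact: measurable_jump.
rewrite ge0_muleDr; last 2 first.
- by apply: integral_ge0 => w _; rewrite lee_fin.
- by apply: integral_ge0 => w _; rewrite lee_fin.
rewrite EFinD; apply: leeD.
  have PA : P0 [set w | 1 < 1 * `|jump N w|] = (abs_tail (a N))%:E.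
    by rewrite (abs_jump_gt _ a0 ltr01) abs_tailE divr1 mulr1.
  rewrite integral_indic// setIT; move: PA => /= ->; rewrite -EFinM lee_fin.
  by have := dom N 1 xa ltr01; rewrite !powR1 mulr1; lra.
rewrite (integral_jump a0 ltr01 mg g0 gF).
apply: (@le_trans _ _ (\int[leb]_(x in `]1%R, +oo[) ((q * (2 * C1))%:E * (x `^ (- (t - q) - 1))%:E))%E).
  rewrite [leLHS](_ : _ = \int[leb]_(x in `]1%R, +oo[) (g x * (N%:R * abs_tail (a N * (x / 1))))%:E)%E.
    apply: ge0_le_integral => //.
    - move=> x; rewrite /= in_itv/= andbT => x1; rewrite lee_fin mulr_ge0// mulr_ge0// ltW//.
      by rewrite abs_tail_gt0// mulr_gt0// divr_gt0//; lra.
    - apply: measurable_funTS; apply/measurable_EFinP; apply: measurable_funM => //.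
      by apply: measurable_funM => //; exact: measurable_abs_tail.
    - by apply: measurable_funTS; apply/measurable_EFinP; apply: measurable_funM.
    - move=> x; rewrite /= in_itv/= andbT => x1; rewrite -EFinM lee_fin divr1 /g x1.
      have x_gt0 : 0 < x by lra.
      have hx : N%:R * abs_tail (a N * x) <= 2 * C1 * x `^ (- t).
        have hr : x `^ (- r) <= x `^ (- t) by rewrite ler_powR ?(ltW x1)// /r /t; lra.
        apply: le_trans (dom N x xa x_gt0) _.
        have := ler_wpM2l C10 hr; lra.
      have -> : x `^ (- (t - q) - 1) = x `^ (q - 1) * x `^ (- t).
        by rewrite -powRD ?(gt_eqF x_gt0) ?implybT//; congr (_ `^ _); ring.
      rewrite [leRHS](_ : _ = q * x `^ (q - 1) * (2 * C1 * x `^ (- t))); last by ring.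
      by rewrite ler_wpM2l// mulr_ge0 ?powR_ge0//; lra.
  rewrite [LHS]integral_mkcond [RHS]integral_mkcond; apply: eq_integral => x _.
  rewrite !patchE; case: ifPn => [/set_mem|/negP h].
    rewrite /= in_itv/= andbT => x_gt0; case: ifPn => [//|/negP h].
    by rewrite /g ifF ?mul0r//; apply/negP => x1; apply: h; apply: mem_set; rewrite /= in_itv/= x1.
  case: ifPn => // /set_mem; rewrite /= in_itv/= andbT => x1.
  by exfalso; apply: h; apply: mem_set; rewrite /= in_itv/= andbT (lt_trans ltr01).
rewrite ge0_integralZl_EFin//; last 3 first.
- by move=> x _; rewrite lee_fin powR_ge0.
- by apply: measurable_funTS; apply/measurable_EFinP; exact: measurable_powR.
- by rewrite !mulr_ge0//; lra.
rewrite integral_itv_obnd_cbnd; last first.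
  by apply: measurable_funTS; apply/measurable_EFinP; exact: measurable_powR.
by rewrite integral_powR_cy//; [rewrite powR1 mulr1 -EFinM|lra].
Unshelve. all: by end_near. Qed.

(** The limit of the left-hand side is [(beta / beta_crit alpha) ^ alpha], by the scaling
of the Levy measure: this is where the critical temperature enters. *)
Lemma tanh_moment_lt1 (beta : R) : 0 < beta < beta_crit alpha ->
  exists2 c : R, 0 <= c < 1 & \forall N \near \oo,
    (N%:R%:E * \int[P0]_w (tanh (beta * jump N w) ^+ 2)%:E <= c%:E)%E.
Proof.
move=> /andP[b0 bc]; have /andP[a1 a2] := alpha12.
pose f (x : R) := 2 * tanh x * (1 - tanh x ^+ 2).
have dF (x : R) : is_derive x 1 (fun y => tanh y ^+ 2) (f x).
  have h := is_derive_tanh x; have h2 := is_deriveX 1 h.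
  by apply: is_derive_eq; rewrite /f /GRing.scale/=; ring.
have ct : continuous (@tanh R).
  move=> x; apply: differentiable_continuous; apply/derivable1_diffP.
  exact: (@ex_derive _ _ _ _ _ _ _ (is_derive_tanh x)).
have cf : continuous f.
  move=> x; apply: cvgM; first by apply: cvgMl_tmp; exact: ct.
  by apply: cvgB; [exact: cvg_cst|apply: cvgM; exact: ct].
have fC (x : R) : 0 < x -> 0 <= f x <= 2 * Num.min x 1.
  move=> x0; have t0 := tanh_ge0 (ltW x0); have t1 := sqr_tanh_le1 x.
  have tm := tanh_le_minr1 (ltW x0).
  have u0 : 0 <= 1 - tanh x ^+ 2 by rewrite subr_ge0.
  rewrite /f; apply/andP; split; first by apply: mulr_ge0 => //; apply: mulr_ge0.
  rewrite -mulrA ler_pM2l//; apply: le_trans tm.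
  by rewrite ler_piMr// gerBl; exact: sqr_ge0.
have F0 : (tanh 0 : R) ^+ 2 = 0 by rewrite tanh0 expr0n.
have := jump_moment_cvg b0 dF cf F0 fC.
set I := (\int[leb]_(x in _) _)%E => -[Ifin lim].
have I0 : (0 <= I)%E.
  by apply: integral_ge0 => x _; rewrite lee_fin divr_ge0 ?powR_ge0 ?sqr_ge0.
have IE : I = (fine I)%:E by rewrite fineK// ge0_fin_numE.
have i0 : 0 <= fine I by exact: fine_ge0.
have lt1 : beta `^ alpha * alpha * fine I < 1.
  have bcE : beta_crit alpha = (alpha * fine I) `^ (- (1 / alpha)) by [].
  have [z|nz] := eqVneq (alpha * fine I) 0; first by rewrite -mulrA z mulr0.
  have z0 : 0 < alpha * fine I by rewrite lt_def nz mulr_ge0//; lra.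
  have : beta `^ alpha < beta_crit alpha `^ alpha.
    by rewrite gt0_ltr_powR ?nnegrE ?(ltW b0)//; [lra|apply: ltW; apply: lt_trans bc].
  rewrite bcE -powRrM div1r mulNr mulVf; last by rewrite gt_eqF//; lra.
  by rewrite powR_inv1 ?(ltW z0)// -mulrA -ltr_pdivlMr// div1r.
pose l := beta `^ alpha * alpha * fine I.
have l0 : 0 <= l by rewrite /l !mulr_ge0 ?powR_ge0//; lra.
exists ((l + 1) / 2); first by rewrite -/l in lt1; lra.
rewrite IE -EFinM -/l in lim.
near=> N.
have -> : (\int[P0]_w (tanh (beta * jump N w) ^+ 2)%:E =
           \int[P0]_w (tanh (beta * `|jump N w|) ^+ 2)%:E)%E.
  apply: eq_integral => w _; congr _%:E.
  by case: (ler0P (jump N w)) => _; rewrite ?mulrN ?tanhN ?sqrrN.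
near: N; have h : (l%:E < ((l + 1) / 2)%:E)%E by rewrite lte_fin -/l in lt1 *; lra.
have := lim => /(_ [set y | (y <= ((l + 1) / 2)%:E)%E]) /=; apply.
apply: (@filterS _ _ _ [set y | (y < ((l + 1) / 2)%:E)%E]); first by move=> y /ltW.
by apply: open_nbhs_nbhs; split => //; exact: open_ereal_lt_ereal.
Unshelve. all: by end_near. Qed.

Lemma lncosh_moment_cvg (beta : R) : 0 < beta ->
  (N%:R%:E * \int[P0]_w (lncosh (beta * jump N w))%:E @[N --> \oo] -->
   (alpha * \int[leb]_(x in `]0%R, +oo[) (lncosh (beta * x) / x `^ (alpha + 1)))%R%:E)%E.
Proof.
move=> b0; have /andP[a1 a2] := alpha12.
pose F (x : R) := lncosh (beta * x).
pose f (x : R) := beta * tanh (beta * x).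
have dF (x : R) : is_derive x 1 F (f x).
  have h := is_derive_lncosh (beta * x).
  have h2 : is_derive x 1 (fun y : R => beta * y) beta.
    by apply: is_derive_eq; rewrite /GRing.scale/= mulr1.
  have := is_derive1_comp h h2; by rewrite mulrC.
have cf : continuous f.
  move=> x; apply: cvgMl_tmp; apply: (@cvg_comp _ _ _ (fun y => beta * y) (@tanh R)).
    by apply: cvgMl_tmp; exact: cvg_id.
  apply: differentiable_continuous; apply/derivable1_diffP.
  exact: (@ex_derive _ _ _ _ _ _ _ (is_derive_tanh _)).
have fC (x : R) : 0 < x -> 0 <= f x <= (beta * (beta + 1)) * Num.min x 1.
  move=> x0; have bx : 0 <= beta * x by rewrite mulr_ge0// ltW.
  have t0 := tanh_ge0 bx; have := tanh_le_minr1 bx.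
  rewrite le_min /f => /andP[t1 t2].
  rewrite (mulr_ge0 (ltW b0) t0)/= -mulrA ler_pM2l//.
  by have [x1|x1] := leP x 1; nra.
have F0 : F 0 = 0 by rewrite /F mulr0 lncosh0.
have := jump_moment_cvg ltr01 dF cf F0 fC; rewrite powR1 mul1r.
set I := (\int[leb]_(x in _) _)%E => -[Ifin lim].
have I0 : (0 <= I)%E.
  by apply: integral_ge0 => x _; rewrite lee_fin divr_ge0 ?powR_ge0// lncosh_ge0.
have IE : I = (fine I)%:E by rewrite fineK// ge0_fin_numE.
rewrite IE -EFinM in lim.
have absE N : (\int[P0]_w (F (1 * `|jump N w|))%:E = \int[P0]_w (lncosh (beta * jump N w))%:E)%E.
  apply: eq_integral => w _; congr _%:E; rewrite mul1r /F.
  by case: (ler0P (jump N w)) => _; rewrite ?mulrN /lncosh ?coshN.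
by under eq_cvg do rewrite -absE; exact: lim.
Qed.

End rescaled_bond.
(** * Discretisation of the bonds *)

Section finite_valued.
Context {R : realType}.

Lemma integral_finite_rv d (Om : measurableType d) (P : probability Om R)
    (V : finType) (Y : Om -> V) (h : V -> R) :
  (forall v, measurable (Y @^-1` [set v])) -> (forall v, 0 <= h v) ->
  (\int[P]_w (h (Y w))%:E = (\sum_v fine (P (Y @^-1` [set v])) * h v)%:E)%E.
Proof.
move=> mY h0.
transitivity (\int[P]_w \sum_v ((h v)%:E * (\1_(Y @^-1` [set v]) w)%:E))%E.
  apply: eq_integral => w _; rewrite (bigD1 (Y w))//= big1 ?adde0.
    by rewrite indicE mem_set// mule1.
  by move=> v vY; rewrite indicE memNset ?mule0//= => /esym/eqP; rewrite (negbTE vY).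
rewrite ge0_integral_sum//; last 2 first.
- by move=> v; apply/measurable_EFinP; apply: measurable_funM.
- by move=> v w _; rewrite -EFinM lee_fin mulr_ge0.
rewrite -sumEFin; apply: eq_bigr => v _.
rewrite ge0_integralZl_EFin//; last first.
  by apply/measurable_EFinP; exact: measurable_indic.
rewrite integral_indic// setIT muleC EFinM fineK//.
exact: fin_num_measure.
Qed.

Lemma same_law_integral d1 d2 (T1 : measurableType d1) (T2 : measurableType d2)
    (P1 : probability T1 R) (P2 : probability T2 R) (X1 : T1 -> R) (X2 : T2 -> R)
    (psi : R -> R) :
  measurable_fun setT X1 -> measurable_fun setT X2 -> same_law P1 P2 X1 X2 ->
  measurable_fun setT psi -> (forall x, 0 <= psi x) ->
  (\int[P1]_w (psi (X1 w))%:E = \int[P2]_w (psi (X2 w))%:E)%E.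
Proof.
move=> m1 m2 law mpsi psi0.
have e1 := @ge0_integral_pushforward _ _ _ _ R X1 m1 P1 setT (fun x => (psi x)%:E) measurableT.
have e2 := @ge0_integral_pushforward _ _ _ _ R X2 m2 P2 setT (fun x => (psi x)%:E) measurableT.
rewrite !preimage_setT in e1 e2.
have mp : measurable_fun setT (fun x => (psi x)%:E) by exact/measurable_EFinP.
have p0 : {in [set: R], forall y, (0 <= (psi y)%:E)%E} by move=> y _; rewrite lee_fin.
transitivity (\int[pushforward P1 X1]_y (psi y)%:E)%E; first by rewrite e1.
transitivity (\int[pushforward P2 X2]_y (psi y)%:E)%E; last by rewrite e2.
by apply: eq_measure_integral => A mA _; exact: law.
Qed.

End finite_valued.

Section discretisation.
Context {R : realType} (M : nat).

(** The modulus is rounded down to a multiple of [1 / M] and capped at [M], so that the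
discretisation is odd and decreases moduli. *)
Definition grid_level (x : R) : nat := minn (M * M) (Num.truncn (`|x| * M%:R)).

Definition grid := (bool * 'I_(M * M).+1)%type.

Definition grid_code (x : R) : grid := (x < 0, inord (grid_level x)).

Definition grid_val (v : grid) : R := (-1) ^+ v.1 * (v.2%:R / M%:R).

Definition grid_round (x : R) : R := grid_val (grid_code x).

Lemma grid_roundE x : grid_round x = (-1) ^+ (x < 0)%R * ((grid_level x)%:R / M%:R).
Proof. by rewrite /grid_round /grid_val /grid_code/= inordK// ltnS geq_minl. Qed.

Lemma grid_levelN x : grid_level (- x) = grid_level x.
Proof. by rewrite /grid_level normrN. Qed.

Lemma grid_level_le x : (grid_level x)%:R / M%:R <= `|x|.
Proof.
have [->|M0] := eqVneq M 0%N; first by rewrite invr0 mulr0.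
rewrite ler_pdivrMr ?ltr0n ?lt0n//.
apply: (@le_trans _ _ (Num.truncn (`|x| * M%:R))%:R); first by rewrite ler_nat geq_minr.
by have /andP[] := truncn_itv (mulr_ge0 (normr_ge0 x) (ler0n R M)).
Qed.

Lemma grid_level0 : grid_level 0 = 0%N.
Proof. by rewrite /grid_level normr0 mul0r truncn0 minn0. Qed.

Lemma grid_roundN x : grid_round (- x) = - grid_round x.
Proof.
rewrite !grid_roundE grid_levelN oppr_lt0.
case: (ltgtP x 0) => [x0|x0|->]; rewrite ?expr1 ?expr0 ?mul1r ?mulN1r ?opprK//.
by rewrite grid_level0 mul0r oppr0.
Qed.

Lemma norm_grid_round x : `|grid_round x| = (grid_level x)%:R / M%:R.
Proof. by rewrite grid_roundE normrM normrX normrN1 expr1n mul1r ger0_norm ?divr_ge0. Qed.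

Lemma grid_round_le x : `|grid_round x| <= `|x|.
Proof. by rewrite norm_grid_round grid_level_le. Qed.

Lemma dist_grid_round x : `|x - grid_round x| = `|x| - `|grid_round x|.
Proof.
wlog x0 : x / 0 <= x => [h|].
  have [/h//|/ltW x0] := leP 0 x.
  by rewrite -(normrN x) -(normrN (grid_round x)) -grid_roundN -h ?oppr_ge0// grid_roundN -opprD normrN.
have r0 : 0 <= grid_round x by rewrite grid_roundE ltNge x0 expr0 mul1r divr_ge0.
by rewrite !ger0_norm// subr_ge0 -[leRHS]ger0_norm// -[leLHS]ger0_norm// grid_round_le.
Qed.

Lemma dist_grid_round_le x : `|x - grid_round x| <= `|x|.
Proof. by rewrite dist_grid_round gerBl. Qed.

(** Below the cap [M] the rounding error is at most one mesh. *)
Lemma dist_grid_round_small x : (0 < M)%N -> `|x| <= M%:R -> `|x - grid_round x| <= M%:R^-1.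
Proof.
move=> M0 xM; have Mr : 0 < M%:R :> R by rewrite ltr0n.
rewrite dist_grid_round norm_grid_round lerBlDl.
have xM0 : 0 <= `|x| * M%:R by rewrite mulr_ge0.
have /andP[h1 h2] := truncn_itv xM0.
have -> : grid_level x = Num.truncn (`|x| * M%:R).
  apply/minn_idPr; rewrite -(ler_nat R); apply: le_trans h1 _.
  by rewrite natrM ler_pM2r.
by rewrite -[X in _ + X]div1r -mulrDl natr1 ler_pdivlMr// ltW.
Qed.

Lemma measurable_grid_level : measurable_fun setT (fun x : R => (grid_level x)%:R : R).
Proof.
have h : measurable_fun setT
    (fun y : R => (minn (M * M) (Num.truncn (y * M%:R)))%:R : R).
  apply: nondecreasing_measurable => // x y xy.
  rewrite ler_nat leq_min geq_minl/=; apply: leq_trans (geq_minr _ _) _.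
  by apply: le_truncn; rewrite ler_wpM2r.
by apply: (measurableT_comp h); exact: normr_measurable.
Qed.

Lemma measurable_grid_code v : measurable (grid_code @^-1` [set v]).
Proof.
have -> : grid_code @^-1` [set v] =
    ((fun x : R => x < 0) @^-1` [set v.1]) `&` ((fun x : R => (grid_level x)%:R : R) @^-1` [set v.2%:R]).
  apply/seteqP; split => x /=.
    by rewrite /grid_code => <- /=; rewrite inordK// ltnS geq_minl.
  case: v => b k/= [<- /eqP]; rewrite eqr_nat => /eqP h.
  by rewrite /grid_code h inord_val.
apply: measurableI.
- have : measurable_fun setT (fun x : R => x < 0) by exact: measurable_fun_ltr.
  by move=> /(_ measurableT [set v.1]); rewrite setTI; exact.
- by have := measurable_grid_level measurableT (measurable_set1 (v.2%:R)); rewrite setTI.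
Qed.

Lemma measurable_grid_round : measurable_fun setT grid_round.
Proof.
rewrite (_ : grid_round = fun x => (if x < 0 then -1 else 1) * ((grid_level x)%:R / M%:R)); last first.
  by apply/funext => x; rewrite grid_roundE; case: ifP; rewrite ?expr1 ?expr0.
apply: measurable_funM.
  by apply: measurable_fun_ifT => //; exact: measurable_fun_ltr.
by apply: measurable_funM => //; exact: measurable_grid_level.
Qed.

End discretisation.
Section approximation.
Context {R : realType}.

(** Dominated convergence: the error is at most the modulus, and at most one mesh once [M]
exceeds the modulus. *)
Lemma grid_round_moment_cvg d (Om : measurableType d) (P : probability Om R)
    (Y : Om -> R) (q : R) : measurable_fun setT Y -> 0 < q ->
  (\int[P]_w (`|Y w| `^ q)%:E < +oo)%E ->
  (\int[P]_w (`|Y w - grid_round M (Y w)| `^ q)%:E @[M --> \oo] --> 0)%E.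
Proof.
move=> mY q0 fin.
have mnorm (h : Om -> R) : measurable_fun setT h ->
    measurable_fun setT (fun w => (`|h w| `^ q)%:E).
  move=> mh; apply/measurable_EFinP; apply: (measurableT_comp (measurable_powR q)).
  exact: measurableT_comp.
have [] := @dominated_convergence _ _ _ P setT measurableT
  (fun M w => (`|Y w - grid_round M (Y w)| `^ q)%:E) (fun=> 0%E)
  (fun w => (`|Y w| `^ q)%:E).
- move=> M; apply: mnorm; apply: measurable_funB => //.
  by apply: measurableT_comp => //; exact: measurable_grid_round.
- exact: measurable_cst.
- apply/aeW => w _; apply: cvg_EFin; first exact: nearW.
  apply: (@squeeze_cvgr _ _ _ _ (fun=> 0) (fun M : nat => M%:R `^ (- q))).
  + near=> M; rewrite powR_ge0/= powRN -powR_inv1// -powRrM mulrC powRrM powR_inv1//.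
    have M0 : (0 < M)%N by near: M; exact: nbhs_infty_gt.
    apply: le_powR2r; rewrite ?(ltW q0)//; apply: dist_grid_round_small => //.
    by near: M; exact: nbhs_infty_ger.
  + exact: cvg_cst.
  + apply: (cvg_comp _ _ _ (cvg_powRN q0)); exact: cvgr_idn.
- apply/integrableP; split; first exact: mnorm.
  by under eq_integral do rewrite gee0_abs ?lee_fin ?powR_ge0//.
- apply/aeW => w M _; rewrite lee_fin ger0_norm ?powR_ge0//.
  by apply: le_powR2r; rewrite ?(ltW q0)// dist_grid_round_le.
by move=> _ _; rewrite integral0.
Unshelve. all: by end_near. Qed.

Section joint_law.
Context (N M : nat) {d : measure_display} {Om : measurableType d} (P : probability Om R).
Context (J : 'I_N -> 'I_N -> {RV P >-> R}).

Definition edge_value (w : Om) (e : edge N) : R := J (val e).1 (val e).2 w.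

(** A random element of a finite type, so that its law is a finite product and the averages
over finite product spaces apply. *)
Definition edge_code (w : Om) : {ffun edge N -> grid M} :=
  [ffun e => grid_code M (edge_value w e)].

Lemma measurable_edge_value e : measurable_fun setT (edge_value ^~ e).
Proof. by []. Qed.

Lemma edge_code_preimage f : edge_code @^-1` [set f] =
  \bigcap_(e in [set: edge N]) ((edge_value ^~ e) @^-1` (grid_code M @^-1` [set f e])).
Proof.
apply/seteqP; split => w /=.
  by move=> /ffunP h e _ /=; rewrite -h ffunE.
by move=> h; apply/ffunP => e; rewrite ffunE; exact: (h e I).
Qed.

Lemma measurable_edge_code f : measurable (edge_code @^-1` [set f]).
Proof.
rewrite edge_code_preimage; apply: fin_bigcap_measurable => [|e _].
  exact: finite_finset.
rewrite -[X in measurable X]setTI; apply: measurable_edge_value => //.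
exact: measurable_grid_code.
Qed.

Lemma edge_code_law (mu : grid M -> R) :
  independent_rvs P (fun e : 'I_N * 'I_N => (e.1 < e.2)%N) (fun e => J e.1 e.2) ->
  (forall (e : edge N) v,
     P ((edge_value ^~ e) @^-1` (grid_code M @^-1` [set v])) = (mu v)%:E) ->
  forall f, P (edge_code @^-1` [set f]) = (\prod_e mu (f e))%:E.
Proof.
move=> indep law f.
pose S := [set e : 'I_N * 'I_N | (e.1 < e.2)%N]%SET.
(* Independence is stated for pairs of indices, the code for edges. *)
pose A (e : 'I_N * 'I_N) : set R :=
  if insub e is Some e' then grid_code M @^-1` [set f e'] else setT.
have AE (e : edge N) : A (val e) = grid_code M @^-1` [set f e] by rewrite /A valK.
have := indep S A; rewrite (_ : [set w | _] = edge_code @^-1` [set f]); last first.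
  rewrite edge_code_preimage; apply/seteqP; split => w /= h e.
    by move=> _ /=; have := h (val e); rewrite inE AE; apply; exact: (valP e).
  rewrite inE => he; have := h (Sub e he) I.
  by rewrite /A insubT.
move=> ->.
- rewrite -prodEFin.
  rewrite (eq_bigl (fun e : 'I_N * 'I_N => (e.1 < e.2)%N)); last by move=> e; rewrite inE.
  rewrite (big_sub (fun e : 'I_N * 'I_N => (e.1 < e.2)%N)
     (fun e => P ((fun w => J e.1 e.2 w) @^-1` A e))) /=.
  by apply: eq_bigr => e _; rewrite AE -(law e).
- by move=> e; rewrite inE.
- move=> e _; rewrite /A; case: insub => [e'|]; [exact: measurable_grid_code|exact: measurableT].
Qed.

Lemma integral_edge_code (mu : grid M -> R) (G : {ffun edge N -> grid M} -> R) :
  independent_rvs P (fun e : 'I_N * 'I_N => (e.1 < e.2)%N) (fun e => J e.1 e.2) ->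
  (forall (e : edge N) v,
     P ((edge_value ^~ e) @^-1` (grid_code M @^-1` [set v])) = (mu v)%:E) ->
  (forall f, 0 <= G f) ->
  (\int[P]_w (G (edge_code w))%:E = (average mu G)%:E)%E.
Proof.
move=> indep law G0; rewrite integral_finite_rv//; last exact: measurable_edge_code.
by congr _%:E; apply: eq_bigr => f _; rewrite (edge_code_law indep law).
Qed.

End joint_law.
End approximation.
(** * The free energy at finite volume *)

Section near_bonds.
Context {R : realType} (N : nat).
Local Notation config := {ffun 'I_N -> bool}.

(** The square of the magnetization of the constant configuration counts the edges. *)
Lemma card_edgeE : #|{: edge N}|%:R = (N%:R ^+ 2 - N%:R) / 2 :> R.
Proof.
have := @sqr_magnetization R N [ffun=> false].
have -> : @magnetization R N [ffun=> false] = N%:R.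
  rewrite /magnetization (eq_bigr (fun=> 1)) ?sumr_const ?card_ord// => i _.
  by rewrite ffunE.
have -> : \sum_(e : edge N) (-1) ^+ edge_sign [ffun=> false] e = #|{: edge N}|%:R :> R.
  rewrite (eq_bigr (fun=> 1)) ?sumr_const// => e _.
  by rewrite /edge_sign !ffunE.
by move=> ->; field.
Qed.

Lemma card_edge_ler : #|{: edge N}|%:R <= N%:R ^+ 2 :> R.
Proof. by rewrite -natrX ler_nat card_edge_le. Qed.

Lemma partition_functionE (beta : R) (J : 'I_N -> 'I_N -> R) :
  partition_function beta J =
  gibbs_sum (@edge_sign N) (fun e : edge N => beta * J (val e).1 (val e).2).
Proof.
apply: eq_bigr => s _; congr expR; rewrite /hamiltonian opprK.
rewrite -(sum_edge (fun i j => J i j * spin s i * spin s j)) mulr_sumr.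
by apply: eq_bigr => e _; rewrite /edge_sign signr_addb /spin; ring.
Qed.

Lemma card_config_gt0 : (0 < #|{: config}|)%N.
Proof. by rewrite card_ffun card_bool expn_gt0. Qed.

Lemma ln_card_config : ln #|{: config}|%:R = N%:R * ln 2 :> R.
Proof. by rewrite card_ffun card_bool card_ord natrX lnXn// mulr_natl. Qed.

(** The bound of [overlap_bound] per pair of configurations; it blows up as [c] tends to 1,
that is at the critical temperature. *)
Definition overlap_const (c : R) : R := 2 * expR (c / 2) / (1 - expR (- ((1 - c) / 2))).

Lemma overlap_const_ge0 (c : R) : c < 1 -> 0 <= overlap_const c.
Proof.
move=> c1; have h : expR (- ((1 - c) / 2)) <= 1 by rewrite -[leRHS]expR0 ler_expR; lra.
by rewrite divr_ge0 ?subr_ge0// mulr_ge0// expR_ge0.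
Qed.

(** The [L^2] law of large numbers for bonds with a second moment. With order [N ^ 2] bonds of
variance of order [1 / N], the error of [ln Z] is of order [N ^ (1 / 2)]. *)
Lemma near_free_energy {V : finType} (mu y : V -> R) (c D : R) :
  (0 < N)%N -> (forall v, 0 <= mu v) -> \sum_v mu v = 1 ->
  \sum_v mu v * tanh (y v) = 0 -> 0 <= c < 1 ->
  N%:R * (\sum_v mu v * tanh (y v) ^+ 2) <= c ->
  N%:R * (\sum_v mu v * y v ^+ 2) <= D ->
  average mu (fun f : {ffun edge N -> V} =>
     (N%:R^-1 * ln (gibbs_sum (@edge_sign N) (y \o f)) -
      (ln 2 + N%:R^-1 * #|{: edge N}|%:R * (\sum_v mu v * lncosh (y v)))) ^+ 2)
  <= (10 * D + 64 * overlap_const c * D + 4) / N%:R.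
Proof.
move=> N0 mu0 mu1 centred c01 hc hD; have Nr : 0 < N%:R :> R by rewrite ltr0n.
have tau0 : 0 <= \sum_v mu v * tanh (y v) ^+ 2.
  by apply: sumr_ge0 => v _; rewrite mulr_ge0 ?sqr_ge0.
have ov : \sum_(s : config) \sum_(t : config) \prod_(e : edge N)
    (1 + (-1) ^+ (edge_sign s e (+) edge_sign t e) * (\sum_v mu v * tanh (y v) ^+ 2)) <=
    overlap_const c * #|{: config}|%:R ^+ 2.
  by apply: overlap_bound; rewrite // mulrC.
have := average_sqr_ln_gibbs_sum card_config_gt0 mu0 mu1 centred erefl ov.
set A := #|_|%:R * (\sum_v mu v * y v ^+ 2).
have hA : A <= N%:R * D.
  apply: (@le_trans _ _ (N%:R ^+ 2 * (\sum_v mu v * y v ^+ 2))).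
    rewrite ler_wpM2r ?card_edge_ler//.
    by apply: sumr_ge0 => v _; rewrite mulr_ge0 ?sqr_ge0.
  by rewrite expr2 -mulrA ler_wpM2l.
move=> h; apply: (@le_trans _ _ (N%:R ^- 2 * (10 * A + 64 * overlap_const c * A + 4))).
  rewrite -exprVn.
  apply: le_trans (ler_wpM2l (sqr_ge0 N%:R^-1) h).
  rewrite -averageZ; apply: le_average => // f; rewrite -exprMn ln_card_config.
  rewrite le_eqVlt; apply/orP; left; apply/eqP; congr (_ ^+ 2).
  by field; rewrite gt_eqF.
have /andP[_ c1] := c01; have oc := overlap_const_ge0 c1.
set Q := 10 * A + _ + _; have -> : N%:R ^- 2 * Q = Q / N%:R / N%:R by field; rewrite gt_eqF.
rewrite ler_pM2r ?invr_gt0// ler_pdivrMr// /Q.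
have N1 : 1 <= N%:R :> R by rewrite ler1n.
have := ler_wpM2l oc hA; lra.
Qed.

End near_bonds.

Section power_of_sum.
Context {R : realType}.

Lemma powR_sum_le (I : finType) (u : I -> R) (q : R) : 0 < q -> (forall i, 0 <= u i) ->
  (\sum_i u i) `^ q <= #|I|%:R `^ q * \sum_i u i `^ q.
Proof.
move=> q0 u0; have [i0 _|I0] := pickP (@predT I); last first.
  by rewrite !big_pred0// powR0 ?gt_eqF// mulr0.
have [i _ hi] := @arg_maxP _ R I i0 predT u isT.
apply: (@le_trans _ _ ((#|I|%:R * u i) `^ q)).
  apply: le_powR2r; rewrite ?(ltW q0) ?sumr_ge0//.
  by rewrite mulr_natl -sumr_const; apply: ler_sum => j _; exact: hi.
rewrite powRM// ler_wpM2l ?powR_ge0// (bigD1 i)//= lerDl sumr_ge0// => j _.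
exact: powR_ge0.
Qed.

End power_of_sum.
(** * The finite-volume error bound *)

(** [Y] stands for the rescaled bond at size [N]; it is rounded to the grid of parameter [M],
then cut at the level [K]. As [1 < q], the bound [kappa] for [N] times the mean of the part
above the cut can be made small by a large [K]. *)
Section finite_volume.
Context {R : realType} (N M : nat).
Context {d0 : measure_display} {T0 : measurableType d0} (P0 : probability T0 R) (Y : T0 -> R).
Context {d : measure_display} {Om : measurableType d} (P : probability Om R).
Context (J : 'I_N -> 'I_N -> {RV P >-> R}).
Context (beta c C q K kappa : R).
Hypothesis N_gt0 : (0 < N)%N.
Hypothesis mY : measurable_fun setT Y.
Hypothesis symY : same_law P0 P0 Y (fun w => - Y w).
Hypothesis lawJ : forall i j : 'I_N, (i < j)%N -> same_law P P0 (J i j) Y.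
Hypothesis indepJ :
  independent_rvs P (fun e : 'I_N * 'I_N => (e.1 < e.2)%N) (fun e => J e.1 e.2).
Hypothesis beta_gt0 : 0 < beta.
Hypothesis c01 : 0 <= c < 1.
Hypothesis C_ge0 : 0 <= C.
Hypothesis q12 : 1 < q <= 2.
Hypothesis K_ge1 : 1 <= K.
Hypothesis kappaE : K `^ (1 - q) * (C + 1) <= kappa.

Let far_part (x : R) : R := if 1 < `|x| then `|x| `^ q else 0.

Hypothesis tanhY : (N%:R%:E * \int[P0]_w (tanh (beta * Y w) ^+ 2)%:E <= c%:E)%E.
Hypothesis farY : (N%:R%:E * \int[P0]_w (far_part (Y w))%:E <= C%:E)%E.

Definition bond_law (v : grid M) : R := fine (P0 ((grid_code M \o Y) @^-1` [set v])).

Definition near_val (x : R) : R := if `|x| <= K then x else 0.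

Definition far_val (x : R) : R := if `|x| <= K then 0 else `|x|.

Local Notation mu := bond_law.
Local Notation val := (@grid_val R M).

Let N_gt0r : 0 < N%:R :> R. Proof. by rewrite ltr0n. Qed.

Let K_gt0 : 0 < K. Proof. exact: lt_le_trans K_ge1. Qed.

Let q_gt1 : 1 < q. Proof. by have /andP[] := q12. Qed.

Let q_gt0 : 0 < q. Proof. exact: lt_trans ltr01 q_gt1. Qed.

Let q_le2 : q <= 2. Proof. by have /andP[] := q12. Qed.

Let C1_gt0 : 0 < C + 1. Proof. by rewrite ltr_wpDl. Qed.

Let kappa_gt0 : 0 < kappa.
Proof. by apply: lt_le_trans kappaE; rewrite mulr_gt0 ?powR_gt0. Qed.

Let code_preimage v : (grid_code M \o Y) @^-1` [set v] = Y @^-1` (grid_code M @^-1` [set v]).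
Proof. by []. Qed.

Let measurable_code_preimage v : measurable ((grid_code M \o Y) @^-1` [set v]).
Proof.
by rewrite code_preimage -[X in measurable X]setTI; apply: mY => //; exact: measurable_grid_code.
Qed.

Lemma bond_law_ge0 v : 0 <= mu v.
Proof. exact: fine_ge0. Qed.

Lemma sum_bond_law (h : R -> R) : (forall x, 0 <= h x) ->
  (\int[P0]_w (h (grid_round M (Y w)))%:E = (\sum_v mu v * h (val v))%:E)%E.
Proof.
move=> h0; exact: (@integral_finite_rv _ _ _ P0 _ (grid_code M \o Y) (fun v => h (val v))).
Qed.

Lemma bond_law_sum1 : \sum_v mu v = 1.
Proof.
have h := @sum_bond_law (fun=> 1) (fun=> ler01).
have h1 := integral_cst P0 measurableT 1%E.
have PT : P0 setT = 1%E := probability_setT P0.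
move: PT h1 => /= ->; rewrite mul1e => h1.
have [->] : (1%:E = (\sum_v mu v * 1)%:E)%E := etrans (esym h1) h.
by apply: eq_bigr => v _; rewrite mulr1.
Qed.

Lemma near_val_le x : `|near_val x| <= `|x|.
Proof. by rewrite /near_val; case: ifP => // _; rewrite normr0. Qed.

Lemma near_valN x : near_val (- x) = - near_val x.
Proof. by rewrite /near_val normrN; case: ifP; rewrite ?oppr0. Qed.

Lemma far_val_ge0 x : 0 <= far_val x.
Proof. by rewrite /far_val; case: ifP. Qed.

Lemma dist_near_val x : `|x - near_val x| = far_val x.
Proof.
by rewrite /near_val /far_val; case: ifP; rewrite ?subr0// subrr normr0.
Qed.

Let measurable_near_val : measurable_fun setT near_val.
Proof.
by apply: measurable_fun_ifT => //; exact: measurable_fun_ler.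
Qed.

Let measurable_tanh : measurable_fun setT (@tanh R).
Proof.
apply: continuous_measurable_fun => x.
apply: differentiable_continuous; apply/derivable1_diffP.
exact: (@ex_derive _ _ _ _ _ _ _ (is_derive_tanh x)).
Qed.

Let measurable_lncosh : measurable_fun setT (@lncosh R).
Proof.
apply: continuous_measurable_fun => x.
apply: differentiable_continuous; apply/derivable1_diffP.
exact: (@ex_derive _ _ _ _ _ _ _ (is_derive_lncosh x)).
Qed.

Let measurable_comp_mull (h : R -> R) : measurable_fun setT h ->
  measurable_fun setT (fun w => h (beta * Y w)).
Proof. by move=> mh; apply: (measurableT_comp mh); apply: measurable_funM. Qed.

Let measurable_far_part : measurable_fun setT (fun w => far_part (Y w)).
Proof.
have mn : measurable_fun setT (fun w => `|Y w|) by exact: measurableT_comp.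
apply: measurable_fun_ifT => //; first exact: measurable_fun_ltr.
exact: (measurableT_comp (measurable_powR q)).
Qed.

Let far_part_ge0 x : 0 <= far_part x.
Proof. by rewrite /far_part; case: ifP => // _; exact: powR_ge0. Qed.

(** The bond is symmetric and the rounding, the cut and [tanh] are odd; the shift by 1 keeps
the integrands nonnegative. *)
Lemma bond_law_centred : \sum_v mu v * tanh (beta * near_val (val v)) = 0.
Proof.
pose t x := tanh (beta * near_val x).
have t1 x : - 1 <= t x <= 1.
  by have := tanh_bound (beta * near_val x); rewrite ltr_norml => /andP[/ltW -> /ltW ->].
have tp x : 0 <= 1 + t x by have := t1 x; lra.
have tm x : 0 <= 1 - t x by have := t1 x; lra.
have mt : measurable_fun setT (fun x => 1 + t (grid_round M x)).
  apply: measurable_funD => //; apply: (measurableT_comp measurable_tanh).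
  apply: measurable_funM => //; apply: (measurableT_comp measurable_near_val).
  exact: measurable_grid_round.
have mNY : measurable_fun setT (fun w => - Y w) by exact: measurableT_comp.
have := same_law_integral mY mNY symY mt (fun x => tp (grid_round M x)).
rewrite (@sum_bond_law (fun x => 1 + t x) tp).
under [X in _ = X -> _]eq_integral do rewrite grid_roundN /t near_valN mulrN tanhN -/(t _).
rewrite (@sum_bond_law (fun x => 1 - t x) tm) => -[].
under eq_bigr do rewrite mulrDr mulr1; rewrite big_split /=.
under [X in _ = X -> _]eq_bigr do rewrite mulrBr mulr1; rewrite sumrB bond_law_sum1.
rewrite /t; lra.
Qed.

Lemma bond_law_sqr_tanh : N%:R * (\sum_v mu v * tanh (beta * near_val (val v)) ^+ 2) <= c.
Proof.
rewrite -lee_fin EFinM -(@sum_bond_law (fun x => tanh (beta * near_val x) ^+ 2)); last first.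
  by move=> x; exact: sqr_ge0.
apply: le_trans tanhY; apply: lee_wpmul2l; first by rewrite lee_fin.
have msq : measurable_fun setT (fun x : R => tanh x ^+ 2).
  exact: measurable_funX.
apply: ge0_le_integral => //.
- by move=> w _; rewrite lee_fin sqr_ge0.
- apply/measurable_EFinP; apply: (measurableT_comp msq); apply: measurable_funM => //.
  apply: (measurableT_comp measurable_near_val).
  by apply: (measurableT_comp (measurable_grid_round M)).
- by apply/measurable_EFinP; exact: (measurable_comp_mull msq).
- move=> w _; rewrite lee_fin sqr_tanh_mono// !normrM ler_wpM2l//.
  exact: le_trans (near_val_le _) (grid_round_le M _).
Qed.

(** On bounded bonds the square is comparable to the square of [tanh]. *)
Lemma bond_law_sqr :
  N%:R * (\sum_v mu v * (beta * near_val (val v)) ^+ 2) <= cosh (beta * K) ^+ 2 * c.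
Proof.
apply: le_trans (ler_wpM2l (sqr_ge0 _) bond_law_sqr_tanh).
rewrite mulrCA ler_wpM2l// mulr_sumr; apply: ler_sum => v _.
rewrite [leRHS]mulrCA ler_wpM2l ?bond_law_ge0//; apply: sqr_le_tanh.
rewrite normrM gtr0_norm// ler_pM2l// /near_val; case: ifP => // _.
by rewrite normr0 (le_trans ler01).
Qed.

Let far_val_powR x y : `|x| <= `|y| -> far_val x `^ q <= far_part y.
Proof.
rewrite /far_val; case: (leP `|x| K) => [_ _|xK xy]; first by rewrite powR0 ?far_part_ge0// gt_eqF.
rewrite /far_part (lt_le_trans _ xy) ?(le_lt_trans K_ge1)//.
by rewrite le_powR2r// ltW.
Qed.

Let far_val_le x y : `|x| <= `|y| -> far_val x <= K `^ (1 - q) * far_part y.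
Proof.
rewrite /far_val; case: (leP `|x| K) => [_ _|xK xy]; first by rewrite mulr_ge0 ?powR_ge0.
rewrite /far_part (lt_le_trans _ xy) ?(le_lt_trans K_ge1)//.
have x0 : 0 < `|x| := lt_trans K_gt0 xK.
have -> : `|x| = `|x| `^ (1 - q) * `|x| `^ q.
  by rewrite -powRD ?subrK ?powRr1// gt_eqF// implybT.
rewrite ler_pM ?powR_ge0//; last by rewrite le_powR2r// ltW.
by rewrite -opprB powRN_le ?subr_ge0 ?(ltW xK)// ltW.
Qed.

(** Above [K >= 1] the modulus is at most [K ^ (1 - q)] times its [q]-th power. *)
Lemma bond_law_far : N%:R * (\sum_v mu v * far_val (val v)) <= kappa.
Proof.
apply: le_trans kappaE; rewrite -lee_fin EFinM -(sum_bond_law far_val_ge0).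
have h : (\int[P0]_w (far_val (grid_round M (Y w)))%:E <=
          (K `^ (1 - q))%:E * \int[P0]_w (far_part (Y w))%:E)%E.
  rewrite -ge0_integralZl_EFin ?powR_ge0//; last 2 first.
  - by move=> w _; rewrite lee_fin.
  - exact/measurable_EFinP.
  apply: ge0_le_integral => //.
  - by move=> w _; rewrite lee_fin far_val_ge0.
  - apply/measurable_EFinP.
    have mf : measurable_fun setT far_val.
      by apply: measurable_fun_ifT => //; exact: measurable_fun_ler.
    by apply: (measurableT_comp mf); apply: (measurableT_comp (measurable_grid_round M)).
  - by apply/measurable_EFinP; apply: measurable_funM.
  - by move=> w _; rewrite -EFinM lee_fin far_val_le// grid_round_le.
apply: (@le_trans _ _ (N%:R%:E * ((K `^ (1 - q))%:E * \int[P0]_w (far_part (Y w))%:E))%E).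
  by rewrite lee_wpmul2l ?lee_fin.
rewrite muleCA EFinM lee_wpmul2l ?lee_fin ?powR_ge0//.
by apply: le_trans farY _; rewrite lee_fin; lra.
Qed.

Lemma bond_law_far_powR : N%:R * (\sum_v mu v * far_val (val v) `^ q) <= C.
Proof.
rewrite -lee_fin EFinM -(@sum_bond_law (fun x => far_val x `^ q)); last first.
  by move=> x; exact: powR_ge0.
apply: le_trans farY; rewrite lee_wpmul2l ?lee_fin//.
apply: ge0_le_integral => //.
- by move=> w _; rewrite lee_fin powR_ge0.
- apply/measurable_EFinP; apply: (measurableT_comp (measurable_powR q)).
  have mf : measurable_fun setT far_val.
    by apply: measurable_fun_ifT => //; exact: measurable_fun_ler.
  by apply: (measurableT_comp mf); apply: (measurableT_comp (measurable_grid_round M)).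
- exact/measurable_EFinP.
- by move=> w _; rewrite lee_fin far_val_powR// grid_round_le.
Qed.

Context (Lam : R).
Hypothesis lncoshY : (N%:R%:E * \int[P0]_w (lncosh (beta * Y w))%:E = Lam%:E)%E.
(* The sum of the rounding errors runs over fewer than [N ^ 2] edges, so the power 5 makes it
negligible with room to spare. *)
Hypothesis roundY : (\int[P0]_w (`|Y w - grid_round M (Y w)|)%:E <= (N%:R ^- 5)%:E)%E.
Hypothesis roundYq : (\int[P0]_w (`|Y w - grid_round M (Y w)| `^ q)%:E <= (N%:R ^- 5)%:E)%E.

Let lncosh_mono x y : `|x| <= `|y| -> lncosh x <= lncosh y :> R.
Proof.
have abs z : lncosh z = lncosh `|z| :> R.
  by have [z0|z0] := leP 0 z; rewrite ?(ger0_norm z0)// (ltr0_norm z0) /lncosh coshN.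
by move=> xy; rewrite (abs x) (abs y) /lncosh ler_ln ?posrE ?cosh_gt0// cosh_le.
Qed.

Let measurable_near_round :
  measurable_fun setT (fun w => lncosh (beta * near_val (grid_round M (Y w)))).
Proof.
apply: (measurableT_comp measurable_lncosh); apply: measurable_funM => //.
by apply: (measurableT_comp measurable_near_val); apply: (measurableT_comp (measurable_grid_round M)).
Qed.

Let measurable_far_round : measurable_fun setT (fun w => far_val (grid_round M (Y w))).
Proof.
have mf : measurable_fun setT far_val.
  by apply: measurable_fun_ifT => //; exact: measurable_fun_ler.
by apply: (measurableT_comp mf); apply: (measurableT_comp (measurable_grid_round M)).
Qed.

Let measurable_dist_round : measurable_fun setT (fun w => `|Y w - grid_round M (Y w)|).
Proof.
apply: measurableT_comp => //; apply: measurable_funB => //.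
by apply: (measurableT_comp (measurable_grid_round M)).
Qed.

Lemma bond_law_lncosh_le : N%:R * (\sum_v mu v * lncosh (beta * near_val (val v))) <= Lam.
Proof.
rewrite -lee_fin EFinM -(@sum_bond_law (fun x => lncosh (beta * near_val x))); last first.
  by move=> x; exact: lncosh_ge0.
rewrite -lncoshY; apply: lee_wpmul2l; first by rewrite lee_fin.
apply: ge0_le_integral => //.
- by move=> w _; rewrite lee_fin lncosh_ge0.
- exact/measurable_EFinP.
- by apply/measurable_EFinP; exact: measurable_comp_mull.
- move=> w _; rewrite lee_fin lncosh_mono// !normrM ler_wpM2l//.
  exact: le_trans (near_val_le _) (grid_round_le M _).
Qed.

(** [lncosh] is Lipschitz, so rounding and cutting lose at most the mean rounding error and
the mean far part. *)
Lemma bond_law_lncosh_ge :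
  Lam <= N%:R * (\sum_v mu v * lncosh (beta * near_val (val v))) + beta / N%:R + beta * kappa.
Proof.
pose near := \sum_v mu v * lncosh (beta * near_val (val v)).
pose far := \sum_v mu v * far_val (val v).
have le_int : (\int[P0]_w (lncosh (beta * Y w))%:E <=
    near%:E + (beta%:E * (N%:R ^- 5)%:E + beta%:E * far%:E))%E.
  apply: (@le_trans _ _ (\int[P0]_w ((lncosh (beta * near_val (grid_round M (Y w))))%:E +
     (beta%:E * (`|Y w - grid_round M (Y w)|)%:E +
      beta%:E * (far_val (grid_round M (Y w)))%:E)))%E).
    apply: ge0_le_integral => //.
    - by move=> w _; rewrite lee_fin lncosh_ge0.
    - by apply/measurable_EFinP; exact: measurable_comp_mull.
    - apply/measurable_EFinP; apply: measurable_funD => //.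
      by apply: measurable_funD; apply: measurable_funM.
    - move=> w _; rewrite -!EFinM -!EFinD lee_fin -lerBlDl -mulrDr.
      apply: le_trans (ler_norm _) _; apply: le_trans (lncosh_lipschitz _ _) _.
      rewrite -mulrBr normrM gtr0_norm// ler_pM2l// -dist_near_val.
      exact: ler_distD.
  rewrite ge0_integralD//=; last 4 first.
  - by move=> w _; rewrite lee_fin lncosh_ge0.
  - exact/measurable_EFinP.
  - by move=> w _; rewrite -!EFinM -EFinD lee_fin addr_ge0 ?mulr_ge0 ?(ltW beta_gt0) ?far_val_ge0.
  - by apply/measurable_EFinP; apply: measurable_funD; apply: measurable_funM.
  rewrite (@sum_bond_law (fun x => lncosh (beta * near_val x))) -/near; last first.
    by move=> x; exact: lncosh_ge0.
  rewrite leeD2l// ge0_integralD//=; last 4 first.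
  - by move=> w _; rewrite -EFinM lee_fin mulr_ge0 ?(ltW beta_gt0).
  - by apply/measurable_EFinP; apply: measurable_funM.
  - by move=> w _; rewrite -EFinM lee_fin mulr_ge0 ?(ltW beta_gt0) ?far_val_ge0.
  - by apply/measurable_EFinP; apply: measurable_funM.
  rewrite !ge0_integralZl_EFin ?(ltW beta_gt0)//; last 3 first.
  - by move=> w _; rewrite lee_fin far_val_ge0.
  - exact/measurable_EFinP.
  - exact/measurable_EFinP.
  rewrite (sum_bond_law far_val_ge0) -/far leeD2r// lee_wpmul2l// lee_fin ltW//.
rewrite -lee_fin -lncoshY.
apply: (@le_trans _ _ (N%:R%:E * (near%:E + (beta%:E * (N%:R ^- 5)%:E + beta%:E * far%:E)))%E).
  by apply: lee_wpmul2l; rewrite // lee_fin.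
rewrite -[leLHS]/((N%:R * (near + (beta * N%:R ^- 5 + beta * far)))%:E) lee_fin -/near !mulrDr addrA lerD//.
  rewrite lerD2l mulrCA ler_pM2l// exprS invfM mulrA divff ?gt_eqF// mul1r.
  by rewrite lef_pV2 ?posrE ?exprn_gt0// ler_eXnr// ler1n.
by rewrite mulrCA ler_pM2l// bond_law_far.
Qed.

(** The far part comes with a bound on its [q]-th moment but none on its variance. Its sum has mean at most
[N * kappa], which is the level at which [average_powR_sum] is used. *)
Lemma average_far :
  average mu (fun f : {ffun edge N -> grid M} =>
    (beta / N%:R * \sum_e far_val (val (f e))) `^ q) <=
  beta `^ q * (N%:R `^ (1 - q) * C + 2 * kappa `^ q).
Proof.
have n2 := @card_edge_ler R N.
have scale_le (S B : R) : 0 <= S -> N%:R * S <= B -> #|{: edge N}|%:R * S <= N%:R * B.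
  move=> S0 SB; apply: le_trans (ler_wpM2r S0 n2) _.
  by rewrite expr2 -mulrA ler_wpM2l.
have far_sum_ge0 : 0 <= \sum_v mu v * far_val (val v).
  by apply: sumr_ge0 => v _; rewrite mulr_ge0 ?bond_law_ge0 ?far_val_ge0.
have h1 := scale_le _ _ far_sum_ge0 bond_law_far.
have hq : #|{: edge N}|%:R * (\sum_v mu v * far_val (val v) `^ q) <= N%:R * C.
  apply: scale_le bond_law_far_powR.
  by apply: sumr_ge0 => v _; rewrite mulr_ge0 ?bond_law_ge0 ?powR_ge0.
have a0 : 0 < N%:R * kappa by rewrite mulr_gt0.
have q12' : 1 <= q <= 2 by rewrite (ltW q_gt1).
have := @average_powR_sum R _ (edge N) mu bond_law_ge0 bond_law_sum1
  (far_val \o val) q (N%:R * kappa) (fun v => far_val_ge0 _) q12' a0 h1.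
move=> h.
have -> : average mu (fun f : {ffun edge N -> grid M} =>
      (beta / N%:R * \sum_e far_val (val (f e))) `^ q) =
    (beta / N%:R) `^ q * average mu (fun f : {ffun edge N -> grid M} =>
      (\sum_e (far_val \o val) (f e)) `^ q).
  rewrite -averageZ; apply: eq_bigr => f _; congr (_ * _).
  rewrite powRM ?(divr_ge0 (ltW beta_gt0))//.
  by apply: sumr_ge0 => e _; exact: far_val_ge0.
rewrite powRM ?invr_ge0 ?(ltW beta_gt0)// -mulrA ler_wpM2l ?powR_ge0//.
apply: le_trans (ler_wpM2l (powR_ge0 _ _) h) _.
apply: (@le_trans _ _ (N%:R^-1 `^ q * (N%:R * C + 2 * (N%:R * kappa) `^ q))).
  rewrite ler_wpM2l ?powR_ge0// lerD// -mulrA ler_wpM2l//.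
  by rewrite -[leRHS]mulr_powRB1 ?(ltW a0)// ler_wpM2r ?powR_ge0.
rewrite powRM ?(ltW kappa_gt0)// mulrDr mulrA mulrCA (mulrA _ (N%:R `^ q)).
rewrite -powRM ?invr_ge0// mulVf ?gt_eqF// powR1 mul1r lerD2r ler_wpM2r//.
rewrite -[X in _ * X <= _](@powRr1 _ N%:R)// -powR_inv1// -powRrM -powRD; last first.
  by rewrite (gt_eqF N_gt0r) implybT.
by rewrite mulN1r addrC.
Qed.

Let edge_code_mu (e : edge N) v :
  P ((edge_value J ^~ e) @^-1` (grid_code M @^-1` [set v])) = (mu v)%:E.
Proof.
have := lawJ (valP e) (measurable_grid_code v); rewrite /edge_value => ->.
by rewrite /bond_law fineK// fin_num_measure.
Qed.

Let measurable_edge (e : edge N) : measurable_fun setT (edge_value J ^~ e).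
Proof. exact: measurable_edge_value. Qed.

Lemma round_error_le : (\int[P]_w ((beta / N%:R *
    \sum_e `|edge_value J w e - grid_round M (edge_value J w e)|) `^ q)%:E <=
  (beta `^ q / N%:R)%:E)%E.
Proof.
pose psi (x : R) := `|x - grid_round M x| `^ q.
have mpsi : measurable_fun setT psi.
  apply: (measurableT_comp (measurable_powR q)); apply: measurableT_comp => //.
  by apply: measurable_funB => //; exact: measurable_grid_round.
have psi0 x : 0 <= psi x by exact: powR_ge0.
have mpsie e : measurable_fun setT (fun w => psi (edge_value J w e)).
  exact: (measurableT_comp mpsi (measurable_edge e)).
pose n := #|{: edge N}|%:R : R.
have b0 : 0 <= beta / N%:R by rewrite divr_ge0 ?(ltW beta_gt0).
have msum : measurable_fun setT (fun w => \sum_e psi (edge_value J w e)).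
  by apply: measurable_sum => e.
have sum_ge0 w : 0 <= \sum_e psi (edge_value J w e) by apply: sumr_ge0.
apply: (@le_trans _ _ (\int[P]_w (((beta / N%:R * n) `^ q)%:E *
    (\sum_e psi (edge_value J w e))%:E))%E).
  apply: ge0_le_integral => //.
  - by move=> w _; rewrite lee_fin powR_ge0.
  - apply/measurable_EFinP; apply: (measurableT_comp (measurable_powR q)).
    apply: measurable_funM => //; apply: measurable_sum => e.
    apply: measurableT_comp => //; apply: measurable_funB => //.
    exact: (measurableT_comp (measurable_grid_round M) (measurable_edge e)).
  - by apply/measurable_EFinP; apply: measurable_funM.
  - move=> w _; rewrite -EFinM lee_fin [leLHS]powRM ?sumr_ge0//.
    rewrite [X in _ <= X * _]powRM// -mulrA.
    by rewrite ler_wpM2l ?powR_ge0// powR_sum_le.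
rewrite ge0_integralZl_EFin ?powR_ge0//; last 2 first.
- by move=> w _; rewrite lee_fin.
- exact/measurable_EFinP.
have -> : (\int[P]_w (\sum_e psi (edge_value J w e))%:E =
    \sum_e \int[P]_w (psi (edge_value J w e))%:E)%E.
  rewrite -ge0_integral_sum//; last 2 first.
  - by move=> e; exact/measurable_EFinP.
  - by move=> e w _; rewrite lee_fin.
  by apply: eq_integral => w _; rewrite sumEFin.
have le_sum : (\sum_(e : edge N) \int[P]_w (psi (edge_value J w e))%:E <=
    (n * N%:R ^- 5)%:E)%E.
  apply: (@le_trans _ _ (\sum_(e : edge N) (N%:R ^- 5)%:E)%E); last first.
    by rewrite sumEFin sumr_const /n mulr_natl.
  apply: lee_sum => e _; apply: le_trans roundYq.
  have := same_law_integral (measurable_edge e) mY (lawJ (valP e)) mpsi psi0.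
  by move=> ->.
apply: (@le_trans _ _ (((beta / N%:R * n) `^ q)%:E * (n * N%:R ^- 5)%:E)%E).
  by apply: lee_wpmul2l le_sum; rewrite lee_fin powR_ge0.
rewrite -EFinM lee_fin.
have n2 : n <= N%:R ^+ 2 := @card_edge_ler R N.
have N1 : 1 <= N%:R :> R by rewrite ler1n.
have h : (beta / N%:R * n) `^ q <= beta `^ q * N%:R ^+ 2.
  apply: (@le_trans _ _ ((beta * N%:R) `^ q)).
    apply: le_powR2r; rewrite ?(ltW q_gt0) ?(mulr_ge0 b0)//.
    by rewrite -mulrA ler_pM2l// mulrC ler_pdivrMr// -expr2.
  rewrite powRM ?(ltW beta_gt0)// ler_wpM2l ?powR_ge0//.
  by rewrite -powR_mulrn// ler_powR.
apply: (@le_trans _ _ (beta `^ q * N%:R ^+ 2 * (N%:R ^+ 2 * N%:R ^- 5))).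
  apply: ler_pM => //; rewrite ?powR_ge0 ?mulr_ge0 ?invr_ge0 ?exprn_ge0//.
  by rewrite ler_wpM2r// invr_ge0 exprn_ge0.
by rewrite le_eqVlt; apply/orP; left; apply/eqP; field; rewrite gt_eqF.
Qed.

Let measurable_ln_gibbs : measurable_fun setT
  (fun w => ln (gibbs_sum (@edge_sign N) (fun e : edge N => beta * edge_value J w e))).
Proof.
apply: (measurableT_comp (@measurable_ln R)); apply: measurable_sum => s.
apply: (measurableT_comp (@measurable_expR R)); apply: measurable_sum => e.
by apply: measurable_funM => //; apply: measurable_funM.
Qed.

Let measurable_code_fun (G : {ffun edge N -> grid M} -> R) :
  measurable_fun setT (fun w => G (edge_code M J w)).
Proof.
move=> _ B mB; rewrite setTI.
have -> : (fun w => G (edge_code M J w)) @^-1` B =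
    \bigcup_(f in [set f | B (G f)]) (edge_code M J @^-1` [set f]).
  apply/seteqP; split => w /=; first by move=> Bw; exists (edge_code M J w).
  by case=> f /= Bf ->.
apply: fin_bigcup_measurable => [|f _]; first exact: finite_finset.
exact: measurable_edge_code.
Qed.

Let near_energy (f : {ffun edge N -> grid M}) : R :=
  N%:R^-1 * ln (gibbs_sum (@edge_sign N) ((fun v => beta * near_val (val v)) \o f)) -
  (ln 2 + N%:R^-1 * #|{: edge N}|%:R * (\sum_v mu v * lncosh (beta * near_val (val v)))).

Let far_energy (f : {ffun edge N -> grid M}) : R :=
  beta / N%:R * \sum_e far_val (val (f e)).

Let round_energy (w : Om) : R :=
  beta / N%:R * \sum_e `|edge_value J w e - grid_round M (edge_value J w e)|.

Let mean_error (l : R) : R :=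
  `|ln 2 + (1 - N%:R^-1) / 2 * Lam - l| + beta / N%:R + beta * kappa.

Let far_energy_ge0 f : 0 <= far_energy f.
Proof.
by rewrite mulr_ge0 ?divr_ge0 ?(ltW beta_gt0)// sumr_ge0// => e _; exact: far_val_ge0.
Qed.

Let round_energy_ge0 w : 0 <= round_energy w.
Proof. by rewrite mulr_ge0 ?divr_ge0 ?(ltW beta_gt0)// sumr_ge0. Qed.

Let mean_error_ge0 l : 0 <= mean_error l.
Proof. by rewrite !addr_ge0// ?mulr_ge0 ?divr_ge0 ?(ltW beta_gt0) ?(ltW kappa_gt0). Qed.

(** With [(N ^ 2 - N) / 2] edges and mean [Lam / N] per bond, the deterministic term is
[(1 - 1 / N) / 2 * Lam]. *)
Lemma mean_error_le l :
  `|ln 2 + N%:R^-1 * #|{: edge N}|%:R * (\sum_v mu v * lncosh (beta * near_val (val v))) - l|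
  <= mean_error l.
Proof.
set near := \sum_v _.
have h1 : N%:R * near <= Lam := bond_law_lncosh_le.
have h2 : Lam <= N%:R * near + beta / N%:R + beta * kappa := bond_law_lncosh_ge.
have r01 : 0 <= (1 - N%:R^-1 : R) / 2 <= 1.
  have : 0 <= N%:R^-1 :> R by rewrite invr_ge0.
  have : N%:R^-1 <= 1 :> R by rewrite invf_le1// ler1n.
  lra.
have -> : N%:R^-1 * #|{: edge N}|%:R * near = (1 - N%:R^-1) / 2 * (N%:R * near).
  by rewrite card_edgeE; field; rewrite gt_eqF.
rewrite /mean_error; move: r01 h1 h2; move: (N%:R * near) ((1 - N%:R^-1) / 2 : R) => x r /andP[r0 r1] h1 h2.
rewrite (_ : _ - l = (ln 2 + r * Lam - l) - r * (Lam - x)); last by ring.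
apply: le_trans (ler_normB _ _) _; rewrite -[leRHS]addrA lerD2l normrM !ger0_norm ?subr_ge0//.
apply: le_trans (ler_piMl _ r1) _; rewrite ?subr_ge0//.
lra.
Qed.

(** Replacing each bond by the near part of its rounding moves [ln Z] by at most [beta] times
the far parts and the rounding errors. *)
Lemma free_energy_dist_le l w :
  `|N%:R^-1 * ln (partition_function beta (fun i j => J i j w)) - l| <=
  `|near_energy (edge_code M J w)| + far_energy (edge_code M J w) + round_energy w + mean_error l.
Proof.
rewrite partition_functionE.
set A := ln _; pose f := edge_code M J w.
set B := ln (gibbs_sum (@edge_sign N) ((fun v => beta * near_val (val v)) \o f)).
have AB : N%:R^-1 * `|A - B| <= far_energy f + round_energy w.
  rewrite /far_energy /round_energy -mulrDr -big_split /= [leRHS]mulrAC [leLHS]mulrC ler_wpM2r ?invr_ge0//.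
  apply: le_trans (ln_gibbs_sum_lipschitz (@edge_sign N) (card_config_gt0 N)
    (fun e : edge N => beta * edge_value J w e)
    ((fun v => beta * near_val (val v)) \o f)) _.
  rewrite mulr_sumr; apply: ler_sum => e _ /=.
  rewrite -mulrBr normrM gtr0_norm// ler_pM2l// addrC -dist_near_val ffunE.
  exact: ler_distD.
have -> : N%:R^-1 * A - l = near_energy f + N%:R^-1 * (A - B) +
   (ln 2 + N%:R^-1 * #|{: edge N}|%:R * (\sum_v mu v * lncosh (beta * near_val (val v))) - l).
  by rewrite /near_energy -/B; ring.
apply: le_trans (ler_normD _ _) _; apply: lerD (mean_error_le l).
apply: le_trans (ler_normD _ _) _; rewrite -addrA lerD2l.
by rewrite normrM ger0_norm ?invr_ge0.
Qed.

(** The near part is controlled in [L^2] and the two other random terms in [L^q]; the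
threshold [eps] lowers these exponents to [p]. *)
Lemma finite_volume_bound (l p eps : R) : 0 < p <= q -> 0 < eps ->
  (\int[P]_w (`|N%:R^-1 * ln (partition_function beta (fun i j => J i j w)) - l| `^ p)%:E <=
   (4 `^ p *
     ((eps `^ p + eps `^ (p - 2) *
        ((10 * (cosh (beta * K) ^+ 2 * c) + 64 * overlap_const c * (cosh (beta * K) ^+ 2 * c) + 4)
          / N%:R)) +
      (eps `^ p + eps `^ (p - q) * (beta `^ q * (N%:R `^ (1 - q) * C + 2 * kappa `^ q))) +
      (eps `^ p + eps `^ (p - q) * (beta `^ q / N%:R)) +
      mean_error l `^ p))%:E)%E.
Proof.
move=> ppq eps0; have /andP[p0 pq] := ppq.
have pp2 : 0 < p <= 2 by rewrite p0 (le_trans pq).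
pose G (f : {ffun edge N -> grid M}) : R :=
  (eps `^ p + eps `^ (p - 2) * near_energy f ^+ 2) +
  (eps `^ p + eps `^ (p - q) * far_energy f `^ q) + (eps `^ p + mean_error l `^ p).
have G0 f : 0 <= G f by rewrite /G !addr_ge0 ?powR_ge0//; apply: mulr_ge0; rewrite ?powR_ge0 ?sqr_ge0.
have mround : measurable_fun setT (fun w => round_energy w `^ q).
  apply: (measurableT_comp (measurable_powR q)); apply: measurable_funM => //.
  apply: measurable_sum => e; apply: measurableT_comp => //; apply: measurable_funB => //.
  exact: (measurableT_comp (measurable_grid_round M) (measurable_edge e)).
have e4 : 0 <= 4 `^ p :> R by exact: powR_ge0.
have eq0 : 0 <= eps `^ (p - q) by exact: powR_ge0.
apply: (@le_trans _ _ (\int[P]_w ((4 `^ p)%:E * ((G (edge_code M J w))%:E +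
    (eps `^ (p - q))%:E * (round_energy w `^ q)%:E)))%E).
  apply: ge0_le_integral => //.
  - apply/measurable_EFinP; apply: (measurableT_comp (measurable_powR p)).
    apply: measurableT_comp => //; apply: measurable_funB => //.
    apply: measurable_funM => //.
    under eq_fun do rewrite partition_functionE.
    exact: measurable_ln_gibbs.
  - apply/measurable_EFinP; apply: measurable_funM => //.
    by apply: measurable_funD => //; apply: measurable_funM.
  - move=> w _; rewrite -[leRHS]/((4 `^ p * (G (edge_code M J w) +
        eps `^ (p - q) * round_energy w `^ q))%:E) lee_fin.
    apply: le_trans (le_powR2r (ltW p0) (normr_ge0 _) (free_energy_dist_le l w)) _.
    apply: le_trans (powR_sum4_le (ltW p0) (normr_ge0 _) (far_energy_ge0 _)
      (round_energy_ge0 _) (mean_error_ge0 _)) _.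
    rewrite ler_wpM2l//.
    have h1 := powR_le_threshold pp2 eps0 (normr_ge0 (near_energy (edge_code M J w))).
    have h2 := powR_le_threshold ppq eps0 (far_energy_ge0 (edge_code M J w)).
    have h3 := powR_le_threshold ppq eps0 (round_energy_ge0 w).
    rewrite powR_mulrn// real_normK ?num_real// in h1.
    rewrite /G; lra.
rewrite ge0_integralZl_EFin//; last 2 first.
- move=> w _; rewrite adde_ge0// ?lee_fin//.
  by rewrite mulr_ge0// powR_ge0.
- apply/measurable_EFinP.
  by apply: measurable_funD => //; apply: measurable_funM.
rewrite ge0_integralD//; last 4 first.
- by move=> w _; rewrite lee_fin.
- exact/measurable_EFinP.
- by move=> w _; rewrite -EFinM lee_fin mulr_ge0// powR_ge0.
- by apply/measurable_EFinP; apply: measurable_funM.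
rewrite ge0_integralZl_EFin//; last 2 first.
- by move=> w _; rewrite lee_fin powR_ge0.
- exact/measurable_EFinP.
have hG := integral_edge_code indepJ edge_code_mu G0.
rewrite hG [leRHS]EFinM lee_wpmul2l ?lee_fin//.
have hR := @lee_wpmul2l _ (eps `^ (p - q))%:E eq0 _ _ round_error_le.
apply: (@le_trans _ _ ((average mu G)%:E + ((eps `^ (p - q))%:E * (beta `^ q / N%:R)%:E))%E).
  exact: leeD2l.
rewrite -EFinM -EFinD lee_fin.
have near_le : average mu (fun f => near_energy f ^+ 2) <=
    (10 * (cosh (beta * K) ^+ 2 * c) + 64 * overlap_const c * (cosh (beta * K) ^+ 2 * c) + 4)
          / N%:R.
  exact: (near_free_energy N_gt0 bond_law_ge0 bond_law_sum1 bond_law_centred c01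
    bond_law_sqr_tanh bond_law_sqr).
have far_le := average_far.
have -> : average mu G = (eps `^ p + eps `^ (p - 2) * average mu (fun f => near_energy f ^+ 2)) +
    (eps `^ p + eps `^ (p - q) * average mu (fun f => far_energy f `^ q)) +
    (eps `^ p + mean_error l `^ p).
  by rewrite /G !(averageD, averageZ) !average_cst ?bond_law_sum1.
have := ler_wpM2l (powR_ge0 eps (p - 2)) near_le.
have := ler_wpM2l eq0 far_le.
rewrite -/(far_energy _); lra.
Qed.

End finite_volume.
(** * The limit of the free energy *)

Section small_quantities.
Context {R : realType}.

Lemma powR_small (r A d : R) : 0 < r -> 0 < A -> 0 < d ->
  exists2 x0 : R, 0 < x0 & forall x, 0 <= x -> x <= x0 -> A * x `^ r <= d.
Proof.
move=> r0 A0 d0; exists ((d / A) `^ r^-1); first by rewrite powR_gt0// divr_gt0.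
move=> x xge xle; rewrite mulrC -ler_pdivlMr//.
apply: le_trans (le_powR2r (ltW r0) xge xle) _.
by rewrite -powRrM mulVf ?gt_eqF// powRr1// ltW// divr_gt0.
Qed.

Lemma cvge0_le (u : nat -> \bar R) : (forall N, (0 <= u N)%E) ->
  (forall e : R, 0 < e -> \forall N \near \oo, (u N <= e%:E)%E) ->
  u N @[N --> \oo] --> 0%E.
Proof.
move=> u0 ue.
have fin (e : R) N : (u N <= e%:E)%E -> u N \is a fin_num.
  by move=> h; rewrite ge0_fin_numE//; exact: le_lt_trans h (ltry _).
apply/fine_cvgP; split; first by near do apply: (fin 1); exact: ue.
apply/cvgrPdist_le => e e0; near=> N.
have h : (u N <= e%:E)%E by near: N; exact: ue.
rewrite sub0r normrN ger0_norm; last by rewrite fine_ge0.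
by rewrite -lee_fin fineK// (fin e).
Unshelve. all: by end_near. Qed.

Lemma near_lte (u : nat -> \bar R) (l y : \bar R) :
  u N @[N --> \oo] --> l -> (l < y)%E -> \forall N \near \oo, (u N < y)%E.
Proof. by move=> ul ly; exact: ul (open_ereal_lt' ly). Qed.

End small_quantities.

Section limit.
Context {R : realType} (alpha : R) (L : R -> R).
Context {d0 : measure_display} {T0 : measurableType d0} (P0 : probability T0 R).
Context (X : {RV P0 >-> R}).
Hypothesis alpha12 : 1 < alpha < 2.
Hypothesis L_gt0 : forall x : R, 0 < x -> 0 < L x.
Hypothesis L_sv : slowly_varying L.
Hypothesis X_tail : forall x : R, 0 < x ->
  P0 [set w | x < `|X w|] = (L x / x `^ alpha)%:E.
Hypothesis X_sym : symmetric_rv P0 X.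
Local Notation jump N w := ((scale P0 X N)^-1 * X w).

Let measurable_jumpN N : measurable_fun setT (fun w => jump N w).
Proof. exact: measurable_jump. Qed.

Lemma jump_symmetric N : same_law P0 P0 (fun w => jump N w) (fun w => - jump N w).
Proof.
move=> A mA; pose B := (fun x => (scale P0 X N)^-1 * x) @^-1` A.
have mB : measurable B.
  have mf : measurable_fun setT (fun x : R => (scale P0 X N)^-1 * x).
    exact: measurable_funM.
  by rewrite -[B]setTI; exact: mf.
have := X_sym mB; rewrite /B.
by rewrite /preimage /=; under [X in _ = P0 X -> _]eq_set do rewrite mulrN.
Qed.

Lemma jump_moment_lty (q : R) : 1 <= q -> q < alpha ->
  \forall N \near \oo, (\int[P0]_w (`|jump N w| `^ q)%:E < +oo)%E.
Proof.
move=> q1 qa; have q0 : 0 <= q := le_trans ler01 q1.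
have [C C0 hC] := jump_far_moment alpha12 L_gt0 L_sv X_tail q1 qa.
near=> N; have N0 : (0 < N)%N by near: N; exact: nbhs_infty_gt.
have hN : (N%:R%:E * \int[P0]_w (if 1 < `|jump N w| then `|jump N w| `^ q else 0)%:E <= C%:E)%E.
  by near: N.
have mn : measurable_fun setT (fun w => `|jump N w|) by exact: measurableT_comp.
have mp : measurable_fun setT (fun w => `|jump N w| `^ q).
  exact: (measurableT_comp (measurable_powR q)).
have mfar : measurable_fun setT (fun w => if 1 < `|jump N w| then `|jump N w| `^ q else 0).
  by apply: measurable_fun_ifT => //; exact: measurable_fun_ltr.
have far0 w : 0 <= (if 1 < `|jump N w| then `|jump N w| `^ q else 0).
  by case: ifP => // _; exact: powR_ge0.
apply: (@le_lt_trans _ _ (\int[P0]_w (1%:E +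
    (if 1 < `|jump N w| then `|jump N w| `^ q else 0)%:E))%E).
  apply: ge0_le_integral => //.
  - exact/measurable_EFinP.
  - by apply/measurable_EFinP; exact: measurable_funD.
  - move=> w _; rewrite -EFinD lee_fin; case: ltP => h; first by rewrite lerDr.
    by have := le_powR2r q0 (normr_ge0 _) h; rewrite powR1 addr0.
rewrite ge0_integralD//; last 2 first.
- by move=> w _; rewrite lee_fin.
- exact/measurable_EFinP.
have PT : P0 setT = 1%E := probability_setT P0.
have h1 := integral_cst P0 measurableT 1%E.
move: PT h1 => /= -> ->; rewrite mul1e; apply: lte_add_pinfty; first exact: ltry.
have Nr : 0 < N%:R :> R by rewrite ltr0n.
apply: (@le_lt_trans _ _ (N%:R^-1 * C)%:E); last exact: ltry.
rewrite EFinM -(@lee_pmul2l _ N%:R%:E)// ?lte_fin//.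
by rewrite -!EFinM mulVKf ?gt_eqF.
Unshelve. all: by end_near. Qed.

(** One grid serves both exponents. *)
Lemma round_small (q : R) N (del : R) : 1 <= q -> 0 < del ->
  (\int[P0]_w (`|jump N w| `^ q)%:E < +oo)%E ->
  (\int[P0]_w (`|jump N w| `^ 1)%:E < +oo)%E ->
  exists M,
   (\int[P0]_w (`|jump N w - grid_round M (jump N w)|)%:E <= del%:E)%E /\
   (\int[P0]_w (`|jump N w - grid_round M (jump N w)| `^ q)%:E <= del%:E)%E.
Proof.
move=> q1 del0 fq f1.
have cq := grid_round_moment_cvg (measurable_jumpN N) (lt_le_trans ltr01 q1) fq.
have c1 := grid_round_moment_cvg (measurable_jumpN N) ltr01 f1.
have hq : \forall M \near \oo, (\int[P0]_w (`|jump N w - grid_round M (jump N w)| `^ q)%:E < del%:E)%E.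
  by apply: (near_lte cq); rewrite lte_fin.
have h1 : \forall M \near \oo, (\int[P0]_w (`|jump N w - grid_round M (jump N w)| `^ 1)%:E < del%:E)%E.
  by apply: (near_lte c1); rewrite lte_fin.
have [M _ /(_ M (leqnn M)) [hM1 hM2]] := filterI h1 hq.
exists M; split; last exact: ltW.
by under eq_integral => w _ do rewrite -[X in X%:E]powRr1//; exact: ltW.
Qed.

End limit.
Theorem theorem2p1 (R : realType) (alpha beta p : R) (L : R -> R)
    (d0 : measure_display) (T0 : measurableType d0) (P0 : probability T0 R)
    (X : {RV P0 >-> R})
    (d : nat -> measure_display) (T : forall N : nat, measurableType (d N))
    (P : forall N : nat, probability (T N) R)
    (J : forall N : nat, 'I_N -> 'I_N -> {RV (P N) >-> R})
    (halpha : 1 < alpha < 2)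
    (hL0 : forall x : R, 0 < x -> 0 < L x)
    (hL : slowly_varying L)
    (hXsym : symmetric_rv P0 X)
    (hXtail : forall x : R, 0 < x ->
       P0 [set w | x < `|X w|] = (L x / x `^ alpha)%:E)
    (hJlaw : forall (N : nat) (i j : 'I_N), (i < j)%N ->
       same_law (P N) P0 (J N i j) (fun w => (scale P0 X N)^-1 * X w))
    (hJind : forall N : nat,
       independent_rvs (P N) (fun e : 'I_N * 'I_N => (e.1 < e.2)%N)
         (fun e => J N e.1 e.2))
    (hbeta : 0 < beta < beta_crit alpha)
    (hp : 0 < p < alpha) :
  ('E_(P N)[(fun w =>
     `| N%:R^-1 * ln (partition_function beta (fun i j => J N i j w))
        - limit_free_energy alpha beta | `^ p)%R])%E @[N --> \oo] --> 0%E.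
Proof.
have /andP[a1 a2] := halpha; have /andP[b0 bc] := hbeta; have /andP[p0 pa] := hp.
(* An exponent for the far part: above [p] and 1, below [alpha]. *)
pose q : R := (Num.max 1 p + alpha) / 2.
have [q1 pq qa] : [/\ 1 < q, p <= q & q < alpha].
  have : Num.max 1 p < alpha by rewrite gt_max a1.
  have : p <= Num.max 1 p by rewrite le_max lexx orbT.
  have : 1 <= Num.max 1 p by rewrite le_max lexx.
  by rewrite /q; split; lra.
have q0 : 0 < q by lra.
have q12 : 1 < q <= 2 by rewrite q1; lra.
have [c c01 hc] := tanh_moment_lt1 halpha hL0 hL hXtail hbeta.
have [C C0 hC] := jump_far_moment halpha hL0 hL hXtail (ltW q1) qa.
have fq := jump_moment_lty halpha hL0 hL hXtail (ltW q1) qa.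
have f1 := jump_moment_lty halpha hL0 hL hXtail (lexx 1) a1.
have lam := lncosh_moment_cvg halpha hL0 hL hXtail b0.
set Lim : R := alpha * _ in lam.
have lE : limit_free_energy alpha beta = ln 2 + Lim / 2.
  by rewrite /limit_free_energy /Lim mulrAC.
(* The parameters are chosen in this order: [eps] for the thresholds, [kappa] for the far
part, [K] for the cut, then [N] and, for that [N], the grid. *)
apply: cvge0_le => [N|del del0].
  by rewrite unlock; apply: integral_ge0 => w _; rewrite lee_fin powR_ge0.
pose A : R := 4 `^ p; have A0 : 0 < A by rewrite powR_gt0.
have del4 : 0 < del / 4 by lra.
have [eps eps0 heps] := @powR_small R p (A * 3) (del / 4) p0 ltac:(lra) del4.
have eb0 : 0 < A * (eps `^ (p - q) * (beta `^ q * 2)) by rewrite !mulr_gt0 ?powR_gt0.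
have ab0 : 0 < A * beta `^ p by rewrite mulr_gt0 ?powR_gt0.
have [k1 k10 hk1] := powR_small q0 eb0 del4.
have [k2 k20 hk2] := powR_small p0 ab0 del4.
pose kappa : R := Num.min k1 k2.
have kappa0 : 0 < kappa by rewrite lt_min k10.
have {}heps := heps eps (ltW eps0) (lexx _).
have {}hk1 : _ <= _ := hk1 kappa (ltW kappa0) ltac:(by rewrite ge_min lexx).
have {}hk2 : _ <= _ := hk2 kappa (ltW kappa0) ltac:(by rewrite ge_min lexx orbT).
have C1 : 0 < C + 1 by lra.
have [K K1 hK] : exists2 K : R, 1 <= K & K `^ (1 - q) * (C + 1) <= kappa.
  have q10 : 0 < q - 1 by lra.
  have kC : 0 < kappa / (C + 1) by rewrite divr_gt0.
  have h : \forall t \near +oo, t `^ (- (q - 1)) < kappa / (C + 1).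
    exact: cvgr_lt (cvg_powRN q10) _ kC.
  have [K [hK1 hK2]] := filter_ex (filterI (nbhs_pinfty_ge (num_real (1 : R))) h).
  by exists K => //; rewrite -ler_pdivlMr// -opprB ltW.
have [finLam cvgLam] := (fine_cvgP _ _).1 lam.
pose D := cosh (beta * K) ^+ 2 * c.
pose mean (N : nat) : R :=
  fine (N%:R%:E * \int[P0]_w (lncosh (beta * ((scale P0 X N)^-1 * X w)))%:E)%E.
pose u (N : nat) : R := A *
  ((eps `^ p + eps `^ (p - 2) * ((10 * D + 64 * overlap_const c * D + 4) / N%:R)) +
   (eps `^ p + eps `^ (p - q) * (beta `^ q * (N%:R `^ (1 - q) * C + 2 * kappa `^ q))) +
   (eps `^ p + eps `^ (p - q) * (beta `^ q / N%:R)) +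
   (`|ln 2 + (1 - N%:R^-1) / 2 * mean N - limit_free_energy alpha beta| + beta / N%:R
     + beta * kappa) `^ p).
have inv_cvg : (N%:R^-1 : R) @[N --> \oo] --> (0 : R).
  have h : (N%:R `^ (-1) : R) @[N --> \oo] --> (0 : R).
    by apply: (cvg_comp _ _ _ (cvg_powRN ltr01)); exact: cvgr_idn.
  apply: cvg_trans h; apply: near_eq_cvg; near=> N.
  by rewrite powR_inv1.
have pow_cvg : (N%:R `^ (1 - q) : R) @[N --> \oo] --> (0 : R).
  rewrite -opprB; apply: (cvg_comp _ _ _ (cvg_powRN _)); last by rewrite subr_gt0.
  exact: cvgr_idn.
have err_cvg : (`|ln 2 + (1 - N%:R^-1) / 2 * mean N - limit_free_energy alpha beta|
    + beta / N%:R + beta * kappa : R) @[N --> \oo] -->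
    `|ln 2 + (1 - 0) / 2 * Lim - limit_free_energy alpha beta| + beta * 0 + beta * kappa.
  apply: cvgD; last exact: cvg_cst.
  apply: cvgD; last by apply: cvgMl_tmp.
  apply: cvg_norm; apply: cvgB; last exact: cvg_cst.
  apply: cvgD; first exact: cvg_cst.
  apply: cvgM => //; apply: cvgMr_tmp; apply: cvgB => //; exact: cvg_cst.
have err_lim : `|ln 2 + (1 - 0) / 2 * Lim - limit_free_energy alpha beta| + beta * 0 +
    beta * kappa = beta * kappa.
  by rewrite lE (_ : _ - _ = 0) ?normr0 ?mulr0 ?add0r//; field.
rewrite err_lim in err_cvg.
have u_cvg : u N @[N --> \oo] --> A *
  ((eps `^ p + eps `^ (p - 2) * ((10 * D + 64 * overlap_const c * D + 4) * 0)) +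
   (eps `^ p + eps `^ (p - q) * (beta `^ q * (0 * C + 2 * kappa `^ q))) +
   (eps `^ p + eps `^ (p - q) * (beta `^ q * 0)) + (beta * kappa) `^ p).
  apply: cvgMl_tmp; apply: cvgD; last first.
    have h := cvg_comp _ _ err_cvg (@continuous_powR R p _ (mulr_gt0 b0 kappa0)).
    exact: h.
  apply: cvgD.
    apply: cvgD; apply: cvgD; try exact: cvg_cst; apply: cvgMl_tmp; apply: cvgMl_tmp => //.
    by apply: cvgD; [exact: cvgMr_tmp|exact: cvg_cst].
  by apply: cvgD; [exact: cvg_cst|apply: cvgMl_tmp; exact: cvgMl_tmp].
have lim_lt : A *
  ((eps `^ p + eps `^ (p - 2) * ((10 * D + 64 * overlap_const c * D + 4) * 0)) +
   (eps `^ p + eps `^ (p - q) * (beta `^ q * (0 * C + 2 * kappa `^ q))) +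
   (eps `^ p + eps `^ (p - q) * (beta `^ q * 0)) + (beta * kappa) `^ p) < del.
  rewrite powRM ?(ltW b0) ?(ltW kappa0)//; move: heps hk1 hk2; lra.
near=> N.
have N0 : (0 < N)%N by near: N; exact: nbhs_infty_gt.
have uN : u N < del by near: N; exact: cvgr_lt lim_lt.
have cN : (N%:R%:E * \int[P0]_w (tanh (beta * ((scale P0 X N)^-1 * X w)) ^+ 2)%:E <= c%:E)%E.
  by near: N.
have CN : (N%:R%:E * \int[P0]_w (if 1 < `|(scale P0 X N)^-1 * X w|
    then `|(scale P0 X N)^-1 * X w| `^ q else 0)%:E <= C%:E)%E.
  by near: N.
have meanN : (N%:R%:E * \int[P0]_w (lncosh (beta * ((scale P0 X N)^-1 * X w)))%:E =
    (mean N)%:E)%E.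
  by rewrite fineK//; near: N.
have N5 : 0 < N%:R ^- 5 :> R by rewrite invr_gt0 exprn_gt0// ltr0n.
have qN : (\int[P0]_w (`|(scale P0 X N)^-1 * X w| `^ q)%:E < +oo)%E by near: N; exact: fq.
have oneN : (\int[P0]_w (`|(scale P0 X N)^-1 * X w| `^ 1)%:E < +oo)%E by near: N; exact: f1.
have [M [r1 rq]] := round_small (ltW q1) N5 qN oneN.
have ppq : 0 < p <= q by rewrite p0.
rewrite unlock.
apply: le_trans (finite_volume_bound N0 (measurable_jump _ _) (jump_symmetric hXsym _)
  (@hJlaw N) (hJind N) b0 c01 C0 q12 K1 hK cN CN meanN r1 rq _ ppq eps0) _.
by rewrite lee_fin ltW.
Unshelve. all: by end_near. Qed.
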